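(* Let $f$ be a smooth strictly convex function on a domain $\Omega\subset\mathbb{R}^n$. Suppose the Calabi hypersurface $M^n=\{(x,f(x))\mid x\in\Omega\}\subset\mathbb{R}^{n+1}$ has parallel cubic form, i.e. $\hat\nabla A=0$. Then $M^n$ is Calabi affine equivalent to an open part of one of the following types of hypersurfaces: (i) an elliptic paraboloid (in which case $A\equiv 0$); or (ii) a hypersurface obtained as the Calabi product of an $(n-1)$-dimensional locally strongly convex hyperbolic centroaffine hypersurface with parallel cubic form and a point; or (iii) a hypersurface obtained as the Calabi product of an $(n-1)$-dimensional Calabi hypersurface with parallel cubic form and a point; or (iv) a hypersurface obtained as the Calabi product of a lower dimensional locally strongly convex hyperbolic centroaffine hypersurface with parallel cubic form and a lower dimensional Calabi hypersurface with parallel cubic form.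
   Context: Calabi hypersurfaces. Put $Y=(0,\dots,0,1)^t\in\mathbb{R}^{n+1}$. A Calabi hypersurface is the graph immersion $x$ of $M^n=\{(x,f(x)):x\in\Omega\}$, where $f$ is a $C^\infty$ strictly convex function (positive definite Hessian) on a domain $\Omega\subset\mathbb{R}^n$, equipped with the constant transversal field $Y$ (more generally, an immersion that is locally such a graph). With $D$ the flat connection of $\mathbb{R}^{n+1}$, write $D_X x_*Z=x_*(\nabla_XZ)+G(X,Z)Y$. Then $G=\sum \frac{\partial^2 f}{\partial x_i\partial x_j}dx_idx_j$ is the Calabi metric and $\nabla$ the induced affine connection. Let $\hat\nabla$ be the Levi-Civita connection of $G$. The Fubini-Pick tensor (cubic form) is $A(X,Z)=\nabla_XZ-\hat\nabla_XZ$, also regarded as the totally symmetric form $A(X,Z,W)=G(A(X,Z),W)$; in the coordinates $x_i$, $A_{ijk}=-\frac12 f_{ijk}$. The hypersurface has parallel cubic form if $\hat\nabla A=0$. Calabi affine equivalence. Two hypersurfaces in $\mathbb{R}^{n+1}$ are Calabi affine equivalent if they differ by an affine map $X\mapsto BX+b$ with $B\in GL(n+1)$, $BY=Y$, $b\in\mathbb{R}^{n+1}$. Centroaffine hypersurfaces. An immersion $\varphi:M_1^{n_1}\to\mathbb{R}^{n_1+1}$ whose position vector is transversal is a locally strongly convex hyperbolic centroaffine hypersurface if $D_V\varphi_*W=\varphi_*(\nabla^c_VW)+g(V,W)\varphi$ with $g$ positive definite; $g$ is the centroaffine metric. Its cubic form is the difference tensor of $\nabla^c$ and the Levi-Civita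 connection of $g$; it is parallel if its covariant derivative with respect to the Levi-Civita connection of $g$ vanishes. Calabi products. Let $\varphi:M_1\to\mathbb{R}^{n_1+1}$ be an $n_1$-dimensional locally strongly convex hyperbolic centroaffine hypersurface, $\psi:M_2\to\mathbb{R}^{n_2+1}$ an $n_2$-dimensional Calabi hypersurface, and $\lambda\neq0$ a constant. Here $Y$ denotes the last standard basis vector of the ambient space. The (generalized) Calabi product of $M_1$ and $M_2$ is $x(t,p,q)=(e^t\varphi(p),\psi(q))-\frac{t}{\lambda^2}Y\in\mathbb{R}^{n_1+n_2+2}$, $t\in\mathbb{R}$, $p\in M_1$, $q\in M_2$. The Calabi product of $M_1$ and a point is $x(t,p)=(e^t\varphi(p),-\frac{t}{\lambda^2})\in\mathbb{R}^{n_1+2}$. The Calabi product of $M_2$ and a point is $x(t,q)=(e^t,\psi(q))-\frac{t}{\lambda^2}Y\in\mathbb{R}^{n_2+2}$. By convention a $0$-dimensional centroaffine (resp. Calabi) hypersurface is a constant map to a positive number (resp. an arbitrary number), with vanishing metric and cubic form. An elliptic paraboloid is the graph of $\frac12\sum x_i^2$ up to Calabi affine equivalence. *)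

(* Defs.v *)
From HB Require Import structures.
From mathcomp Require Import all_boot all_order all_algebra.
From mathcomp Require Import all_classical all_reals all_analysis.
Set Implicit Arguments.
Unset Strict Implicit.
Unset Printing Implicit Defensive.
Import Order.TTheory GRing.Theory Num.Theory.
Import numFieldNormedType.Exports.
Local Open Scope classical_set_scope.
Local Open Scope ring_scope.

(* Vectors are row vectors: linear maps act by right multiplication. *)

Section Calculus.
Context {R : realType} {n : nat}.

Definition is_domain (U : set 'rV[R]_n) : Prop :=
  [/\ open U, connected U & U !=set0].

Definition partial {V : normedModType R} (i : 'I_n) (F : 'rV[R]_n -> V)
  (x : 'rV[R]_n) : V := 'D_(delta_mx 0 i) F x.

Fixpoint Ck_on {V : normedModType R} (k : nat) (U : set 'rV[R]_n)
    (F : 'rV[R]_n -> V) : Prop :=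
  (forall x, U x -> {for x, continuous F}) /\
  if k is k'.+1 then
    forall i : 'I_n, (forall x, U x -> derivable F x (delta_mx 0 i)) /\
                     Ck_on k' U (partial i F)
  else True.

(* Only used for open U. *)
Definition smooth_on {V : normedModType R} (U : set 'rV[R]_n)
    (F : 'rV[R]_n -> V) : Prop := forall k, Ck_on k U F.

Definition posdef (G : 'M[R]_n) : Prop :=
  forall v : 'rV[R]_n, v != 0 -> 0 < (v *m G *m v^T) 0 0.

Definition hessian (f : 'rV[R]_n -> R) (x : 'rV[R]_n) : 'M[R]_n :=
  \matrix_(i, j) partial i (partial j f) x.

Definition strictly_convex_on (U : set 'rV[R]_n) (f : 'rV[R]_n -> R) : Prop :=
  forall x, U x -> posdef (hessian f x).

End Calculus.

(* Geometry of a parametrized hypersurface X with transversal field xi, in the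
   coordinates x_i of the parameter space. *)
Section RelativeGeometry.
Context {R : realType} {n : nat}.
Implicit Types X xi : 'rV[R]_n -> 'rV[R]_(n + 1).

(* Rows d_1 X, ..., d_n X, xi; invertible iff X is an immersion at x and xi is
   transversal there. *)
Definition frame X xi (x : 'rV[R]_n) : 'M[R]_(n + 1) :=
  col_mx (\matrix_i partial i X x) (xi x).

(* Components of D_{d_i} X_* d_j in the frame, i.e. the Gauss formula
   d_i d_j X = \sum_k Gamma^k_ij d_k X + G_ij xi. *)
Definition gauss X xi (i j : 'I_n) (x : 'rV[R]_n) : 'rV[R]_(n + 1) :=
  partial i (partial j X) x *m invmx (frame X xi x).

Definition induced_conn X xi (k i j : 'I_n) (x : 'rV[R]_n) : R :=
  lsubmx (gauss X xi i j x) 0 k.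

Definition metric X xi (x : 'rV[R]_n) : 'M[R]_n :=
  \matrix_(i, j) rsubmx (gauss X xi i j x) 0 0.

Definition levi_civita (g : 'rV[R]_n -> 'M[R]_n) (k i j : 'I_n)
    (x : 'rV[R]_n) : R :=
  2^-1 * \sum_l invmx (g x) k l *
    (partial i (fun y => g y j l) x + partial j (fun y => g y i l) x
     - partial l (fun y => g y i j) x).

(* A^k_ij *)
Definition cubic X xi (k i j : 'I_n) (x : 'rV[R]_n) : R :=
  induced_conn X xi k i j x - levi_civita (metric X xi) k i j x.

(* (\hat\nabla_l A)^k_ij *)
Definition cov_cubic X xi (l k i j : 'I_n) (x : 'rV[R]_n) : R :=
  let LC := levi_civita (metric X xi) in
  let A := cubic X xi in
  partial l (A k i j) x
  + \sum_m (LC k l m x * A m i j x - LC m l i x * A k m j x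
            - LC m l j x * A k i m x).

Definition parallel_cubic (U : set 'rV[R]_n) X xi : Prop :=
  forall x, U x -> forall l k i j, cov_cubic X xi l k i j x = 0.

Definition zero_cubic (U : set 'rV[R]_n) X xi : Prop :=
  forall x, U x -> forall k i j, cubic X xi k i j x = 0.

Definition Yvec : 'rV[R]_(n + 1) := row_mx 0 1%:M.

Definition graph (f : 'rV[R]_n -> R) (x : 'rV[R]_n) : 'rV[R]_(n + 1) :=
  row_mx x (f x)%:M.

Definition half_sqnorm (x : 'rV[R]_n) : R := 2^-1 * \sum_i x 0 i ^+ 2.

End RelativeGeometry.
Arguments Yvec R n : clear implicits.

Section Hypersurfaces.
Context {R : realType} {n : nat}.

(* u maps the open set U homeomorphically onto an open subset of M. *)
Definition open_embedding_on {M : topologicalType} (U : set 'rV[R]_n)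
    (u : 'rV[R]_n -> M) : Prop :=
  [/\ open U,
      forall x, U x -> {for x, continuous u},
      forall W : set 'rV[R]_n, W `<=` U -> open W -> open (u @` W)
    & set_inj U u].

Definition manifold_space (M : topologicalType) : Prop :=
  [/\ hausdorff_space M, @second_countable M & connected [set: M]].

(* The smooth structure of an immersed hypersurface phi : M -> R^(n+1) is given
   by the open embeddings u of open sets of R^n into M for which phi \o u is a
   smooth immersion: two such u differ by a diffeomorphism, because a smooth
   immersion has a smooth local left inverse.  The metric and the cubic form
   are tensors, so it is enough to have a condition on them in one chart
   around each point. *)

Definition centroaffine_chart {M : topologicalType} (phi : M -> 'rV[R]_(n + 1))
    (U : set 'rV[R]_n) (u : 'rV[R]_n -> M) : Prop :=
  let X := phi \o u in
  [/\ open_embedding_on U u,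
      smooth_on U X,
      forall x, U x -> frame X X x \in unitmx
    & forall x, U x -> posdef (metric X X x)].

(* Locally strongly convex hyperbolic centroaffine hypersurface.  In dimension
   0 there is no metric to fix the sign of phi, which is positive by
   convention. *)
Definition centroaffine_hypersurface {M : topologicalType}
    (phi : M -> 'rV[R]_(n + 1)) : Prop :=
  [/\ manifold_space M,
      forall p, exists U u, (u @` U) p /\ centroaffine_chart phi U u
    & n = 0%N -> forall p i, 0 < phi p 0 i].

Definition centroaffine_parallel {M : topologicalType}
    (phi : M -> 'rV[R]_(n + 1)) : Prop :=
  forall p, exists U u,
    [/\ (u @` U) p, centroaffine_chart phi U u
      & parallel_cubic U (phi \o u) (phi \o u)].

(* On the open set u @` U, psi is the graph of h. *)
Definition calabi_chart {M : topologicalType} (psi : M -> 'rV[R]_(n + 1))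
    (U : set 'rV[R]_n) (h : 'rV[R]_n -> R) (u : 'rV[R]_n -> M) : Prop :=
  [/\ is_domain U, smooth_on U h, strictly_convex_on U h, open_embedding_on U u
    & forall y, U y -> psi (u y) = graph h y].

Definition calabi_hypersurface {M : topologicalType}
    (psi : M -> 'rV[R]_(n + 1)) : Prop :=
  manifold_space M /\
  forall p, exists U h u, (u @` U) p /\ calabi_chart psi U h u.

Definition calabi_parallel {M : topologicalType}
    (psi : M -> 'rV[R]_(n + 1)) : Prop :=
  forall p, exists U h u,
    [/\ (u @` U) p, calabi_chart psi U h u
      & parallel_cubic U (graph h) (fun=> Yvec R n)].

(* Some Calabi affine image of the graph of f over Omega is an open part of the
   immersed hypersurface x : N -> R^m, that is, the restriction of x to an open
   subset of N, reparametrized over Omega by h.  Reparametrizations need only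
   be topological: when x is an immersion, h is then smooth, as above. *)
Definition calabi_equiv_open_part (Omega : set 'rV[R]_n) (f : 'rV[R]_n -> R)
    {N : topologicalType} {m : nat} (x : N -> 'rV[R]_m) : Prop :=
  exists (e : m = (n + 1)%N) (B : 'M[R]_(n + 1)) (b : 'rV[R]_(n + 1))
         (h : 'rV[R]_n -> N),
    [/\ B \in unitmx, Yvec R n *m B = Yvec R n, open_embedding_on Omega h
      & forall y, Omega y ->
          graph f y *m B + b = castmx (erefl 1%N, e) (x (h y))].

End Hypersurfaces.

Section CalabiProducts.
Context {R : realType}.

Definition calabi_product {n1 n2 : nat} {M1 M2 : topologicalType} (lam : R)
    (phi : M1 -> 'rV[R]_(n1 + 1)) (psi : M2 -> 'rV[R]_(n2 + 1))
    (z : R * M1 * M2) : 'rV[R]_((n1 + 1) + (n2 + 1)) :=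
  let: (t, p, q) := z in
  row_mx (expR t *: phi p) (psi q) - (t / lam ^+ 2) *: row_mx 0 (Yvec R n2).

Definition calabi_product_centroaffine_point {n1 : nat} {M1 : topologicalType}
    (lam : R) (phi : M1 -> 'rV[R]_(n1 + 1)) (z : R * M1) :
    'rV[R]_((n1 + 1) + 1) :=
  let: (t, p) := z in row_mx (expR t *: phi p) (- (t / lam ^+ 2))%:M.

Definition calabi_product_calabi_point {n2 : nat} {M2 : topologicalType}
    (lam : R) (psi : M2 -> 'rV[R]_(n2 + 1)) (z : R * M2) :
    'rV[R]_(1 + (n2 + 1)) :=
  let: (t, q) := z in
  row_mx (expR t)%:M (psi q) - (t / lam ^+ 2) *: row_mx 0 (Yvec R n2).

End CalabiProducts.

(* Main.v *)
(* The difference tensor A turns every tangent space into a commutative algebra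
   whose multiplications are self-adjoint for the Calabi metric, and for a
   parallel cubic form the commutators of multiplications are derivations: these
   are Jordan algebras.  Hence the inverse Hessian H of f is a polynomial of
   degree at most 2, and the algebra at a point x0 has an idempotent e0 which is
   a unit on a complement of the annihilator.  Let P be the multiplication by
   e0.  Then e(y) = e0 + (y - x0) P is the unit of the algebra at y, and after
   subtracting a linear function and a quadratic function of the annihilator
   directions, f becomes a function F that is constant in these directions and
   satisfies dF(e) = -1/mu.

   If P = 0, then F is constant and the graph is a paraboloid.  Otherwise
   y |-> exp(mu F(y)) e(y) is constant along e and the annihilator, its image is
   the centroaffine factor of a Calabi product, the other factor is a paraboloid
   in the annihilator, possibly of dimension 0 (which subsumes the products with
   a point).  As Omega is arbitrary, this image may be immersed only, and it has
   to carry the quotient topology. *)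
From HB Require Import structures.
Require Import Defs.
From mathcomp Require Import all_boot all_order all_algebra.
From mathcomp Require Import all_classical all_reals all_analysis.
From mathcomp Require Import ring lra zify.
Set Implicit Arguments.
Unset Strict Implicit.
Unset Printing Implicit Defensive.
Import Order.TTheory GRing.Theory Num.Theory.
Import numFieldNormedType.Exports.
Local Open Scope classical_set_scope.
Local Open Scope ring_scope.

(** * Smooth functions of several variables *)

(** In graph coordinates the induced connection vanishes, so the Levi-Civita coefficients are [-A]
    and a parallel cubic form makes every derivative of a multiplication a polynomial in
    multiplications. Equality of mixed derivatives then yields the derivation property, and the
    third derivative of [H] vanishes by the linearised Jordan identity together with its adjoint.
    The idempotent comes from the vector [s] representing the form [tr (L y)]: multiplication by [s]
    kills only the annihilator, so [s] can be divided by itself. The obstacle is global. Points of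
    the domain with the same value of the projection may be far apart, and the fibres may be
    disconnected, so nothing can be transported along a path. What helps is that [H] is the
    quadratic representation of the unit field on the complement of the annihilator: proportional
    unit fields have inversely proportional gradients, and an explicit affine map identifies the two
    neighbourhoods. This makes the quotient map open. The constant [1/mu] is the squared length of
    the unit field, the same at all points, and the product has [lam^2 = mu]. *)

Section LineCalculus.
Context {R : realType} {V : normedModType R}.
Implicit Types (F : V -> R) (x v : V).

Lemma is_derive_line F x v t : derivable F (x + t *: v) v ->
  is_derive t 1 (fun s => F (x + s *: v)) ('D_v F (x + t *: v)).
Proof.
move=> dF.
have E : (fun h : R => h^-1 *: (((fun s => F (x + s *: v)) \o shift t) (h *: (1:R))
                          - F (x + t *: v))) =
         (fun h : R => h^-1 *: ((F \o shift (x + t *: v)) (h *: v) - F (x + t *: v))).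
  apply: funext => h; congr (_ *: (F _ - _)) => /=.
  by rewrite [h *: 1]mulr1 scalerDl addrCA.
by split; [rewrite /derivable E | rewrite /derive E].
Qed.

(** The intermediate point is given as a fraction of [a], which treats both signs of [a] at once. *)
Lemma line_MVT F x v a :
  (forall s, 0 <= s <= 1 -> derivable F (x + (s * a) *: v) v) ->
  exists2 s, 0 <= s <= 1 & F (x + a *: v) - F x = a * 'D_v F (x + (s * a) *: v).
Proof.
move=> dF; pose g t := F (x + t *: v); pose dg t := 'D_v F (x + t *: v).
have [->|a0] := eqVneq a 0.
  by exists 0; rewrite ?lexx ?ler01 // scale0r addr0 subrr mul0r.
have gP t : 0 <= t / a <= 1 -> is_derive t 1 g (dg t).
  move=> t01; have dFt := dF _ t01.
  rewrite (divfK a0) in dFt.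
  exact: (is_derive_line dFt).
have sP c : 0 <= c / a <= 1 -> g a - g 0 = dg c * a ->
    exists2 s, 0 <= s <= 1 & F (x + a *: v) - F x = a * 'D_v F (x + (s * a) *: v).
  move=> c01 E; exists (c / a) => //; rewrite divfK // [RHS]mulrC -[RHS]E.
  by rewrite /g scale0r addr0.
have [alt|agt|/eqP] := ltgtP a 0; last by rewrite (negbTE a0).
- have I c : c \in `[a, 0] -> 0 <= c / a <= 1.
    rewrite in_itv /= => /andP[ac c0]; rewrite ler_ndivlMr // mul0r c0.
    by rewrite ler_ndivrMr // mul1r ac.
  have [|||c /I cI E] := @MVT_segment R g dg a 0.
  + exact: ltW.
  + by move=> t tI; apply/gP/I; exact: subset_itv_oo_cc.
  + by apply: derivable_within_continuous => t /I /gP [].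
  + by apply: (sP c) => //; rewrite -opprB E sub0r mulrN opprK.
- have I c : c \in `[0, a] -> 0 <= c / a <= 1.
    rewrite in_itv /= => /andP[ac c0]; rewrite ler_pdivlMr // mul0r ac.
    by rewrite ler_pdivrMr // mul1r c0.
  have [|||c /I cI E] := @MVT_segment R g dg 0 a.
  + exact: ltW.
  + by move=> t tI; apply/gP/I; exact: subset_itv_oo_cc.
  + by apply: derivable_within_continuous => t /I /gP [].
  + by apply: (sP c) => //; rewrite E subr0.
Qed.

End LineCalculus.

Section Differentiability.
Context {R : realType} {n : nat}.
Implicit Types (F G : 'rV[R]_n -> R) (U : set 'rV[R]_n) (x v : 'rV[R]_n).

Lemma norm_row_lt x (e : R) : 0 < e -> (`|x| < e) = [forall j, `|x 0 j| < e].
Proof.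
move=> e0; apply/idP/forallP => [xe j|xe].
  apply: le_lt_trans xe; rewrite {2}/Num.Def.normr /= mx_normrE.
  exact: (le_bigmax _ (fun ij => `|x ij.1 ij.2|) (0, j)).
rewrite /Num.Def.normr /= mx_normrE; apply: bigmax_lt => // -[i j] _ /=.
by rewrite ord1 xe.
Qed.

Lemma norm_row_le x (e : R) : 0 <= e -> (`|x| <= e) = [forall j, `|x 0 j| <= e].
Proof.
move=> e0; apply/idP/forallP => [xe j|xe].
  apply: le_trans xe; rewrite {2}/Num.Def.normr /= mx_normrE.
  exact: (le_bigmax _ (fun ij => `|x ij.1 ij.2|) (0, j)).
rewrite /Num.Def.normr /= mx_normrE; apply: bigmax_le => // -[i j] _ /=.
by rewrite ord1 xe.
Qed.

(** Keeping the first [k] coordinates, for [k] from 0 to [n], gives the corners of a staircase from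
    0 to [h] with edges parallel to the axes. *)
Definition headpart k (h : 'rV[R]_n) : 'rV[R]_n :=
  \row_j if (j < k)%N then h 0 j else 0.

Lemma headpart0 h : headpart 0 h = 0.
Proof. by apply/rowP => j; rewrite !mxE. Qed.

Lemma headpart_max h : headpart n h = h.
Proof. by apply/rowP => j; rewrite !mxE ltn_ord. Qed.

Lemma headpartS h (k : 'I_n) :
  headpart k.+1 h = headpart k h + h 0 k *: delta_mx 0 k.
Proof.
apply/rowP => j; rewrite !mxE eqxx /= ltnS leq_eqVlt.
case: (eqVneq (j : nat) k) => [/val_inj->|jk] /=.
  by rewrite ltnn eqxx mulr1 add0r.
by rewrite -(inj_eq val_inj) /= (negbTE jk) mulr0 addr0.
Qed.

(** In the sup norm the staircase stays in the closed ball of radius [|h|], so the mean value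
    theorem on its edges needs information on a ball only. *)
Lemma norm_headpart k h c : 0 <= c <= 1 ->
  `|headpart k h + c *: (headpart k.+1 h - headpart k h)| <= `|h|.
Proof.
move=> /andP[c0 c1]; rewrite norm_row_le //; apply/forallP => i.
have hi : `|h 0 i| <= `|h|.
  by move: (lexx `|h|); rewrite {1}norm_row_le // => /forallP.
rewrite !mxE ltnS [(i <= k)%N]leq_eqVlt; case: ltngtP => _ /=.
- by rewrite addrN mulr0 addr0.
- by rewrite addrN mulr0 addr0 normr0.
- rewrite add0r oppr0 addr0 normrM ger0_norm //; apply: le_trans hi.
  by rewrite ler_piMl.
Qed.

(** The increment of [F] telescopes along the staircase of [h]. On each edge the mean value theorem
    gives a partial derivative at a point near [x], and continuity bounds its distance to the one at
    [x]. *)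
Lemma C1_differentiable F U x : open U ->  U x ->
  (forall i y, U y -> derivable F y (delta_mx 0 i)) ->
  (forall i, {for x, continuous (partial i F)}) ->
  differentiable F x.
Proof.
move=> oU Ux dF cF.
pose df (h : 'rV[R]_n) : R := \sum_i h 0 i * partial i F x.
have df_lin : linear df.
  move=> a h k; rewrite /df scaler_sumr -big_split /=; apply: eq_bigr => i _.
  by rewrite !mxE mulrDl -mulrA.
pose dfL := GRing.isLinear.Build _ _ _ _ df df_lin.
pose dfl : {linear 'rV[R]_n -> R} := HB.pack df dfL.
have dfc : continuous dfl.
  move=> h; rewrite /dfl /=.
  apply: differentiable_continuous.
  rewrite /df; have -> : (fun h : 'rV[R]_n => \sum_i h 0 i * partial i F x) =
     \sum_i (fun h : 'rV[R]_n => h 0 i * partial i F x).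
    by apply: funext => y; rewrite fct_sumE.
  apply: differentiable_sum => i; apply: differentiableM => //.
  exact: differentiable_coord.
suff E : F \o shift x = cst (F x) + (dfl : 'rV[R]_n -> R^o)
    +o_ (0 : 'rV[R]_n) (id : 'rV[R]_n -> 'rV[R]_n).
  by apply/diff_locallyP; rewrite (diff_unique dfc E).
apply/eqaddoP => _ /posnumP[e].
(* Each of the [n] edges contributes an error of at most [d * |h|]; the successor keeps the quotient
   meaningful for [n = 0]. *)
pose d := e%:num / n.+1%:R.
have d0 : 0 < d by rewrite divr_gt0.
have [r r0 [rU rc]] : exists2 r : R, 0 < r & (ball x r `<=` U) /\
    forall i y, ball x r y -> `|partial i F x - partial i F y| < d.
  have : \forall y \near x, U y /\ forall i, `|partial i F x - partial i F y| < d.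
    near=> y; split; first by near: y; exact: open_nbhs_nbhs.
    near: y; apply: filter_forall => i.
    by move/cvgrPdist_lt : (cF i); apply.
  by move=> /nbhs_ballP[r /= r0 rP]; exists r => //; split => [y /rP[]|i y /rP[_]].
near=> h.
have hr : `|h| < r.
  near: h; apply/nbhs_ballP; exists r => //= y.
  by rewrite -ball_normE /= sub0r normrN.
have xB y : `|y| <= `|h| -> ball x r (x + y).
  by move=> yh; rewrite -ball_normE /= opprD addrA subrr sub0r normrN (le_lt_trans yh).
have tel : F (x + h) - F x =
    \sum_(i < n) (F (x + headpart i.+1 h) - F (x + headpart i h)).
  have := telescope_sumr (fun k => F (x + headpart k h)) (leq0n n).
  by rewrite big_mkord => ->; rewrite headpart_max headpart0 addr0.
rewrite /= !fctE /= [h + x]addrC opprD addrA tel /df -sumrB.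
apply: le_trans (ler_norm_sum _ _ _) _.
apply: (@le_trans _ _ (\sum_(i < n) d * `|h|)); last first.
  rewrite sumr_const card_ord -mulr_natr mulrAC ler_wpM2r //.
  by rewrite /d -mulrA ler_piMr // mulrC ler_pdivrMr // mul1r ler_nat.
apply: ler_sum => i _.
have hi : `|h 0 i| <= `|h|.
  by move: (lexx `|h|); rewrite {1}norm_row_le // => /forallP.
have inB c : 0 <= c <= 1 ->
    ball x r (x + headpart i h + (c * h 0 i) *: delta_mx 0 i).
  move=> c01; rewrite -addrA; apply: xB.
  have -> : (c * h 0 i) *: delta_mx 0 i = c *: (headpart i.+1 h - headpart i h).
    by rewrite headpartS addrAC addrN add0r scalerA.
  exact: norm_headpart.
have [|c c01] := @line_MVT R _ F (x + headpart i h) (delta_mx 0 i) (h 0 i).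
  by move=> s s01; apply/dF/rU/inB.
rewrite -addrA -headpartS => ->.
rewrite -mulrBr normrM mulrC ler_pM //; apply: ltW.
by rewrite distrC; apply: rc; apply: inB.
Unshelve. all: by end_near. Qed.

Lemma derive_partial F x v : differentiable F x ->
  'D_v F x = \sum_i v 0 i * partial i F x.
Proof.
move=> dF; rewrite deriveE // {1}(row_sum_delta v) linear_sum /=.
by apply: eq_bigr => i _; rewrite linearZ /= /partial deriveE.
Qed.

End Differentiability.

Section Smoothness.
Context {R : realType}.

Section General.
Context {n : nat} {V : normedModType R}.
Implicit Types (F G : 'rV[R]_n -> V) (U : set 'rV[R]_n).

Lemma Ck_cont k U F x : Ck_on k U F -> U x -> {for x, continuous F}.
Proof. by case: k => [|k] [cF _] /cF. Qed.

Lemma Ck_ext k U F G : open U -> (forall x, U x -> F x = G x) ->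
  Ck_on k U F -> Ck_on k U G.
Proof.
move=> oU; elim: k F G => [|k IH] F G FG /= [cF dF].
all: have nFG x : U x -> \near x, F x = G x.
all: try by move=> Ux; apply: filterS (open_nbhs_nbhs (conj oU Ux)); exact: FG.
  split => // x Ux.
  move: (cF x Ux); rewrite /prop_for /continuous_at (FG x Ux); apply: cvg_trans.
  exact: (near_eq_cvg (nFG x Ux)).
split=> [x Ux|i].
  move: (cF x Ux); rewrite /prop_for /continuous_at (FG x Ux); apply: cvg_trans.
  exact: (near_eq_cvg (nFG x Ux)).
have [di ci] := dF i; split=> [x Ux|].
  by apply: near_eq_derivable (nFG x Ux) (di x Ux).
apply: IH ci => x Ux; exact/near_eq_derive/nFG.
Qed.

Lemma Ck_onW k U F : Ck_on k.+1 U F -> Ck_on k U F.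
Proof.
elim: k F => [|k IH] F [cF dF]; split=> // i.
by have [di ci] := dF i; split=> //; apply: IH.
Qed.

Lemma smooth_partial U F i : smooth_on U F -> smooth_on U (partial i F).
Proof. by move=> sF k; have [_ /(_ i)[]] := sF k.+1. Qed.

Lemma smooth_ext U F G : open U -> (forall x, U x -> F x = G x) ->
  smooth_on U F -> smooth_on U G.
Proof. by move=> oU FG sF k; apply: Ck_ext (sF k). Qed.

End General.

Section Scalar.
Context {n : nat}.
Implicit Types (F G : 'rV[R]_n -> R) (U : set 'rV[R]_n) (x : 'rV[R]_n).

Lemma Ck_differentiable k U F x : open U -> Ck_on k.+1 U F -> U x ->
  differentiable F x.
Proof.
move=> oU [_ dF] Ux; apply: (C1_differentiable oU Ux) => i.
  by move=> y Uy; have [+ _] := dF i; apply.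
by have [_ +] := dF i => /Ck_cont; apply.
Qed.

Lemma smooth_differentiable U F x : open U -> smooth_on U F -> U x ->
  differentiable F x.
Proof. by move=> oU /(_ 1%N); exact: Ck_differentiable. Qed.

(* To establish smoothness order by order, it suffices to know the partial
   derivatives up to equality on U. *)
Lemma Ck_step k U F (dF : 'I_n -> 'rV[R]_n -> R) : open U ->
  (forall x, U x -> differentiable F x) ->
  (forall i x, U x -> partial i F x = dF i x) ->
  (forall i, Ck_on k U (dF i)) -> Ck_on k.+1 U F.
Proof.
move=> oU diffF pF cdF; split=> [x Ux|i].
  exact/differentiable_continuous/diffF.
split=> [x Ux|]; first exact/diff_derivable/diffF.
by apply: Ck_ext (cdF i) => // x Ux; rewrite pF.
Qed.

Lemma Ck_cst k U (c : R) : open U -> Ck_on k U (fun=> c).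
Proof.
move=> oU; elim: k c => [|k IH] c; first by split=> // x _; exact: cst_continuous.
apply: (Ck_step oU (dF := fun _ _ => 0)) => // i x _.
by rewrite /partial derive_cst.
Qed.

Lemma CkD k U F G : open U -> Ck_on k U F -> Ck_on k U G ->
  Ck_on k U (fun x => F x + G x).
Proof.
move=> oU; elim: k F G => [|k IH] F G.
  by move=> cF cG; split=> // x Ux; exact: (continuousD (Ck_cont cF Ux) (Ck_cont cG Ux)).
move=> cF cG.
have dF x := Ck_differentiable oU cF (x := x).
have dG x := Ck_differentiable oU cG (x := x).
apply: (Ck_step oU (dF := fun i x => partial i F x + partial i G x)).
- by move=> x Ux; apply: differentiableD; [exact: dF|exact: dG].
- move=> i x Ux; rewrite /partial -deriveD //; apply/diff_derivable; [exact: dF|exact: dG].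
- by move=> i; case: cF cG => [_ /(_ i)[_ ?]] [_ /(_ i)[_ ?]]; apply: IH.
Qed.

Lemma CkM k U F G : open U -> Ck_on k U F -> Ck_on k U G ->
  Ck_on k U (fun x => F x * G x).
Proof.
move=> oU; elim: k F G => [|k IH] F G.
  by move=> cF cG; split=> // x Ux; exact: (continuousM (Ck_cont cF Ux) (Ck_cont cG Ux)).
move=> cF cG.
have dF x := Ck_differentiable oU cF (x := x).
have dG x := Ck_differentiable oU cG (x := x).
apply: (Ck_step oU (dF := fun i x => F x * partial i G x + G x * partial i F x)).
- by move=> x Ux; apply: differentiableM; [exact: dF|exact: dG].
- move=> i x Ux; rewrite /partial [LHS](@deriveM _ _ F G) //; apply/diff_derivable; [exact: dF|exact: dG].
- move=> i; case: (cF) (cG) => [_ /(_ i)[_ ?]] [_ /(_ i)[_ ?]].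
  by apply: CkD => //; apply: IH => //; exact: Ck_onW.
Qed.

Lemma CkV k U F : open U -> (forall x, U x -> F x != 0) -> Ck_on k U F ->
  Ck_on k U (fun x => (F x)^-1).
Proof.
move=> oU F0; elim: k => [|k IH] cF.
  by split=> // x Ux; exact: (continuousV (F0 x Ux) (Ck_cont cF Ux)).
have dF x := Ck_differentiable oU cF (x := x).
have cV := IH (Ck_onW cF).
apply: (Ck_step oU (dF := fun i x => ((F x)^-1 * (F x)^-1) * (-1 * partial i F x))).
- by move=> x Ux; apply: differentiableV; [exact: dF|exact: F0].
- move=> i x Ux; rewrite /partial [LHS](@deriveV _ _ F) //; last 2 first.
    exact: F0.
    exact/diff_derivable/dF.
  by rewrite -[_ *: _]/(_ * _) mulN1r mulrN mulNr -exprVn.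
- move=> i; case: (cF) => [_ /(_ i)[_ ?]]; apply: CkM => //; first exact: CkM.
  by apply: CkM => //; exact: Ck_cst.
Qed.

Lemma differentiable_expR F x : differentiable F x ->
  differentiable (fun x => expR (F x)) x.
Proof.
move=> dF; have dE : differentiable expR (F x).
  exact/derivable1_diffP/derivable_expR.
exact: (differentiable_comp dF dE).
Qed.

Lemma partial_expR F x i : differentiable F x ->
  partial i (fun x => expR (F x)) x = expR (F x) * partial i F x.
Proof.
move=> dF; rewrite /partial deriveE; last exact: differentiable_expR.
rewrite (@diff_comp _ _ _ _ F expR) //; last exact/derivable1_diffP/derivable_expR.
rewrite /= deriv1E; last exact: derivable_expR.
by rewrite derive1E (@derive_val _ _ _ _ _ _ _ (is_derive_expR _)) deriveE // -[_ *: _]/(_ * _) mulrC.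
Qed.

Lemma Ck_expR k U F : open U -> Ck_on k U F ->
  Ck_on k U (fun x => expR (F x)).
Proof.
move=> oU; elim: k => [|k IH] cF.
  split=> // x Ux; apply: (@continuous_comp _ _ _ F expR); last exact: continuous_expR.
  exact: Ck_cont cF Ux.
have dF x := Ck_differentiable oU cF (x := x).
apply: (Ck_step oU (dF := fun i x => expR (F x) * partial i F x)).
- by move=> x Ux; apply/differentiable_expR/dF.
- by move=> i x Ux; apply/partial_expR/dF.
- move=> i; case: (cF) => [_ /(_ i)[_ ?]]; apply: CkM => //.
  exact/IH/Ck_onW.
Qed.

Lemma Ck_sum (I : Type) (r : seq I) (P : pred I) k U (F : I -> 'rV[R]_n -> R) : open U ->
  (forall i, P i -> Ck_on k U (F i)) -> Ck_on k U (fun x => \sum_(i <- r | P i) F i x).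
Proof.
move=> oU cF; elim: r => [|i r IH].
  by apply: Ck_ext (Ck_cst k 0 oU) => // x _; rewrite big_nil.
case: (boolP (P i)) => Pi.
  by apply: Ck_ext (CkD oU (cF i Pi) IH) => // x _; rewrite big_cons Pi.
by apply: Ck_ext IH => // x _; rewrite big_cons (negbTE Pi).
Qed.

Lemma Ck_prod (I : Type) (r : seq I) (P : pred I) k U (F : I -> 'rV[R]_n -> R) : open U ->
  (forall i, P i -> Ck_on k U (F i)) -> Ck_on k U (fun x => \prod_(i <- r | P i) F i x).
Proof.
move=> oU cF; elim: r => [|i r IH].
  by apply: Ck_ext (Ck_cst k 1 oU) => // x _; rewrite big_nil.
case: (boolP (P i)) => Pi.
  by apply: Ck_ext (CkM oU (cF i Pi) IH) => // x _; rewrite big_cons Pi.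
by apply: Ck_ext IH => // x _; rewrite big_cons (negbTE Pi).
Qed.

Lemma derive_coord x v j : 'D_v (fun y : 'rV[R]_n => y 0 j) x = v 0 j.
Proof.
have := @derive_mx R 'rV[R]_n 1 n id x v (@derivable_id _ _ _ _).
by move/matrixP/(_ 0 j); rewrite derive_id mxE.
Qed.

Lemma partial_coord i j x : partial i (fun y : 'rV[R]_n => y 0 j) x = (i == j)%:R.
Proof. by rewrite /partial derive_coord mxE eqxx eq_sym. Qed.

Lemma Ck_coord k U j : open U -> Ck_on k U (fun x => x 0 j).
Proof.
move=> oU; case: k => [|k].
  by split=> // x _; exact: coord_continuous.
apply: (Ck_step oU (dF := fun i _ => (i == j)%:R)) => [x _|i x _|i].
- exact: differentiable_coord.
- by rewrite partial_coord.
- exact: Ck_cst.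
Qed.

End Scalar.

Section AffineComp.
Context {n m : nat}.
Implicit Types (F : 'rV[R]_n -> R) (U : set 'rV[R]_n) (W : set 'rV[R]_m)
  (a : 'rV[R]_n) (M : 'M[R]_(m, n)) (y v : 'rV[R]_m).

Lemma differentiable_affine a M y : differentiable (fun y => a + y *m M) y.
Proof.
apply: differentiableD => //.
have -> : (mulmx^~ M) = \sum_i (fun y : 'rV[R]_m => y 0 i *: row i M).
  by apply: funext => z; rewrite mulmx_sum_row fct_sumE.
apply: differentiable_sum => i.
exact/differentiableZl/differentiable_coord.
Qed.

Lemma derive_affine_comp (V : normedModType R) (F : 'rV[R]_n -> V) a M y v :
  'D_v (fun y => F (a + y *m M)) y = 'D_(v *m M) F (a + y *m M).
Proof.
rewrite /derive; suff -> : (fun h : R => h^-1 *: (((fun y => F (a + y *m M)) \o shift y)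
    (h *: v) - F (a + y *m M))) =
  (fun h : R => h^-1 *: ((F \o shift (a + y *m M)) (h *: (v *m M)) - F (a + y *m M))) by [].
by apply: funext => h /=; rewrite mulmxDl scalemxAl addrCA.
Qed.

Lemma differentiable_affine_comp F a M y :
  differentiable F (a + y *m M) -> differentiable (fun y => F (a + y *m M)) y.
Proof.
move=> dF; exact: (differentiable_comp (differentiable_affine a M y) dF).
Qed.

Lemma Ck_affine_comp k U W F a M : open U -> open W ->
  (forall y, W y -> U (a + y *m M)) -> Ck_on k U F ->
  Ck_on k W (fun y => F (a + y *m M)).
Proof.
move=> oU oW WU; elim: k F => [|k IH] F cF.
  split=> // y Wy; apply: (@continuous_comp _ _ _ (fun y => a + y *m M) F).
    exact/differentiable_continuous/differentiable_affine.
  exact/(Ck_cont cF)/WU.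
have dF x := Ck_differentiable oU cF (x := x).
apply: (Ck_step oW (dF := fun i y => \sum_j M i j * partial j F (a + y *m M))).
- by move=> y Wy; apply/differentiable_affine_comp/dF/WU.
- move=> i y Wy; rewrite /partial derive_affine_comp derive_partial; last exact/dF/WU.
  by apply: eq_bigr => j _; rewrite -rowE mxE.
- move=> i; apply: Ck_sum => // j _; apply: CkM => //; first exact: Ck_cst.
  by apply: IH; case: cF => _ /(_ j)[].
Qed.

End AffineComp.

End Smoothness.

(** * Symmetry of second derivatives; functions with zero derivative *)

Section SecondDerivatives.
Context {R : realType} {n : nat}.
Implicit Types (F G : 'rV[R]_n -> R) (U : set 'rV[R]_n) (x : 'rV[R]_n).

(** The left side is symmetric in [i] and [j]. The mean value theorem along [j], applied to the
    increment in direction [i], and then once more along [i], turns it into one particular mixed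
    derivative. *)
Lemma second_difference U F x i j h : open U -> smooth_on U F ->
  (forall a b, 0 <= a <= 1 -> 0 <= b <= 1 ->
     U (x + (a * h) *: delta_mx 0 i + (b * h) *: delta_mx 0 j)) ->
  exists a b p, [/\ 0 <= a <= 1, 0 <= b <= 1,
    p = partial i (partial j F) (x + (a * h) *: delta_mx 0 i + (b * h) *: delta_mx 0 j) &
    F (x + h *: delta_mx 0 i + h *: delta_mx 0 j) - F (x + h *: delta_mx 0 i)
      - F (x + h *: delta_mx 0 j) + F x =
    h * (h * p)].
Proof.
move=> oU sF inU.
have dF y : U y -> differentiable F y by exact: smooth_differentiable.
have dpF y : U y -> differentiable (partial j F) y.
  by apply: smooth_differentiable => //; exact: smooth_partial.
pose ei : 'rV[R]_n := delta_mx 0 i; pose ej : 'rV[R]_n := delta_mx 0 j.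
have shiftd y z v : differentiable F (y + z) ->
    is_derive y v (fun y => F (y + z)) ('D_v F (y + z)).
  move=> dFyz.
  have E : (fun y => F (y + z)) = (fun y => F (z + y *m 1%:M)).
    by apply: funext => w; rewrite mulmx1 addrC.
  rewrite E; split.
    by apply/diff_derivable/differentiable_affine_comp; rewrite mulmx1 addrC.
  by rewrite derive_affine_comp !mulmx1 [z + y]addrC.
pose G := (fun y => F (y + h *: ei)) - F.
have i0 : 0 <= (0 : R) <= 1 by rewrite lexx ler01.
have i1 : 0 <= (1 : R) <= 1 by rewrite lexx ler01.
have dG s : 0 <= s <= 1 -> is_derive (x + (s * h) *: ej) ej G
    (partial j F (x + (s * h) *: ej + h *: ei) - partial j F (x + (s * h) *: ej)).
  move=> s01; apply: is_deriveB.
    by apply: shiftd; apply: dF; have := inU 1 s i1 s01; rewrite mul1r addrAC.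
  apply/derivableP/diff_derivable/dF.
  by have := inU 0 s i0 s01; rewrite mul0r scale0r addr0.
have [|b b01] := @line_MVT R _ G x ej h; first by move=> s /dG [].
rewrite (@derive_val _ _ _ _ _ _ _ (dG b b01)) => E1.
have [|a a01 E2] := @line_MVT R _ (partial j F) (x + (b * h) *: ej) ei h.
  move=> s s01; apply/diff_derivable/dpF; rewrite addrAC; exact: inU.
have ptE : x + (b * h) *: ej + (a * h) *: ei = x + (a * h) *: ei + (b * h) *: ej.
  by rewrite addrAC.
rewrite ptE in E2.
have [p Ep] : exists p, p = 'D_ei (partial j F) (x + (a * h) *: ei + (b * h) *: ej).
  by eexists.
rewrite -Ep in E2; exists a, b, p; split; [exact: a01|exact: b01|exact: Ep|].
rewrite -E2 -E1.
rewrite /G !fctE /= [x + _ + _]addrAC; ring.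
Qed.

(** The same second difference equals either mixed derivative at some point near [x]; continuity
    carries the equality to [x]. *)
Lemma partialC U F x i j : open U -> smooth_on U F -> U x ->
  partial i (partial j F) x = partial j (partial i F) x.
Proof.
move=> oU sF Ux; apply/eqP; rewrite -subr_eq0 -normr_eq0; apply/eqP/le_anti.
rewrite normr_ge0 andbT; apply/ler_addgt0Pr => e e0; rewrite add0r.
have cont k l : {for x, continuous (partial k (partial l F))}.
  by apply: (Ck_cont (k := 0) (U := U)) => //; do 2 apply: smooth_partial.
have : \forall y \near x, [/\ U y,
    `|partial i (partial j F) x - partial i (partial j F) y| < e / 2 &
    `|partial j (partial i F) x - partial j (partial i F) y| < e / 2].
  have e2 : 0 < e / 2 by rewrite divr_gt0.
  have Ux' := open_nbhs_nbhs (conj oU Ux).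
  have c1 : \forall t \near x, `|partial i (partial j F) x - partial i (partial j F) t| < e / 2.
    exact: ((cvgrPdist_lt _ _).1 (cont i j) _ e2).
  have c2 : \forall t \near x, `|partial j (partial i F) x - partial j (partial i F) t| < e / 2.
    exact: ((cvgrPdist_lt _ _).1 (cont j i) _ e2).
  apply: filterS3 Ux' c1 c2 => y Uy c1 c2; split.
  - exact: Uy.
  - exact: c1.
  - exact: c2.
move=> /nbhs_ballP[r /= r0 rP].
(* Intermediate points are displaced by at most [h] in each of two directions, which may
   coincide. *)
have [h hp hr] : exists2 h, 0 < h & h + h < r.
  by exists (r / 4); [rewrite divr_gt0 | lra].
have h0 : h != 0 by rewrite gt_eqF.
have hB a b (k l : 'I_n) : 0 <= a <= 1 -> 0 <= b <= 1 ->
    ball x r (x + (a * h) *: delta_mx 0 k + (b * h) *: delta_mx 0 l).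
  move=> /andP[a0 a1] /andP[b0 b1].
  rewrite -ball_normE /= -addrA opprD addrA subrr sub0r normrN.
    rewrite norm_row_lt //; apply/forallP => q; rewrite !mxE /=.
  apply: le_lt_trans (ler_normD _ _) _; apply: le_lt_trans hr.
  have d1 (c : bool) : `|c%:R : R| <= 1 by case: c; rewrite ?normr1 ?normr0 // ler01.
  have bnd c (t : bool) : 0 <= c -> c <= 1 -> `|c * h * t%:R| <= h.
    move=> c0 c1; rewrite !normrM (ger0_norm c0) (gtr0_norm hp).
    rewrite mulrAC -[leRHS]mul1r ler_wpM2r ?(ltW hp) //.
    by rewrite mulr_ile1.
  by rewrite lerD ?bnd.
have inU a b k l a01 b01 : U _ := let: And3 u _ _ := rP _ (hB a b k l a01 b01) in u.
have [a [b [p [a01 b01 Ep E1]]]] := second_difference oU sF (fun a b => inU a b i j).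
have [c [d [q [c01 d01 Eq E2]]]] := second_difference oU sF (fun a b => inU a b j i).
have [_ + _] := rP _ (hB a b i j a01 b01); rewrite -Ep => A1.
have [_ _] := rP _ (hB c d j i c01 d01); rewrite -Eq => A2.
move: (partial i _ x) (partial j _ x) A1 A2 => P Q A1 A2.
have E : p = q.
  apply: (mulfI h0); apply: (mulfI h0); rewrite -E1 -E2.
  rewrite [x + h *: delta_mx 0 j + _]addrAC; ring.
rewrite -(subrKA p) (le_trans (ler_normD _ _)) // [leRHS](splitr e) lerD //.
  exact: ltW.
by rewrite distrC E ltW.
Qed.

Lemma partial0_ball x (r : R) F : (forall y, ball x r y -> differentiable F y) ->
  (forall i y, ball x r y -> partial i F y = 0) ->
  forall y, ball x r y -> F y = F x.
Proof.
move=> dF pF y xy;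
have inB s : 0 <= s <= 1 -> ball x r (x + (s * 1) *: (y - x)).
  move=> /andP[s0 s1]; rewrite mulr1 -ball_normE /= opprD addrA subrr sub0r normrN.
  rewrite normrZ ger0_norm // (le_lt_trans (y := `|y - x|)) ?ler_piMl //.
  by move: xy; rewrite -ball_normE /= distrC.
have [|s s01] := @line_MVT R _ F x (y - x) 1.
  by move=> s /inB /dF; exact: diff_derivable.
rewrite scale1r addrCA addrN addr0 mul1r derive_partial; last exact/dF/inB.
rewrite big1 => [/eqP|i _]; last by rewrite pF ?mulr0 //; exact: inB.
by rewrite subr_eq0 => /eqP.
Qed.

(** By the case of a ball, the set where [F] equals [F y] and its complement are both open in the
    connected set [U]. *)
Lemma partial0_cst U F x y : is_domain U -> (forall z, U z -> differentiable F z) ->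
  (forall i z, U z -> partial i F z = 0) -> U x -> U y -> F x = F y.
Proof.
move=> [oU cU _] dF pF Ux Uy.
have oP (P : set R) : open [set z | U z /\ P (F z)].
  rewrite openE => z [Uz Fz]; have /nbhs_ballP[r /= r0 rU] := open_nbhs_nbhs (conj oU Uz).
  apply/nbhs_ballP; exists r => //= w zw; split; first exact: rU.
  by rewrite (@partial0_ball z r F) // => [u /rU/dF|i u /rU]; [|exact: pF].
have /seteqP[_ /(_ x Ux) []//] : U `&` [set z | F z = F y] = U.
apply: cU; first by exists y.
- by exists [set z | U z /\ F z = F y]; [exact: (oP [set F y])|apply/seteqP; split=> z /= []; tauto].
- exists (~` [set z | U z /\ F z <> F y]).
    exact/open_closedC/(oP [set w | w <> F y]).
  apply/seteqP; split=> z /= [Uz Fz]; split=> //; first by case.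
  by apply: contrapT => FF; apply: Fz.
Qed.

End SecondDerivatives.

(** * Jordan algebras with a positive definite form *)

Section MatrixEntries.
Context {R : pzRingType} {m n : nat}.
Implicit Types A B : 'M[R]_(m, n).

Lemma addmxE A B i j : (A + B) i j = A i j + B i j. Proof. by rewrite mxE. Qed.
Lemma oppmxE A i j : (- A) i j = - A i j. Proof. by rewrite mxE. Qed.
Lemma scalemxE a A i j : (a *: A) i j = a * A i j. Proof. by rewrite mxE. Qed.
Lemma trmxE A i j : A^T i j = A j i. Proof. by rewrite mxE. Qed.
Lemma rowmxE A i k : row i A 0 k = A i k. Proof. by rewrite mxE. Qed.
Lemma zeromxE i j : (0 : 'M[R]_(m, n)) i j = 0. Proof. by rewrite mxE. Qed.

End MatrixEntries.

(* Linear arithmetic on matrices, entry by entry, products being atoms. *)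
Ltac mxlin :=
  let i := fresh in let j := fresh in let H := fresh in
  first [move/matrixP => H; apply/matrixP => i j; move: (H i j)
        | apply/matrixP => i j];
  rewrite !(addmxE, oppmxE, scalemxE, mulmxnE, zeromxE); lra.

Section EuclideanMatrices.
Context {R : realFieldType}.

Lemma mx_trace_form_ge0 m n (M : 'M[R]_(m, n)) : 0 <= \tr (M *m M^T).
Proof.
apply: sumr_ge0 => i _; rewrite mxE; apply: sumr_ge0 => j _.
by rewrite mxE -expr2 sqr_ge0.
Qed.

Lemma mx_trace_form_eq0 m n (M : 'M[R]_(m, n)) : \tr (M *m M^T) = 0 -> M = 0.
Proof.
move=> trM; apply/matrixP => i j; rewrite mxE.
have ge0 k l : 0 <= M k l * M^T l k by rewrite mxE -expr2 sqr_ge0.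
move/eqP: trM; rewrite /mxtrace psumr_eq0 => [|k _]; last first.
  by rewrite mxE sumr_ge0.
move=> /allP/(_ i); rewrite mem_index_enum => /(_ isT) /=.
rewrite mxE psumr_eq0 //= => /allP/(_ j); rewrite mem_index_enum => /(_ isT) /=.
by rewrite mxE -expr2 sqrf_eq0 => /eqP.
Qed.

Lemma row_mulP m n (M N : 'M[R]_(m, n)) :
  (forall y : 'rV_m, y *m M = y *m N) -> M = N.
Proof. by move=> E; apply/row_matrixP => i; rewrite !rowE. Qed.

End EuclideanMatrices.

Section JordanAlgebra.
Context {R : realFieldType} {n : nat} (L : {linear 'rV[R]_n -> 'M[R]_n}).
Implicit Types x y z w : 'rV[R]_n.

(* y *m L x is the product xy of a commutative algebra. *)
Hypothesis Lcomm : forall x y, y *m L x = x *m L y.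

(* The commutators of multiplications are derivations. *)
Hypothesis Lder : forall x y z,
  L (z *m (L y *m L x - L x *m L y)) =
  L z *m (L y *m L x - L x *m L y) - (L y *m L x - L x *m L y) *m L z.

(** The linearised Jordan identity: the derivation identity is evaluated at [w], and commutativity
    lets each term be read as an operator applied to [y]. *)
Lemma Jordan1 x z w : L (w *m L z *m L x) =
  L (w *m L z) *m L x + L (z *m L x) *m L w + L (w *m L x) *m L z
  - L z *m L x *m L w - L w *m L x *m L z.
Proof.
apply: row_mulP => y.
have := congr1 (mulmx w) (Lder x y z).
rewrite !mulmxBl !mulmxBr linearB /= !mulmxBr !mulmxDr !mulmxA.
have -> : w *m L (z *m L y *m L x) = y *m L z *m L x *m L w.
  by rewrite Lcomm (Lcomm z).
have -> : w *m L (z *m L x *m L y) = y *m L (z *m L x) *m L w.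
  by rewrite Lcomm (Lcomm (z *m _)).
have -> : w *m L z *m L y = y *m L (w *m L z) by rewrite Lcomm.
have -> : w *m L z *m L x *m L y = y *m L (w *m L z *m L x) by rewrite Lcomm.
have -> : w *m L y = y *m L w by rewrite Lcomm.
have -> : w *m L x *m L y = y *m L (w *m L x) by rewrite Lcomm.
mxlin.
Qed.

Variable G : 'M[R]_n.
Hypothesis Gunit : G \in unitmx.
Hypothesis Lsym : forall x, L x *m G = G *m (L x)^T.

(** The adjoint of [Jordan1] with respect to [G]: multiplications are self-adjoint, so only the
    order of the products changes. *)
Lemma Jordan2 x z w : L (w *m L z *m L x) =
  L x *m L (w *m L z) + L w *m L (z *m L x) + L z *m L (w *m L x)
  - L w *m L x *m L z - L z *m L x *m L w.
Proof.
pose adj (M : 'M[R]_n) := G *m M^T *m invmx G.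
have adjL y : adj (L y) = L y by rewrite /adj -Lsym mulmxK.
have adjM M N : adj (M *m N) = adj N *m adj M.
  by rewrite /adj trmx_mul !mulmxA mulmxKV.
have adjD M N : adj (M + N) = adj M + adj N.
  by rewrite /adj linearD /= mulmxDr mulmxDl.
have adjN M : adj (- M) = - adj M.
  by rewrite /adj linearN /= mulmxN mulNmx.
have := congr1 adj (Jordan1 x z w).
by rewrite !(adjN, adjD, adjM, adjL) !mulmxA.
Qed.

End JordanAlgebra.

(** * The idempotent that is a unit modulo the annihilator *)

Section UnitElement.
Context {R : realFieldType} {n : nat} (L : {linear 'rV[R]_n -> 'M[R]_n}).
Implicit Types x y z w : 'rV[R]_n.
Hypothesis Lcomm : forall x y, y *m L x = x *m L y.
Hypothesis Lder : forall x y z,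
  L (z *m (L y *m L x - L x *m L y)) =
  L z *m (L y *m L x - L x *m L y) - (L y *m L x - L x *m L y) *m L z.
Hypothesis Lsym : forall x, (L x)^T = L x.

Let e_ i : 'rV[R]_n := delta_mx 0 i.
(** The sum of the squares of an orthonormal basis; it represents the linear form [tr (L y)], and
    [S] represents the bilinear form [tr (L y L z)]. *)
Let s : 'rV[R]_n := \sum_i e_ i *m L (e_ i).
Let S : 'M[R]_n := \sum_i L (e_ i) *m L (e_ i).

Let mxtr (M : 'M[R]_n) : \tr M = \sum_i (e_ i *m M *m (e_ i)^T) 0 0.
Proof.
by apply: eq_bigr => i _; rewrite -rowE trmx_delta -colE !mxE.
Qed.

Let sE y : (s *m y^T) 0 0 = \tr (L y).
Proof.
rewrite mxtr mulmx_suml summxE; apply: eq_bigr => i _.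
rewrite -[_ *m y^T]trmxK mxE trmx_mul trmxK trmx_mul Lsym mulmxA.
by rewrite Lcomm.
Qed.

Let SE y z : (y *m S *m z^T) 0 0 = \tr (L y *m L z).
Proof.
rewrite mxtr mulmx_sumr mulmx_suml summxE; apply: eq_bigr => i _.
rewrite !mulmxA (Lcomm _ y) -!mulmxA; congr ((_ *m _) 0 0).
by rewrite -[L z]Lsym -trmx_mul Lcomm trmx_mul Lsym.
Qed.

(** The commutator [D] is a derivation, so the product of [s] with any [z D] is the trace of the
    commutator of [L z] and [D], which is 0. As [D] is skew, a suitable [z] gives the squared norm
    of [s D]. *)
Let s_der x y : s *m (L y *m L x - L x *m L y) = 0.
Proof.
set D := _ - _.
have DT : D^T = - D.
  by rewrite /D linearB /= !trmx_mul !Lsym opprB.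
have sz z : s *m (z *m D)^T = 0.
  apply/matrixP => i j; rewrite !ord1 sE Lder raddfB /= mxtrace_mulC -/D subrr mxE //.
apply/mx_trace_form_eq0.
have -> : s *m D *m (s *m D)^T = s *m (s *m D *m D^T)^T.
  by rewrite [(_ *m D^T)^T]trmx_mul trmxK mulmxA.
by rewrite DT mulmxN -mulNmx sz raddf0.
Qed.

(** Since commutators kill [s], two multiplications applied to [s] can be exchanged. *)
Let TL x : L s *m L x = L (x *m L s).
Proof.
apply: row_mulP => y; rewrite mulmxA (Lcomm s y) (Lcomm _ y) (Lcomm s x).
have := s_der x y; rewrite mulmxBr !mulmxA => /eqP; rewrite subr_eq0 => /eqP ->.
by [].
Qed.

Let LT x : L x *m L s = L (x *m L s).
Proof. by rewrite -[LHS]trmxK trmx_mul !Lsym TL Lsym. Qed.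

(** The Jordan identity is summed over an orthonormal basis. The terms with [L s L w] vanish, and
    the squared norm of [w S] turns out to be minus a sum of squared norms of the commutators [C i].
    Hence [w S = 0], so the trace of the square of the symmetric matrix [L w] is 0. *)
Let kerT w : w *m L s = 0 -> L w = 0.
Proof.
move=> ws0; have J := Jordan1 Lcomm Lder.
have Lws : L s *m L w = 0 by rewrite TL ws0 linear0.
have A : L (w *m S) = \sum_i (L (w *m L (e_ i)) *m L (e_ i)) *+ 2 - S *m L w - L w *m S.
  rewrite /S mulmx_sumr linear_sum /= (eq_bigr (fun i => (L (w *m L (e_ i)) *m L (e_ i)) *+ 2
     + L (e_ i *m L (e_ i)) *m L w - L (e_ i) *m L (e_ i) *m L w
     - L w *m (L (e_ i) *m L (e_ i)))); last first.
    by move=> i _; rewrite mulmxA J !mulmxA; mxlin.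
  rewrite !big_split /= !sumrN -!mulmx_suml -linear_sum -/s Lws addr0 -mulmx_sumr.
  by [].
(* Here the Jordan identity is applied to [(e_i e_i) w], whereas [A] applies it to [(w e_i) e_i]. *)
have B : \sum_i L (w *m L (e_ i)) *m L (e_ i) = \sum_i L (e_ i) *m L w *m L (e_ i).
  have : L (s *m L w) = 0 by rewrite Lcomm ws0 linear0.
  rewrite /s mulmx_suml linear_sum /= (eq_bigr (fun i => L (e_ i *m L (e_ i)) *m L w
    + (L (w *m L (e_ i)) *m L (e_ i)) *+ 2 - (L (e_ i) *m L w *m L (e_ i)) *+ 2)); last first.
    by move=> i _; rewrite J (Lcomm (e_ i) w); mxlin.
  rewrite !big_split /= !sumrN -!mulmx_suml -linear_sum -/s Lws add0r !sumrMnl.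
  mxlin.
pose C i := L (e_ i) *m L w - L w *m L (e_ i).
have E : \tr (L (w *m S) *m L w) = - \sum_i \tr (C i *m (C i)^T).
  rewrite A sumrMnl B -sumrMnl !mulmxBl /S !mulmx_suml mulmx_sumr mulmx_suml.
  rewrite -!sumrB raddf_sum /= -sumrN; apply: eq_bigr => i _.
  have -> : (C i)^T = - C i by rewrite /C linearB /= !trmx_mul !Lsym opprB.
  rewrite /C mulmxN !mulmxBl !mulmxBr !mulmxA.
  set M := L (e_ i); set W := L w; 
  have trB (X Y : 'M[R]_n) : \tr (X - Y) = \tr X - \tr Y by exact: raddfB.
  rewrite mulr2n mulmxDl opprB !trB mxtraceD.
  have t1 : \tr (W *m M *m M *m W) = \tr (M *m M *m W *m W).
    by rewrite -!mulmxA mxtrace_mulC !mulmxA.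
  have t2 : \tr (W *m M *m W *m M) = \tr (M *m W *m M *m W).
    by rewrite -!mulmxA mxtrace_mulC !mulmxA.
  have t3 : \tr (M *m W *m W *m M) = \tr (M *m M *m W *m W).
    by rewrite mxtrace_mulC !mulmxA.
  lra.
have wS0 : w *m S = 0.
  have : \tr (w *m S *m (w *m S)^T) = \tr (L (w *m S) *m L w).
    have ST : S^T = S.
      by rewrite /S raddf_sum; apply: eq_bigr => i _; rewrite /= trmx_mul Lsym.
    by rewrite -SE trmx_mul ST /mxtrace big_ord1 !mulmxA.
  move=> E'.
  apply/mx_trace_form_eq0/le_anti/andP; split; last exact: mx_trace_form_ge0.
  by rewrite E' E oppr_le0 sumr_ge0 // => i _; exact: mx_trace_form_ge0.
apply/mx_trace_form_eq0; rewrite Lsym -SE wS0 mul0mx mxE //.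
Qed.

Let ker_ortho w : w *m L s = 0 -> s *m w^T = 0.
Proof.
by move=> /kerT w0; apply/matrixP => i j; rewrite !ord1 sE w0 mxtrace0 mxE.
Qed.

Lemma unit_element_orthonormal : exists e : 'rV[R]_n,
  [/\ e *m L e = e, L e *m L e = L e, (forall x, L e *m L x = L x) &
      (forall x, L (x *m L e) = L x)].
Proof.
(* The row space of the symmetric matrix [L s] is the orthogonal complement of its kernel, and [s]
   is orthogonal to this kernel by [ker_ortho]. *)
have /submxP[u su] : (s <= L s)%MS.
  rewrite submxE; apply/eqP/rowP => j; rewrite !mxE.
  pose c := (cokermx (L s))^T; pose w := row j c.
  have ws : w *m L s = 0.
    rewrite /w -row_mul; suff -> : c *m L s = 0 by rewrite row0.
    by rewrite /c -{2}[L s]Lsym -trmx_mul mulmx_coker raddf0.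
  have := ker_ortho ws => /matrixP/(_ 0 0); rewrite !mxE => E.
  by rewrite -[RHS]E; apply: eq_bigr => k _; rewrite !mxE.
have uT : L u *m L s = L s.
  by rewrite LT -su.
have K v : L (v - v *m L u) = 0.
  by apply: kerT; rewrite mulmxBl -mulmxA uT subrr.
have Lu v : L (v *m L u) = L v.
  by have := K v; rewrite linearB /= => /eqP; rewrite subr_eq0 => /eqP.
have uL x : L u *m L x = L x.
  apply: row_mulP => v; rewrite mulmxA (Lcomm _ (v *m L u)) Lu (Lcomm x v) //.
(* The equation [u L s = s] determines [u] only up to the annihilator. Squaring removes the
   component there and leaves an exact idempotent. *)
exists (u *m L u); rewrite Lu; split=> //.
by rewrite -mulmxA uL.
Qed.

End UnitElement.

Section PositiveDefinite.
Context {R : rcfType} {n : nat} (G : 'M[R]_n).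
Hypothesis Gsym : G^T = G.
Hypothesis Gpos : forall v : 'rV[R]_n, v != 0 -> 0 < (v *m G *m v^T) 0 0.

Lemma posdef_unit : G \in unitmx.
Proof.
rewrite -row_free_unit; apply/inj_row_free => v vG.
by apply/eqP/negPn/negP => /Gpos; rewrite vG mul0mx mxE ltxx.
Qed.

Lemma orthonormal_row_free m (B : 'M[R]_(m, n)) : B *m G *m B^T = 1%:M -> row_free B.
Proof.
move=> BG; apply/row_freeP; exists (G *m B^T); by rewrite mulmxA.
Qed.

(** Gram-Schmidt, each time with a row of [U] outside the span reached so far. Orthonormal rows are
    independent, so [\rank U] of them fill the row space. *)
Lemma orthonormal_basis (U : 'M[R]_n) : exists B : 'M[R]_(\rank U, n),
  (B :=: U)%MS /\ B *m G *m B^T = 1%:M.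
Proof.
suff /(_ (\rank U) (leqnn _)) [B [BU BG]] : forall m, (m <= \rank U)%N ->
    exists B : 'M[R]_(m, n), (B <= U)%MS /\ B *m G *m B^T = 1%:M.
  exists B; split=> //; apply/eqmxP.
  by rewrite -(mxrank_leqif_eq BU).2 (eqP (orthonormal_row_free BG)).
elim=> [|m IH] mU; first by exists 0; rewrite sub0mx !mul0mx; split=> //; apply/matrixP; case.
have [B [BU BG]] := IH (ltnW mU).
have [i iB] : exists i, ~~ (row i U <= B)%MS.
  apply/existsP; rewrite -negb_forall; apply/negP => /forallP H.
  have /mxrankS : (U <= B)%MS by apply/row_subP.
  by rewrite (eqP (orthonormal_row_free BG)) leqNgt mU.
pose v := row i U - row i U *m G *m B^T *m B.
have vU : (v <= U)%MS.
  rewrite addmx_sub ?row_sub // -mulNmx; exact: (submx_trans (submxMl _ _) BU).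
have v0 : v != 0.
  apply: contraNneq iB => /eqP; rewrite subr_eq0 => /eqP ->; exact: submxMl.
have vB : v *m G *m B^T = 0.
  rewrite !mulmxBl -!mulmxA [B *m _]mulmxA BG mulmx1 !mulmxA subrr //.
have Bv : B *m G *m v^T = 0.
  by apply: trmx_inj; rewrite raddf0 !trmx_mul trmxK Gsym mulmxA vB.
pose r := (v *m G *m v^T) 0 0; have r0 : 0 < r by exact: Gpos.
have sr0 : Num.sqrt r != 0 by rewrite gt_eqF // sqrtr_gt0.
pose u := (Num.sqrt r)^-1 *: v.
rewrite -[m.+1]addn1; exists (col_mx B u); split.
  by rewrite col_mx_sub BU scalemx_sub.
rewrite tr_col_mx mul_col_mx mul_col_row BG linearZ /= -!scalemxAl -!scalemxAr vB Bv !scaler0.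
rewrite scalerA; have -> : v *m G *m v^T = r%:M by rewrite /r -mx11_scalar.
rewrite -invfM -expr2 sqr_sqrtr ?ltW // scale_scalar_mx mulVf ?gt_eqF //.
by rewrite -scalar_mx_block.
Qed.

End PositiveDefinite.

Section UnitElementPosdef.
Context {R : rcfType} {n : nat} (L : {linear 'rV[R]_n -> 'M[R]_n}) (G : 'M[R]_n).
Hypothesis Gsym : G^T = G.
Hypothesis Gpos : forall v : 'rV[R]_n, v != 0 -> 0 < (v *m G *m v^T) 0 0.
Hypothesis Lcomm : forall x y, y *m L x = x *m L y.
Hypothesis Lder : forall x y z,
  L (z *m (L y *m L x - L x *m L y)) =
  L z *m (L y *m L x - L x *m L y) - (L y *m L x - L x *m L y) *m L z.
Hypothesis Lsym : forall x, L x *m G = G *m (L x)^T.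

(** Conjugation by a [G]-orthonormal basis [E] makes all multiplications symmetric matrices, because
    [invmx E] is [G] times the transpose of [E]. *)
Lemma unit_element : exists e : 'rV[R]_n,
  [/\ e *m L e = e, L e *m L e = L e, (forall x, L e *m L x = L x) &
      (forall x, L (x *m L e) = L x)].
Proof.
have [E0 [E1 EG0]] := orthonormal_basis Gsym Gpos 1%:M.
have [E [EG EU]] : exists E : 'M[R]_n, E *m G *m E^T = 1%:M /\ E \in unitmx.
  move: (E0) E1 EG0; rewrite mxrank1 => E E1 EG; exists E; split=> //.
  by rewrite -row_free_unit; exact: orthonormal_row_free EG.
pose iE := invmx E.
have EiE : E *m iE = 1%:M by exact: mulmxV.
have iEE : iE *m E = 1%:M by exact: mulVmx.
pose L' (u : 'rV[R]_n) := E *m L (u *m E) *m iE.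
have L'lin : linear L'.
  by move=> a u v; rewrite /L' mulmxDl -scalemxAl linearP mulmxDr mulmxDl -scalemxAr -scalemxAl.
pose L'L := GRing.isLinear.Build _ _ _ _ L' L'lin.
pose Ll : {linear 'rV[R]_n -> 'M[R]_n} := HB.pack L' L'L.
have L'E x : Ll x = E *m L (x *m E) *m iE by [].
have [||x|e [e1 e2 e3 e4]] := @unit_element_orthonormal R n Ll.
- move=> x y; rewrite !L'E !mulmxA; congr (_ *m _); exact: Lcomm.
- move=> x y z; rewrite !L'E.
  have cM (M N : 'M[R]_n) : E *m M *m iE *m (E *m N *m iE) = E *m (M *m N) *m iE.
    by rewrite !mulmxA -[E *m M *m iE *m E]mulmxA iEE mulmx1.
  rewrite !cM -mulmxBl -mulmxBr.
  rewrite !cM -!mulmxBl -!mulmxBr -Lder; congr (_ *m L _ *m _).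
  by rewrite -!mulmxA iEE mulmx1.
- rewrite L'E. 
  have iEG : iE = G *m E^T.
    by rewrite -[LHS]mulmx1 -EG !mulmxA iEE mul1mx.
  rewrite iEG !trmx_mul trmxK Gsym [in LHS]mulmxA.
  rewrite -!mulmxA; congr (_ *m _); rewrite !mulmxA; congr (_ *m _).
  by rewrite -Lsym.
- exists (e *m E).
  have LE x : L (x *m E) = iE *m Ll x *m E.
    by rewrite L'E !mulmxA iEE mul1mx -mulmxA iEE mulmx1.
  have xE (x : 'rV[R]_n) : x = (x *m iE) *m E by rewrite -mulmxA iEE mulmx1.
  have cM (M N : 'M[R]_n) : iE *m M *m E *m (iE *m N *m E) = iE *m (M *m N) *m E.
    by rewrite !mulmxA -[iE *m M *m E *m iE]mulmxA EiE mulmx1.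
  split.
  + by rewrite -[in RHS]e1 LE !mulmxA -[e *m E *m iE]mulmxA EiE mulmx1.
  + by rewrite LE cM e2.
  + by move=> x; rewrite (xE x) !LE cM e3.
  + move=> x; rewrite (xE x) [in RHS]LE LE.
    have -> : x *m iE *m E *m (iE *m Ll e *m E) = x *m iE *m Ll e *m E.
      by rewrite !mulmxA -[x *m iE *m E *m iE]mulmxA EiE mulmx1.
    by rewrite LE e4.
Qed.

End UnitElementPosdef.

(** * Matrix-valued functions *)

(* Entrywise partial derivative, locked so that comparing derivatives in two
   directions does not unfold limits. *)
HB.lock Definition pd (R : realType) (n p q : nat) (l : 'I_n)
    (M : 'rV[R]_n -> 'M[R]_(p, q)) (x : 'rV[R]_n) : 'M[R]_(p, q) :=
  \matrix_(i, j) partial l (fun y => M y i j) x.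

Section MatrixCalculus.
Context {R : realType} {n : nat}.
Implicit Types (U : set 'rV[R]_n) (x : 'rV[R]_n).

Definition msmooth {p q} U (M : 'rV[R]_n -> 'M[R]_(p, q)) :=
  forall i j, smooth_on U (fun x => M x i j).

Lemma pdE p q l (M : 'rV[R]_n -> 'M[R]_(p, q)) x i j :
  pd l M x i j = partial l (fun y => M y i j) x.
Proof. by rewrite pd.unlock mxE. Qed.

Lemma smooth_partialD U (F G : 'rV[R]_n -> R) l x : open U -> smooth_on U F ->
  smooth_on U G -> U x ->
  partial l (fun y => F y + G y) x = partial l F x + partial l G x.
Proof.
move=> oU sF sG Ux; rewrite /partial.
have dF := smooth_differentiable oU sF Ux; have dG := smooth_differentiable oU sG Ux.
by rewrite -deriveD //; apply/diff_derivable.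
Qed.

Lemma smooth_partialM U (F G : 'rV[R]_n -> R) l x : open U -> smooth_on U F ->
  smooth_on U G -> U x ->
  partial l (fun y => F y * G y) x = partial l F x * G x + F x * partial l G x.
Proof.
move=> oU sF sG Ux; rewrite /partial.
have dF := smooth_differentiable oU sF Ux; have dG := smooth_differentiable oU sG Ux.
have dF' : derivable F x (delta_mx 0 l) by exact: diff_derivable.
have dG' : derivable G x (delta_mx 0 l) by exact: diff_derivable.
rewrite [LHS](@deriveM _ _ F G _ _ dF' dG').
by rewrite addrC -![_ *: _]/(_ * _) [_ * G x]mulrC.
Qed.

Lemma partial_cst l (c : R) x : partial l (fun=> c) x = 0.
Proof. by rewrite /partial derive_cst. Qed.

Lemma partial_ext U (V : normedModType R) (F G : 'rV[R]_n -> V) l x : open U ->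
  (forall y, U y -> F y = G y) -> U x -> partial l F x = partial l G x.
Proof.
move=> oU FG Ux; apply: near_eq_derive.
by apply: filterS (open_nbhs_nbhs (conj oU Ux)) => y /FG.
Qed.

Lemma smooth_partial_sum U (I : Type) (r : seq I) (F : I -> 'rV[R]_n -> R) l x :
  open U -> (forall i, smooth_on U (F i)) -> U x ->
  partial l (fun y => \sum_(i <- r) F i y) x = \sum_(i <- r) partial l (F i) x.
Proof.
move=> oU sF Ux; elim: r => [|i r IH].
  rewrite big_nil -[RHS](partial_cst l 0 x); apply: (partial_ext l oU) => // y _.
  by rewrite big_nil.
rewrite big_cons -IH -(smooth_partialD l oU) //.
  by apply: (partial_ext l oU) => // y _; rewrite big_cons.
by move=> k; apply: Ck_sum => // j _; apply: sF.
Qed.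

Lemma smooth_cst U (c : R) : open U -> smooth_on U (fun=> c).
Proof. by move=> oU k; apply: Ck_cst. Qed.

Lemma msmooth_cst U p q (M : 'M[R]_(p, q)) : open U -> msmooth U (fun=> M).
Proof. by move=> oU i j; apply: smooth_cst. Qed.

Lemma msmooth_ext U p q (M N : 'rV[R]_n -> 'M[R]_(p, q)) : open U ->
  (forall y, U y -> M y = N y) -> msmooth U M -> msmooth U N.
Proof. by move=> oU MN sM i j; apply: smooth_ext (sM i j) => // y /MN ->. Qed.

Lemma msmoothD U p q (M N : 'rV[R]_n -> 'M[R]_(p, q)) : open U ->
  msmooth U M -> msmooth U N -> msmooth U (fun x => M x + N x).
Proof.
move=> oU sM sN i j k; apply: Ck_ext (CkD oU (sM i j k) (sN i j k)) => // x _.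
by rewrite mxE.
Qed.

Lemma msmoothM U p q r (M : 'rV[R]_n -> 'M[R]_(p, q)) (N : 'rV[R]_n -> 'M[R]_(q, r)) :
  open U -> msmooth U M -> msmooth U N -> msmooth U (fun x => M x *m N x).
Proof.
move=> oU sM sN i j k.
apply: Ck_ext (Ck_sum (index_enum _) (P := predT)
  (F := fun l y => M y i l * N y l j) oU _) => // [x _|l _].
  by rewrite mxE.
by apply: CkM => //; [exact: sM|exact: sN].
Qed.

Lemma msmooth_scale U p q (F : 'rV[R]_n -> R) (M : 'rV[R]_n -> 'M[R]_(p, q)) :
  open U -> smooth_on U F -> msmooth U M -> msmooth U (fun x => F x *: M x).
Proof.
move=> oU sF sM i j k; apply: Ck_ext (CkM oU (sF k) (sM i j k)) => // x _.
by rewrite mxE.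
Qed.

Lemma msmoothN U p q (M : 'rV[R]_n -> 'M[R]_(p, q)) : open U ->
  msmooth U M -> msmooth U (fun x => - M x).
Proof.
move=> oU sM; apply: (msmooth_ext oU (M := fun x => (-1) *: M x)) => [x _|].
  by rewrite scaleN1r.
exact: (msmooth_scale oU (smooth_cst _ oU)).
Qed.

Lemma msmoothB U p q (M N : 'rV[R]_n -> 'M[R]_(p, q)) : open U ->
  msmooth U M -> msmooth U N -> msmooth U (fun x => M x - N x).
Proof. by move=> oU sM sN; apply: msmoothD => //; exact: msmoothN. Qed.

Lemma msmooth_sum U p q (I : Type) (r : seq I) (M : I -> 'rV[R]_n -> 'M[R]_(p, q)) :
  open U -> (forall i, msmooth U (M i)) -> msmooth U (fun x => \sum_(i <- r) M i x).
Proof.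
move=> oU sM i j k; apply: Ck_ext (Ck_sum r (P := predT) oU (fun l _ => sM l i j k)).
by [].
by move=> x _; rewrite summxE.
Qed.

Lemma smooth_coord U j : open U -> smooth_on U (fun x : 'rV[R]_n => x 0 j).
Proof. by move=> oU k; exact: Ck_coord. Qed.

Lemma msmooth_id U : open U -> msmooth U (fun x : 'rV[R]_n => x).
Proof. by move=> oU i j; rewrite ord1; exact: smooth_coord. Qed.

Lemma smooth_det U p (M : 'rV[R]_n -> 'M[R]_p) : open U -> msmooth U M ->
  smooth_on U (fun x => \det (M x)).
Proof.
move=> oU sM k; rewrite /determinant; apply: Ck_sum => // s _.
apply: CkM => //; first exact: Ck_cst.
by apply: Ck_prod => // i _; apply: sM.
Qed.

Lemma msmooth_invmx U p (M : 'rV[R]_n -> 'M[R]_p) : open U -> msmooth U M ->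
  (forall x, U x -> M x \in unitmx) -> msmooth U (fun x => invmx (M x)).
Proof.
move=> oU sM uM.
apply: (msmooth_ext oU (M := fun x => (\det (M x))^-1 *: \adj (M x))).
  by move=> x Ux; rewrite /invmx uM.
apply: msmooth_scale => //.
  move=> k; apply: CkV => //; last exact: smooth_det.
  by move=> x /uM; rewrite unitmxE unitfE.
move=> i j; apply: (smooth_ext oU (F := fun x => cofactor (M x) j i)).
  by move=> x _; rewrite mxE.
move=> k; apply: CkM => //; first exact: Ck_cst.
apply: smooth_det => // a b; apply: (smooth_ext oU _ (sM (lift j a) (lift i b))).
by move=> x _; rewrite !mxE.
Qed.

Lemma pd_ext U p q (M N : 'rV[R]_n -> 'M[R]_(p, q)) l x : open U ->
  (forall y, U y -> M y = N y) -> U x -> pd l M x = pd l N x.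
Proof.
move=> oU MN Ux; apply/matrixP => i j; rewrite !pdE; apply: (partial_ext l oU) => //.
by move=> y /MN ->.
Qed.

Lemma msmooth_pd U p q (M : 'rV[R]_n -> 'M[R]_(p, q)) l : open U ->
  msmooth U M -> msmooth U (pd l M).
Proof.
move=> oU sM i j; apply: (smooth_ext oU _ (smooth_partial l (sM i j))).
by move=> x _; rewrite pdE.
Qed.

Lemma pd_cst p q (M : 'M[R]_(p, q)) l x : pd l (fun=> M) x = 0.
Proof. by apply/matrixP => i j; rewrite pdE mxE partial_cst. Qed.

Lemma pdD U p q (M N : 'rV[R]_n -> 'M[R]_(p, q)) l x : open U -> msmooth U M ->
  msmooth U N -> U x -> pd l (fun y => M y + N y) x = pd l M x + pd l N x.
Proof.
move=> oU sM sN Ux; apply/matrixP => i j; rewrite addmxE !pdE.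
rewrite -(smooth_partialD l oU (sM i j) (sN i j) Ux).
by apply: (partial_ext l oU) => // y _; rewrite mxE.
Qed.

Lemma pdM U p q r (M : 'rV[R]_n -> 'M[R]_(p, q)) (N : 'rV[R]_n -> 'M[R]_(q, r)) l x :
  open U -> msmooth U M -> msmooth U N -> U x ->
  pd l (fun y => M y *m N y) x = pd l M x *m N x + M x *m pd l N x.
Proof.
move=> oU sM sN Ux; apply/matrixP => i j; rewrite addmxE pdE 2!mxE.
rewrite (partial_ext l oU (G := fun y => \sum_k M y i k * N y k j)) //; last first.
  by move=> y _; rewrite mxE.
rewrite (smooth_partial_sum _ l oU) //; last first.
  by move=> k m; apply: CkM => //; [exact: sM|exact: sN].
rewrite -big_split; apply: eq_bigr => k _ /=; rewrite !pdE.
by rewrite (smooth_partialM l oU).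
Qed.

Lemma pdMl U p q r (M : 'M[R]_(p, q)) (N : 'rV[R]_n -> 'M[R]_(q, r)) l x :
  open U -> msmooth U N -> U x -> pd l (fun y => M *m N y) x = M *m pd l N x.
Proof.
move=> oU sN Ux; rewrite (pdM l oU) //; last exact: msmooth_cst.
by rewrite pd_cst mul0mx add0r.
Qed.

Lemma pdMr U p q r (M : 'rV[R]_n -> 'M[R]_(p, q)) (N : 'M[R]_(q, r)) l x :
  open U -> msmooth U M -> U x -> pd l (fun y => M y *m N) x = pd l M x *m N.
Proof.
move=> oU sN Ux; rewrite (pdM l oU) //; last exact: msmooth_cst.
by rewrite pd_cst mulmx0 addr0.
Qed.

Lemma pd_scale U p q (F : 'rV[R]_n -> R) (M : 'rV[R]_n -> 'M[R]_(p, q)) l x :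
  open U -> smooth_on U F -> msmooth U M -> U x ->
  pd l (fun y => F y *: M y) x = partial l F x *: M x + F x *: pd l M x.
Proof.
move=> oU sF sM Ux; apply/matrixP => i j; rewrite addmxE !scalemxE !pdE.
rewrite -(smooth_partialM l oU) //.
by apply: (partial_ext l oU) => // y _; rewrite mxE.
Qed.

Lemma pdZ U p q (c : R) (M : 'rV[R]_n -> 'M[R]_(p, q)) l x :
  open U -> msmooth U M -> U x -> pd l (fun y => c *: M y) x = c *: pd l M x.
Proof.
move=> oU sM Ux; rewrite (pd_scale l oU) //; last exact: smooth_cst.
by rewrite partial_cst scale0r add0r.
Qed.

Lemma pdN U p q (M : 'rV[R]_n -> 'M[R]_(p, q)) l x :
  open U -> msmooth U M -> U x -> pd l (fun y => - M y) x = - pd l M x.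
Proof.
move=> oU sM Ux; rewrite -[RHS]scaleN1r -(pdZ _ l oU) //.
by apply: (pd_ext l oU) => // y _; rewrite scaleN1r.
Qed.

Lemma pdB U p q (M N : 'rV[R]_n -> 'M[R]_(p, q)) l x : open U -> msmooth U M ->
  msmooth U N -> U x -> pd l (fun y => M y - N y) x = pd l M x - pd l N x.
Proof.
move=> oU sM sN Ux; rewrite (pdD l oU) //; last exact: msmoothN.
by rewrite (pdN l oU).
Qed.

Lemma pd_sum U p q (I : Type) (r : seq I) (M : I -> 'rV[R]_n -> 'M[R]_(p, q)) l x :
  open U -> (forall i, msmooth U (M i)) -> U x ->
  pd l (fun y => \sum_(i <- r) M i y) x = \sum_(i <- r) pd l (M i) x.
Proof.
move=> oU sM Ux; apply/matrixP => i j; rewrite summxE pdE.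
rewrite (partial_ext l oU (G := fun y => \sum_(k <- r) M k y i j)) //; last first.
  by move=> y _; rewrite summxE.
rewrite (smooth_partial_sum _ l oU) //; last by move=> k; exact: sM.
by apply: eq_bigr => k _; rewrite pdE.
Qed.

Lemma pd_tr p q (M : 'rV[R]_n -> 'M[R]_(p, q)) l x :
  pd l (fun y => (M y)^T) x = (pd l M x)^T.
Proof.
apply/matrixP => i j; rewrite trmxE !pdE; congr (partial l _ x).
by apply: funext => y; rewrite trmxE.
Qed.

Lemma msmooth_tr U p q (M : 'rV[R]_n -> 'M[R]_(p, q)) : open U ->
  msmooth U M -> msmooth U (fun x => (M x)^T).
Proof.
move=> oU sM i j; apply: (smooth_ext oU _ (sM j i)) => x _.
by rewrite trmxE.
Qed.

Lemma pd_id l x : pd l (fun y : 'rV[R]_n => y) x = delta_mx 0 l.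
Proof.
by apply/matrixP => i j; rewrite pdE mxE ord1 partial_coord eq_sym.
Qed.

Lemma pdC U p q (M : 'rV[R]_n -> 'M[R]_(p, q)) k l x : open U -> msmooth U M ->
  U x -> pd k (pd l M) x = pd l (pd k M) x.
Proof.
move=> oU sM Ux; apply/matrixP => i j.
have E a b : pd a (pd b M) x i j = partial a (partial b (fun y => M y i j)) x.
  by rewrite pdE; apply: (partial_ext a oU) => // y _; rewrite pdE.
exact: (etrans (E k l) (etrans (partialC k l oU (sM i j) Ux) (esym (E l k)))).
Qed.

Lemma pd_invmx U p (M : 'rV[R]_n -> 'M[R]_p) l x : open U -> msmooth U M ->
  (forall x, U x -> M x \in unitmx) -> U x ->
  pd l (fun y => invmx (M y)) x = - (invmx (M x) *m pd l M x *m invmx (M x)).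
Proof.
move=> oU sM uM Ux; have sI := msmooth_invmx oU sM uM.
have : pd l (fun y => M y *m invmx (M y)) x = 0.
  rewrite -(pd_cst (1%:M : 'M[R]_p) l x); apply: (pd_ext l oU) => // y Uy.
  by rewrite mulmxV ?uM.
rewrite (pdM l oU) // => /eqP; rewrite addrC addr_eq0 => /eqP E.
by rewrite -[LHS](mulKmx (uM x Ux)) E mulmxN mulmxA.
Qed.

Lemma pd0_cst U p q (M : 'rV[R]_n -> 'M[R]_(p, q)) x y : is_domain U ->
  msmooth U M -> (forall l z, U z -> pd l M z = 0) -> U x -> U y -> M x = M y.
Proof.
move=> dU sM pM Ux Uy; apply/matrixP => i j.
have [oU _ _] := dU.
apply: (partial0_cst (F := fun z => M z i j) dU) => // [z|l z Uz].
  exact: smooth_differentiable.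
by have /matrixP/(_ i j) := pM l z Uz; rewrite pdE mxE.
Qed.

End MatrixCalculus.

(** * Geometry of a graph *)

Definition third (R : realType) (n : nat) (f : 'rV[R]_n -> R) l x : 'M[R]_n :=
  pd l (hessian f) x.

(* Multiplication of the algebra defined by the cubic form:
   A^k_ij = A_ f i x j k. *)
HB.lock Definition A_ (R : realType) (n : nat) (f : 'rV[R]_n -> R) (l : 'I_n)
    (x : 'rV[R]_n) : 'M[R]_n :=
  - 2^-1 *: (third f l x *m invmx (hessian f x)).

Section GraphGeometry.
Context {R : realType} {n : nat}.
Variables (U : set 'rV[R]_n) (f : 'rV[R]_n -> R).
Hypotheses (oU : open U) (sf : smooth_on U f) (cf : strictly_convex_on U f).
Implicit Types (x y : 'rV[R]_n).

Lemma partial_pd m (M : 'rV[R]_n -> 'rV[R]_m) l x : msmooth U M -> U x ->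
  partial l M x = pd l M x.
Proof.
move=> sM Ux; rewrite /partial derive_mx.
  by apply/matrixP => i j; rewrite pdE mxE.
by apply/derivable_mxP => i j; apply: diff_derivable; exact: (smooth_differentiable oU).
Qed.

Lemma graphE x : graph f x = x *m row_mx 1%:M 0 + f x *: Yvec R n.
Proof.
rewrite /graph /Yvec mul_mx_row mulmx1 mulmx0 scale_row_mx scaler0 add_row_mx.
by rewrite addr0 add0r scalemx1.
Qed.

Lemma partial_graph l x : U x -> partial l (graph f) x =
  delta_mx 0 l *m row_mx 1%:M 0 + partial l f x *: Yvec R n.
Proof.
have s1 : msmooth U (fun y : 'rV[R]_n => y *m row_mx 1%:M (0 : 'M[R]_(n, 1))).
  by apply: msmoothM => //; [exact: msmooth_id|exact: msmooth_cst].
have s2 : msmooth U (fun y => f y *: Yvec R n).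
  by apply: msmooth_scale => //; exact: msmooth_cst.
move=> Ux; have -> : graph f = fun y => y *m row_mx 1%:M 0 + f y *: Yvec R n.
  by apply: funext => y; rewrite graphE.
rewrite partial_pd //; last exact: msmoothD.
rewrite (pdD l oU) // (pdMr _ l oU) //; last exact: msmooth_id.
rewrite (pd_scale l oU) //; last exact: msmooth_cst.
by rewrite pd_id pd_cst scaler0 addr0.
Qed.

Lemma partial2_graph k l x : U x -> partial k (partial l (graph f)) x =
  partial k (partial l f) x *: Yvec R n.
Proof.
move=> Ux; have spf := smooth_partial l sf.
rewrite (partial_ext k oU (partial_graph l)) //.
have sY : msmooth U (fun y => partial l f y *: Yvec R n).
  by apply: msmooth_scale => //; exact: msmooth_cst.
rewrite partial_pd //; last by apply: msmoothD => //; exact: msmooth_cst.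
rewrite (pdD k oU) //; last exact: msmooth_cst.
rewrite pd_cst add0r (pd_scale k oU) //; last exact: msmooth_cst.
by rewrite pd_cst scaler0 addr0.
Qed.

Lemma graph_frame x : U x -> frame (graph f) (fun=> Yvec R n) x =
  block_mx 1%:M (\col_i partial i f x) 0 1%:M.
Proof.
move=> Ux; rewrite /frame /block_mx; congr col_mx.
apply/row_matrixP => i; rewrite rowK partial_graph // mul_mx_row mulmx1 mulmx0.
rewrite /Yvec scale_row_mx scaler0 add_row_mx addr0 add0r row_row_mx.
congr row_mx; first by rewrite rowE mulmx1.
by apply/rowP => j; rewrite !mxE !ord1 mulr1.
Qed.

Lemma graph_gauss i j x : U x -> gauss (graph f) (fun=> Yvec R n) i j x =
  row_mx 0 (hessian f x i j)%:M.
Proof.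
move=> Ux; rewrite /gauss partial2_graph //.
have uF : frame (graph f) (fun=> Yvec R n) x \in unitmx.
  by rewrite unitmxE graph_frame // det_ublock !det1 mulr1 unitr1.
apply: (canLR (mulmxK uF)).
rewrite graph_frame // mul_row_block !mul0mx mulmx0 mulmx1 !add0r /Yvec.
by rewrite scale_row_mx scaler0 scalemx1 mxE.
Qed.

Lemma graph_conn k i j x : U x ->
  induced_conn (graph f) (fun=> Yvec R n) k i j x = 0.
Proof. by move=> Ux; rewrite /induced_conn graph_gauss // row_mxKl mxE. Qed.

Lemma graph_metric x : U x -> metric (graph f) (fun=> Yvec R n) x = hessian f x.
Proof.
by move=> Ux; apply/matrixP => i j; rewrite mxE graph_gauss // row_mxKr mxE eqxx mulr1n.
Qed.

Lemma msmooth_hessian : msmooth U (hessian f).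
Proof.
move=> i j; apply: (smooth_ext (F := partial i (partial j f)) oU).
  by move=> x _; rewrite mxE.
exact/smooth_partial/smooth_partial.
Qed.

Lemma hessian_sym x : U x -> (hessian f x)^T = hessian f x.
Proof.
move=> Ux; apply/matrixP => i j; rewrite !mxE.
exact: (partialC j i oU sf Ux).
Qed.

Lemma hessian_unit x : U x -> hessian f x \in unitmx.
Proof. by move=> Ux; exact/posdef_unit/cf. Qed.

Lemma invhessian_sym x : U x -> (invmx (hessian f x))^T = invmx (hessian f x).
Proof. by move=> Ux; rewrite trmx_inv hessian_sym. Qed.

Lemma third_pd l x : third f l x = pd l (hessian f) x.
Proof. by []. Qed.

Lemma thirdE l i j x : U x ->
  third f l x i j = partial l (partial i (partial j f)) x.
Proof.
move=> Ux; rewrite /third pdE; apply: (partial_ext l oU) => // y Uy.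
by rewrite mxE.
Qed.

Lemma third_symr l x : U x -> (third f l x)^T = third f l x.
Proof.
by move=> Ux; rewrite /third -pd_tr; apply: (pd_ext l oU) => // y /hessian_sym.
Qed.

Lemma third_swap l i j x : U x -> third f l x i j = third f i x l j.
Proof.
move=> Ux; apply: etrans (thirdE l i j Ux) _; apply: esym.
apply: etrans (thirdE i l j Ux) _.
exact: (partialC i l oU (smooth_partial j sf) Ux).
Qed.

Lemma msmooth_third l : msmooth U (third f l).
Proof. exact/msmooth_pd/msmooth_hessian. Qed.

Lemma msmooth_invhessian : msmooth U (fun x => invmx (hessian f x)).
Proof. by apply: msmooth_invmx; [|exact: msmooth_hessian|exact: hessian_unit]. Qed.

Lemma A_E l x : A_ f l x = - 2^-1 *: (third f l x *m invmx (hessian f x)).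
Proof. by rewrite A_.unlock. Qed.

Lemma msmooth_A l : msmooth U (A_ f l).
Proof.
apply: (msmooth_ext oU (fun x _ => esym (A_E l x))).
apply: msmooth_scale => //; first exact: smooth_cst.
apply: msmoothM => //; [exact: msmooth_third|exact: msmooth_invhessian].
Qed.

Lemma A_comm i j x : U x -> delta_mx 0 i *m A_ f j x = delta_mx 0 j *m A_ f i x :> 'rV[R]_n.
Proof.
move=> Ux; have E : row i (third f j x) = row j (third f i x).
  apply/rowP => k.
  exact: etrans (rowmxE _ i k) (etrans (third_swap j i k Ux) (esym (rowmxE _ j k))).
by rewrite !A_E -!scalemxAr !mulmxA -(rowE i) E (rowE j).
Qed.

Lemma A_sym l x : U x -> A_ f l x *m hessian f x = hessian f x *m (A_ f l x)^T.
Proof.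
move=> Ux; rewrite A_E linearZ /= -scalemxAl -scalemxAr trmx_mul invhessian_sym //.
by rewrite third_symr // mulmxKV ?mulKVmx ?hessian_unit.
Qed.

(** The derivatives of the metric are third derivatives of [f], symmetric in all indices, so two of
    the three terms of the Christoffel formula cancel. *)
Lemma graph_levi_civita k i j x : U x ->
  levi_civita (metric (graph f) (fun=> Yvec R n)) k i j x = - A_ f i x j k.
Proof.
move=> Ux; rewrite /levi_civita graph_metric // A_E scalemxE mulNr opprK [in RHS]mxE.
congr (_ * _); apply: eq_bigr => l _; rewrite mulrC.
have E a b c : partial a (fun y => metric (graph f) (fun=> Yvec R n) y b c) x = third f a x b c.
  by rewrite third_pd pdE; apply: (partial_ext a oU) => // y Uy; rewrite graph_metric.
rewrite (E i j l) (E j i l) (E l i j); congr (_ * _).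
  have e1 := third_swap j i l Ux; have e2 := third_swap l i j Ux.
  have e3 : third f i x l j = third f i x j l.
    by have /matrixP/(_ l j) := third_symr i Ux; rewrite trmxE.
  have e4 := etrans e1 (etrans (esym e3) (esym e2)).
  apply: (etrans (congr1 (fun t => third f i x j l + t - third f l x i j) e4)).
  exact: addrK.
by have /matrixP/(_ k l) := invhessian_sym Ux; rewrite trmxE.
Qed.

Lemma graph_cubic k i j x : U x ->
  cubic (graph f) (fun=> Yvec R n) k i j x = A_ f i x j k.
Proof.
by move=> Ux; rewrite /cubic graph_conn // graph_levi_civita // sub0r opprK.
Qed.

Let cov_entry (X Ai Al : 'M[R]_n) (B : 'I_n -> 'M[R]_n) i j k :
  (X - (Ai *m Al - Al *m Ai - \sum_m Al i m *: B m)) j k =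
  X j k + \sum_m (- Al m k * Ai j m - - Al i m * B m j k - - Al j m * Ai m k).
Proof.
rewrite !mxE summxE -!sumrN -!big_split /= -sumrN; congr (_ + _).
by apply: eq_bigr => m _; rewrite mxE; ring.
Qed.

(** With [-A] for the Levi-Civita coefficients, the correction terms of the covariant derivative
    become a commutator of two multiplications and the multiplication by a product. *)
Lemma graph_cov_cubic l k i j x : U x ->
  cov_cubic (graph f) (fun=> Yvec R n) l k i j x =
  (pd l (A_ f i) x - (A_ f i x *m A_ f l x - A_ f l x *m A_ f i x
     - \sum_m A_ f l x i m *: A_ f m x)) j k.
Proof.
move=> Ux; rewrite /cov_cubic.
rewrite (partial_ext l oU (G := fun y => A_ f i y j k)) //; last first.
  by move=> y Uy; rewrite graph_cubic.
rewrite [RHS]cov_entry pdE; congr (_ + _).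
apply: eq_bigr => m _.
by rewrite !graph_levi_civita // !graph_cubic.
Qed.

End GraphGeometry.

(** * Consequences of a parallel cubic form *)

HB.lock Definition Lmul (R : realType) (n : nat) (f : 'rV[R]_n -> R)
    (x v : 'rV[R]_n) : 'M[R]_n := \sum_i v 0 i *: A_ f i x.

Section Multiplication.
Context {R : realType} {n : nat} (f : 'rV[R]_n -> R) (x : 'rV[R]_n).

Lemma LmulE v : Lmul f x v = \sum_i v 0 i *: A_ f i x.
Proof. by rewrite Lmul.unlock. Qed.

Lemma Lmul_linear : linear (Lmul f x).
Proof.
move=> a u v; rewrite !LmulE scaler_sumr -big_split; apply: eq_bigr => i _ /=.
by rewrite addmxE scalemxE scalerDl scalerA.
Qed.

HB.instance Definition _ := GRing.isLinear.Build _ _ _ _ (Lmul f x) Lmul_linear.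

Lemma Lmul_delta i : Lmul f x (delta_mx 0 i) = A_ f i x.
Proof.
rewrite LmulE (bigD1 i) //= mxE !eqxx scale1r big1 ?addr0 // => j ji.
by rewrite mxE eqxx (negbTE ji) scale0r.
Qed.

Lemma Lmul_row i (M : 'M[R]_n) : \sum_m M i m *: A_ f m x = Lmul f x (delta_mx 0 i *m M).
Proof. by rewrite -rowE LmulE; apply: eq_bigr => m _; rewrite rowmxE. Qed.

End Multiplication.

Section DerivationIdentity.
Context {R : realFieldType} {n : nat} (L : {linear 'rV[R]_n -> 'M[R]_n}).
Implicit Types (z : 'rV[R]_n) (a b c W : 'M[R]_n).

(** The second derivative of the multiplication by a fixed [z]: [a] is this multiplication, [b] and
    [c] are those by the directions of the inner and the outer derivative, and [W] is the one by
    their product. *)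
Let E z a b c W := (a *m c - c *m a - L (z *m c)) *m b + a *m (b *m c - c *m b - W)
  - ((b *m c - c *m b - W) *m a + b *m (a *m c - c *m a - L (z *m c)))
  - (L (z *m b) *m c - c *m L (z *m b) - L (z *m b *m c) + L (z *m (b *m c - c *m b - W))).

(** A Ricci identity: antisymmetrising the second derivative in its two directions leaves exactly
    the failure of the commutator to be a derivation. *)
Lemma derivation_of_symmetry z a b c W : E z a b c W = E z a c b W ->
  L (z *m (b *m c - c *m b)) = a *m (b *m c - c *m b) - (b *m c - c *m b) *m a.
Proof.
have LB u v : L (u - v) = L u - L v by exact: linearB.
rewrite /E !mulmxBr !LB !mulmxBl ?mulmxBr !mulmxA; mxlin.
Qed.

Lemma sum_dir (h h0 V : 'M[R]_n) (v w : 'rV[R]_n) (a b : 'I_n -> 'M[R]_n) :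
  (forall l, h *m a l = h0 *m (b l + V *m b l + b l *m V - L (v *m b l))) ->
  let S := \sum_l w 0 l *: b l in
  h *m (\sum_l w 0 l *: a l) = h0 *m (S + V *m S + S *m V - L (v *m S)).
Proof.
move=> Eab S; rewrite mulmx_sumr.
rewrite (eq_bigr (fun l => w 0 l *: (h *m a l))); last by move=> l _; rewrite scalemxAr.
rewrite /S [v *m _]mulmx_sumr [V *m _]mulmx_sumr mulmx_suml (linear_sum L) /=.
rewrite -!big_split -sumrB mulmx_sumr; apply: eq_bigr => l _ /=.
rewrite Eab scalemxAr; congr (_ *m _).
rewrite -!scalemxAr -!scalemxAl linearZ /=.
by rewrite scalerBr !scalerDr.
Qed.

End DerivationIdentity.

Section ParallelCubicForm.
Context {R : realType} {n : nat}.
Variables (U : set 'rV[R]_n) (f : 'rV[R]_n -> R).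
Hypotheses (dU : is_domain U) (sf : smooth_on U f) (cf : strictly_convex_on U f).
Hypothesis par : parallel_cubic U (graph f) (fun=> Yvec R n).
Implicit Types (x y : 'rV[R]_n).

Let oU : open U. Proof. by case: dU. Qed.
Local Notation A := (A_ f).
Local Notation L := (Lmul f).
Local Notation G := (hessian f).
Local Notation H := (fun x => invmx (hessian f x)).

Let sA l : msmooth U (A l). Proof. exact: msmooth_A. Qed.
Let sH : msmooth U H. Proof. exact: msmooth_invhessian. Qed.
Let sG : msmooth U G. Proof. exact: msmooth_hessian. Qed.

Lemma pd_A l i x : U x -> pd l (A i) x =
  A i x *m A l x - A l x *m A i x - L x (delta_mx 0 i *m A l x).
Proof.
move=> Ux; rewrite -Lmul_row; apply/matrixP => j k.
apply/eqP; rewrite -subr_eq0 -oppmxE -addmxE.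
by rewrite -(graph_cov_cubic oU sf l k i j Ux) par.
Qed.

Lemma msmooth_Lmul (w : 'rV[R]_n -> 'rV[R]_n) : msmooth U w ->
  msmooth U (fun x => L x (w x)).
Proof.
move=> sw; apply: (msmooth_ext oU (fun y _ => esym (LmulE f y (w y)))).
by apply: msmooth_sum => // i; apply: msmooth_scale.
Qed.

Lemma pd_Lmul l (w : 'rV[R]_n -> 'rV[R]_n) x : msmooth U w -> U x ->
  pd l (fun y => L y (w y)) x =
  L x (w x) *m A l x - A l x *m L x (w x) - L x (w x *m A l x) + L x (pd l w x).
Proof.
move=> sw Ux; rewrite (pd_ext l oU (fun y _ => LmulE f y (w y)) Ux).
rewrite (pd_sum _ l oU) // => [|i]; last exact: msmooth_scale.
have E (v : 'rV[R]_n) : \sum_i (v *m A l x) 0 i *: A i x = \sum_i v 0 i *: L x (delta_mx 0 i *m A l x).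
  rewrite -LmulE {1}(row_sum_delta v) mulmx_suml linear_sum /=.
  by apply: eq_bigr => i _; rewrite -scalemxAl linearZ.
rewrite !LmulE E mulmx_suml mulmx_sumr -!sumrB -big_split /=; apply: eq_bigr => i _.
rewrite (pd_scale l oU (sw 0 i) (sA i) Ux) (pd_A l i Ux) (pdE l w x 0 i).
by rewrite -scalemxAl -(scalemxAr (w x 0 i) (A l x) (A i x)) !scalerBr [LHS]addrC.
Qed.

Lemma pd_Lmul_cst l z x : U x -> pd l (fun y => L y z) x =
  L x z *m A l x - A l x *m L x z - L x (z *m A l x).
Proof.
move=> Ux; rewrite (pd_Lmul l (w := fun=> z)) ?pd_cst ?linear0 ?addr0 //.
exact: msmooth_cst.
Qed.

Lemma Lmul_comm x (v w : 'rV[R]_n) : U x -> v *m L x w = w *m L x v.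
Proof.
move=> Ux.
have E (a b : 'rV[R]_n) : a *m L x b =
    \sum_i \sum_j (a 0 i * b 0 j) *: (delta_mx 0 i *m A j x).
  rewrite {1}(row_sum_delta a) mulmx_suml; apply: eq_bigr => i _.
  rewrite LmulE mulmx_sumr; apply: eq_bigr => j _.
  by rewrite -scalemxAl -scalemxAr scalerA.
rewrite !E exchange_big /=; apply: eq_bigr => i _; apply: eq_bigr => j _.
by rewrite mulrC (A_comm oU sf).
Qed.

Lemma Lmul_sym x v : U x -> L x v *m G x = G x *m (L x v)^T.
Proof.
move=> Ux; rewrite LmulE mulmx_suml raddf_sum /= mulmx_sumr; apply: eq_bigr => i _.
rewrite [(_ *: _)^T]linearZ /= -scalemxAl -scalemxAr; congr (_ *: _).
exact: (A_sym oU sf cf).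
Qed.

(** The analytic input is the equality of the mixed derivatives of [y |-> L y z]; the product of the
    two directions is symmetric by commutativity. *)
Lemma Lmul_der_basis k l z x : U x ->
  L x (z *m (A l x *m A k x - A k x *m A l x)) =
  L x z *m (A l x *m A k x - A k x *m A l x) -
  (A l x *m A k x - A k x *m A l x) *m L x z.
Proof.
move=> Ux.
have sz : msmooth U (fun y : 'rV[R]_n => z) by exact: msmooth_cst.
have sLz : msmooth U (fun y => L y z) by exact: (msmooth_Lmul sz).
have szA m : msmooth U (fun y => z *m A m y) by exact: msmoothM.
have E a b : pd a (pd b (fun y => L y z)) x =
   (L x z *m A a x - A a x *m L x z - L x (z *m A a x)) *m A b x
   + L x z *m (A b x *m A a x - A a x *m A b x - L x (delta_mx 0 b *m A a x))
   - ((A b x *m A a x - A a x *m A b x - L x (delta_mx 0 b *m A a x)) *m L x z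
      + A b x *m (L x z *m A a x - A a x *m L x z - L x (z *m A a x)))
   - (L x (z *m A b x) *m A a x - A a x *m L x (z *m A b x) - L x (z *m A b x *m A a x)
      + L x (z *m (A b x *m A a x - A a x *m A b x - L x (delta_mx 0 b *m A a x)))).
  rewrite (pd_ext a oU (pd_Lmul_cst b z)) //.
  rewrite (pdB a oU) //; [|by apply: msmoothB => //; exact: msmoothM|exact: msmooth_Lmul].
  rewrite (pdB a oU) //; [|exact: msmoothM|exact: msmoothM].
  rewrite (pdM a oU) // (pdM a oU) // pd_Lmul_cst // pd_A //.
  by rewrite pd_Lmul // (pdMl _ a oU) // pd_A.
apply: derivation_of_symmetry.
have W : delta_mx 0 k *m A l x = delta_mx 0 l *m A k x :> 'rV[R]_n.
  exact: (A_comm oU sf).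
apply: etrans (esym (E k l)) _; apply: etrans (pdC k l oU sLz Ux) _.
by apply: etrans (E l k) _; rewrite W.
Qed.

Lemma Lmul_der x (u v z : 'rV[R]_n) : U x ->
  L x (z *m (L x v *m L x u - L x u *m L x v)) =
  L x z *m (L x v *m L x u - L x u *m L x v) -
  (L x v *m L x u - L x u *m L x v) *m L x z.
Proof.
move=> Ux.
have -> : L x v *m L x u - L x u *m L x v =
   \sum_l \sum_k (v 0 l * u 0 k) *: (A l x *m A k x - A k x *m A l x).
  have -> : L x v *m L x u = \sum_l \sum_k (v 0 l * u 0 k) *: (A l x *m A k x).
    rewrite (LmulE f x v) mulmx_suml; apply: eq_bigr => l _; rewrite LmulE mulmx_sumr.
    by apply: eq_bigr => k _; rewrite -scalemxAl -scalemxAr scalerA.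
  have -> : L x u *m L x v = \sum_l \sum_k (v 0 l * u 0 k) *: (A k x *m A l x).
    rewrite (LmulE f x v) mulmx_sumr; apply: eq_bigr => l _; rewrite LmulE mulmx_suml.
    by apply: eq_bigr => k _; rewrite -scalemxAr -scalemxAl scalerA.
  rewrite -sumrB; apply: eq_bigr => l _; rewrite -sumrB; apply: eq_bigr => k _.
  by rewrite scalerBr.
have [Lz LzE] : exists M, M = L x z by eexists.
rewrite -LzE mulmx_sumr linear_sum [in RHS]mulmx_sumr mulmx_suml -sumrB.
apply: eq_bigr => l _ /=.
rewrite mulmx_sumr linear_sum [in RHS]mulmx_sumr mulmx_suml -sumrB.
apply: eq_bigr => k _ /=.
rewrite -[in LHS]scalemxAr [LHS]linearZ /= -[Lz *m _]scalemxAr -scalemxAl -scalerBr LzE; congr (_ *: _).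
exact: Lmul_der_basis.
Qed.

Lemma pd_H l x : U x -> pd l H x = 2 *: (H x *m A l x).
Proof.
move=> Ux; rewrite (pd_invmx l oU sG) //; last by move=> y; exact: hessian_unit.
by rewrite A_E -third_pd -scalemxAr scalerA mulrN mulfV // scaleN1r mulmxA.
Qed.

(** Up to [2 H], the right side is the polarised quadratic representation
    [L_a L_b + L_b L_a - L_(ab)] of a Jordan algebra. *)
Lemma pd2_H k l x : U x -> pd k (pd l H) x =
  2 *: (H x *m (A k x *m A l x + A l x *m A k x - L x (delta_mx 0 l *m A k x))).
Proof.
move=> Ux; rewrite (pd_ext k oU (pd_H l)) // (pdZ _ k oU) //; last exact: msmoothM.
rewrite (pdM k oU) // pd_H // pd_A //; congr (_ *: _).
rewrite -!scalemxAl !mulmxBr !mulmxDr ?mulmxA.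
mxlin.
Qed.

(** The bracket in the third derivative of [H]. The multiplications [D1] and [D2] by triple products
    are expanded by [Jordan1] and by its adjoint [Jordan2]; [D3] and all remaining words cancel. *)
Let third_order (a b c Lw La Lk D1 D2 D3 : 'M[R]_n) :
  D1 = La *m b + Lk *m c + Lw *m a - a *m b *m c - c *m b *m a ->
  D2 = c *m Lk + b *m La + a *m Lw - b *m c *m a - a *m c *m b ->
  2 *: (a *m (b *m c + c *m b - Lw)) + ((b *m a - a *m b - Lk) *m c + b *m (c *m a - a *m c - La)
   + ((c *m a - a *m c - La) *m b + c *m (b *m a - a *m b - Lk))
   - (Lw *m a - a *m Lw - D3 + (D3 - D1 - D2))) = 0.
Proof.
move=> -> ->; rewrite !mulmxBr !mulmxBl ?mulmxDr ?mulmxBr !mulmxA; mxlin.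
Qed.

Lemma pd3_H j k l x : U x -> pd j (pd k (pd l H)) x = 0.
Proof.
move=> Ux; rewrite (pd_ext j oU (pd2_H k l)) //.
have sw : msmooth U (fun y => delta_mx 0 l *m A k y : 'rV[R]_n).
  by apply: msmoothM => //; exact: msmooth_cst.
have sL := msmooth_Lmul sw.
have sAA a b : msmooth U (fun y => A a y *m A b y) by exact: msmoothM.
have sS : msmooth U (fun y => A k y *m A l y + A l y *m A k y - L y (delta_mx 0 l *m A k y)).
  by apply: msmoothB => //; exact: msmoothD.
rewrite (pdZ _ j oU) //; last exact: msmoothM.
rewrite (pdM j oU) // pd_H // (pdB j oU) //; last exact: msmoothD.
rewrite (pdD j oU) // !(pdM j oU) // pd_Lmul // (pdMl _ j oU) // !pd_A //.
have factH (Hx a S T : 'M[R]_n) : (2 *: (Hx *m a)) *m S + Hx *m T = Hx *m (2 *: (a *m S) + T).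
  by rewrite mulmxDr -scalemxAl -mulmxA scalemxAr.
rewrite factH.
have J1 := Jordan1 (L := Lmul f x) (fun u v => Lmul_comm v u Ux) (fun u v z => Lmul_der u v z Ux).
have J2 := Jordan2 (L := Lmul f x) (fun u v => Lmul_comm v u Ux) (fun u v z => Lmul_der u v z Ux)
  (hessian_unit cf Ux) (fun u => Lmul_sym u Ux).
have jk : delta_mx 0 j *m A k x = delta_mx 0 k *m A j x :> 'rV[R]_n by exact: (A_comm oU sf).
have jl : delta_mx 0 j *m A l x = delta_mx 0 l *m A j x :> 'rV[R]_n by exact: (A_comm oU sf).
have lk : delta_mx 0 k *m A l x = delta_mx 0 l *m A k x :> 'rV[R]_n by exact: (A_comm oU sf).
have -> : L x (delta_mx 0 l *m (A k x *m A j x - A j x *m A k x - L x (delta_mx 0 k *m A j x))) =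
   L x (delta_mx 0 l *m A k x *m A j x) - L x (delta_mx 0 l *m A j x *m A k x)
   - L x (delta_mx 0 k *m A j x *m A l x).
  have LB u v : L x (u - v) = L x u - L x v by exact: linearB.
  by rewrite !mulmxBr !LB !mulmxA (Lmul_comm (delta_mx 0 l)) // Lmul_delta.
have E1 := J1 (delta_mx 0 k) (delta_mx 0 j) (delta_mx 0 l).
have E2 := J2 (delta_mx 0 l) (delta_mx 0 j) (delta_mx 0 k).
rewrite /= !Lmul_delta ?jk ?jl ?lk in E1 E2.
by rewrite (third_order (L x (delta_mx 0 l *m A k x *m A j x)) E1 E2) mulmx0 scaler0.
Qed.

Section LinearComposition.
Context {m p q : nat} (phi : {linear 'rV[R]_m -> 'M[R]_(p, q)}).
Variable w : 'rV[R]_n -> 'rV[R]_m.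
Hypothesis sw : msmooth U w.

Let phiE y : phi (w y) = \sum_i w y 0 i *: phi (delta_mx 0 i).
Proof. by rewrite {1}(row_sum_delta (w y)) linear_sum; apply: eq_bigr => i _; rewrite linearZ. Qed.

Lemma msmooth_linear : msmooth U (fun y => phi (w y)).
Proof.
apply: (msmooth_ext oU (fun y _ => esym (phiE y))); apply: msmooth_sum => // i.
by apply: msmooth_scale => //; exact: msmooth_cst.
Qed.

Lemma pd_linear l x : U x -> pd l (fun y => phi (w y)) x = phi (pd l w x).
Proof.
move=> Ux; rewrite (pd_ext l oU (fun y _ => phiE y)) // (pd_sum _ l oU) //; last first.
  by move=> i; apply: msmooth_scale => //; exact: msmooth_cst.
rewrite [in RHS](row_sum_delta (pd l w x)) linear_sum; apply: eq_bigr => i _.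
rewrite linearZ /= (pd_scale l oU) //; last exact: msmooth_cst.
by rewrite pd_cst scaler0 addr0 pdE.
Qed.

End LinearComposition.

Section Quadratic.
Variable x0 : 'rV[R]_n.
Hypothesis Ux0 : U x0.
Local Notation L0 := (Lmul f x0).
Local Notation H0 := (invmx (hessian f x0)).

Let v x := x - x0.
Let sv : msmooth U v.
Proof. by apply: msmoothB => //; [exact: msmooth_id|exact: msmooth_cst]. Qed.
Let pdv l x : U x -> pd l v x = delta_mx 0 l.
Proof.
move=> Ux; rewrite (pdB l oU) ?pd_id ?pd_cst ?subr0 //; [exact: msmooth_id|exact: msmooth_cst].
Qed.
Let sLv : msmooth U (fun y => L0 (v y)).
Proof. exact: (msmooth_linear L0 sv). Qed.
Let pdLv l x : U x -> pd l (fun y => L0 (v y)) x = A l x0.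
Proof. by move=> Ux; rewrite (pd_linear L0 sv) // pdv //= Lmul_delta. Qed.
Let svB l : msmooth U (fun y => v y *m A l x0).
Proof. by apply: msmoothM => //; exact: msmooth_cst. Qed.
Let scA l : msmooth U (fun y : 'rV[R]_n => A l x0).
Proof. exact: msmooth_cst. Qed.
Let L00 : L0 0 = 0. Proof. exact: linear0. Qed.
Let comm := fun u w => Lmul_comm u w Ux0.

(** The second derivatives of [H] are constant by [pd3_H], so both sides have the same derivatives,
    and they agree at [x0]. *)
Lemma pd_invhessian l x : U x ->
  pd l H x = 2 *: (H0 *m (A l x0 + L0 (v x) *m A l x0 + A l x0 *m L0 (v x)
                          - L0 (v x *m A l x0))).
Proof.
move=> Ux; apply/eqP; rewrite -subr_eq0; apply/eqP.
pose W y := 2 *: (H0 *m (A l x0 + L0 (v y) *m A l x0 + A l x0 *m L0 (v y)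
                          - L0 (v y *m A l x0))).
have s1 : msmooth U (fun y => L0 (v y) *m A l x0) by exact: msmoothM.
have s2 : msmooth U (fun y => A l x0 *m L0 (v y)) by exact: msmoothM.
have s3 := msmooth_linear L0 (svB l).
have s4 := msmoothD oU (scA l) s1.
have s5 := msmoothD oU s4 s2.
have s6 := msmoothB oU s5 s3.
have s7 := msmoothM oU (msmooth_cst H0 oU) s6.
have sW : msmooth U W by exact: (msmooth_scale oU (smooth_cst _ oU) s7).
have spH := msmooth_pd l oU sH.
have pdW k y : U y -> pd k W y =
    2 *: (H0 *m (A k x0 *m A l x0 + A l x0 *m A k x0 - L0 (delta_mx 0 l *m A k x0))).
  move=> Uy; rewrite (pdZ _ k oU s7) // (pdMl _ k oU s6) // (pdB k oU s5 s3) //.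
  rewrite (pdD k oU s4 s2) // (pdD k oU (scA l) s1) // pd_cst add0r.
  rewrite (pdMr _ k oU sLv) // (pdMl _ k oU sLv) // pdLv // (pd_linear L0 (svB l)) //.
  rewrite (pdMr _ k oU sv) // pdv //.
  by rewrite (A_comm oU sf k l Ux0).
have sD := msmoothB oU spH sW.
have Z : pd l H x0 - W x0 = 0.
  by rewrite /W /v subrr !(L00, mul0mx, mulmx0, scaler0, addr0, subr0) pd_H // subrr.
rewrite -[RHS]Z; apply: (pd0_cst dU sD) => // k y Uy.
rewrite (pdB k oU spH sW) // pdW // -pd2_H //; apply/eqP; rewrite subr_eq0; apply/eqP.
apply: (pd0_cst dU (msmooth_pd k oU spH)) => // j z Uz; exact: pd3_H.
Qed.

(** The Taylor polynomial of [H] at [x0]. With the quadratic representation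
    [Q(a) = 2 L(a)^2 - L(a^2)], the bracket is formally [Q(1 + v)]. *)
Lemma invhessian_quadratic x : U x ->
  H x = H0 *m (1%:M + 2 *: L0 (v x) + 2 *: (L0 (v x) *m L0 (v x)) - L0 (v x *m L0 (v x))).
Proof.
move=> Ux; apply/eqP; rewrite -subr_eq0; apply/eqP.
pose W y := H0 *m (1%:M + 2 *: L0 (v y) + 2 *: (L0 (v y) *m L0 (v y)) - L0 (v y *m L0 (v y))).
have s1 : msmooth U (fun y => 2 *: L0 (v y)) := msmooth_scale oU (smooth_cst _ oU) sLv.
have s0 := msmoothM oU sLv sLv.
have s2 : msmooth U (fun y => 2 *: (L0 (v y) *m L0 (v y))) := msmooth_scale oU (smooth_cst _ oU) s0.
have s3 := msmoothM oU sv sLv.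
have s4 := msmooth_linear L0 s3.
have sc : msmooth U (fun y : 'rV[R]_n => 1%:M : 'M[R]_n) := msmooth_cst _ oU.
have s5 := msmoothD oU sc s1.
have s6 := msmoothD oU s5 s2.
have s7 := msmoothB oU s6 s4.
have sW : msmooth U W := msmoothM oU (msmooth_cst H0 oU) s7.
have sD := msmoothB oU sH sW.
have Z : H x0 - W x0 = 0.
  by rewrite /W /v subrr !(L00, mul0mx, mulmx0, scaler0, addr0, subr0) mulmx1 subrr.
rewrite -[RHS]Z; apply: (pd0_cst dU sD) => // l y Uy.
rewrite (pdB l oU sH sW) // pd_invhessian // (pdMl _ l oU s7) // (pdB l oU s6 s4) //.
rewrite (pdD l oU s5 s2) // (pdD l oU sc s1) // pd_cst add0r (pdZ _ l oU sLv) //.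
rewrite (pdZ _ l oU s0) // (pdM l oU sLv sLv) // pdLv // (pd_linear L0 s3) //.
rewrite (pdM l oU sv sLv) // pdv // pdLv // -(Lmul_delta f x0 l) (comm _ (v y)).
have LD a b : L0 (a + b) = L0 a + L0 b by exact: linearD.
rewrite /= (LD (v y *m _) (v y *m _)) (Lmul_delta f x0 l) !(mulmxDr, mulmxN) -!scalemxAr !mulmxDr.
mxlin.
Qed.

Lemma invhessian_dir x w : U x -> H x *m L x w =
  H0 *m (L0 w + L0 (v x) *m L0 w + L0 w *m L0 (v x) - L0 (v x *m L0 w)).
Proof.
move=> Ux.
have E l : H x *m A l x = H0 *m (A l x0 + L0 (v x) *m A l x0
     + A l x0 *m L0 (v x) - L0 (v x *m A l x0)).
  have := pd_invhessian l Ux; rewrite pd_H // => /scalerI.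
  by apply; rewrite pnatr_eq0.
have Lw : \sum_l w 0 l *: A l x0 = L0 w by rewrite LmulE.
have := sum_dir (L := L0) w E; rewrite /= Lw.
by rewrite -LmulE.
Qed.

Lemma pd_hessian l x : U x -> pd l G x = - 2 *: (L x (delta_mx 0 l) *m G x).
Proof.
move=> Ux; rewrite Lmul_delta A_E -scalemxAl scalerA mulmxKV; last exact: (hessian_unit cf).
by rewrite mulrNN mulfV // scale1r third_pd.
Qed.

End Quadratic.

End ParallelCubicForm.

(** * The unit field and the potential *)

Section UnitField.
Context {R : realType} {n : nat}.
Variables (U : set 'rV[R]_n) (f : 'rV[R]_n -> R).
Variables (G : 'rV[R]_n -> 'M[R]_n) (L : 'rV[R]_n -> {linear 'rV[R]_n -> 'M[R]_n}).
Variables (x0 e0 : 'rV[R]_n).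
Hypotheses (dU : is_domain U) (Ux0 : U x0) (sf : smooth_on U f) (sG : msmooth U G).
Hypotheses (Gu : forall y, U y -> G y \in unitmx) (Gsym : forall y, U y -> (G y)^T = G y).
Local Notation L0 := (L x0).
Local Notation G0 := (G x0).
Local Notation H0 := (invmx G0).
Local Notation P := (L0 e0).
Hypotheses (Lc : forall y u w, U y -> u *m L y w = w *m L y u)
  (Ls : forall y v, U y -> L y v *m G y = G y *m (L y v)^T).
Hypothesis pdG : forall l y, U y -> pd l G y = - 2 *: (L y (delta_mx 0 l) *m G y).
Hypothesis pd_grad : forall l y, U y -> pd l (fun y => \row_j partial j f y) y = delta_mx 0 l *m G y.
Hypothesis invG : forall y, U y -> invmx (G y) = H0 *m
  (1%:M + 2 *: L0 (y - x0) + 2 *: (L0 (y - x0) *m L0 (y - x0)) - L0 ((y - x0) *m L0 (y - x0))).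
Hypothesis invGL : forall y w, U y -> invmx (G y) *m L y w =
  H0 *m (L0 w + L0 (y - x0) *m L0 w + L0 w *m L0 (y - x0) - L0 ((y - x0) *m L0 w)).
Hypotheses (eP : e0 *m P = e0) (PP : P *m P = P)
  (PL : forall x, P *m L0 x = L0 x) (LP0 : forall x, L0 (x *m P) = L0 x).
Implicit Types (x y z : 'rV[R]_n).

Let oU : open U. Proof. by case: dU. Qed.
Let L0D a b : L0 (a + b) = L0 a + L0 b. Proof. exact: linearD. Qed.
Let L0B a b : L0 (a - b) = L0 a - L0 b. Proof. exact: linearB. Qed.

Definition unit_field y := e0 + (y - x0) *m P.
Local Notation ef := unit_field.

Lemma unit_fieldP y : ef y *m P = ef y.
Proof. by rewrite mulmxDl eP -mulmxA PP. Qed.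

Lemma PG0 : P *m G0 = G0 *m P^T.
Proof. exact: Ls. Qed.

(** The adjoint of [PL] with respect to [G0]. *)
Lemma mulLP x : L0 x *m P = L0 x.
Proof.
have E w : L0 w = G0 *m (L0 w)^T *m H0.
  by rewrite -Ls // mulmxK ?Gu.
rewrite {1}(E x) -mulmxA.
have -> : H0 *m P = P^T *m H0.
  by rewrite -[RHS](mulKmx (Gu Ux0)) [G0 *m (_ *m _)]mulmxA -PG0 -mulmxA mulmxV ?Gu // mulmx1.
by rewrite !mulmxA -[G0 *m _ *m P^T]mulmxA -trmx_mul PL -E.
Qed.

Lemma L0_compl x : L0 (x *m (1%:M - P)) = 0.
Proof. by rewrite mulmxBr mulmx1 L0B LP0 subrr. Qed.

(** In [invGL] every term contains the multiplication by [k] at [x0]; thus annihilating elements at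
    [x0] annihilate at all points. *)
Lemma Lmul_kernel y k : U y -> L0 k = 0 -> L y k = 0.
Proof.
move=> Uy k0; have := invGL k Uy.
rewrite k0 !mulmx0 mul0mx [L0 0]linear0 !addr0 subr0 mulmx0.
by move/(congr1 (mulmx (G y))); rewrite mulKVmx ?Gu // mulmx0.
Qed.

Lemma L0_unit_field y : L0 (ef y) = P + L0 (y - x0).
Proof. by rewrite /unit_field L0D LP0. Qed.

Let vP y : (y - x0) *m P = e0 *m L0 (y - x0). Proof. by rewrite Lc. Qed.

(** After multiplication by [invmx (G y)], both sides are explicit polynomials in [y - x0], by
    [invGL] and by [invG]. *)
Lemma Lmul_unit_field y : U y -> L y (ef y) = P.
Proof.
move=> Uy.
suff : invmx (G y) *m L y (ef y) = invmx (G y) *m P.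
  by move/(congr1 (mulmx (G y))); rewrite !mulKVmx ?Gu.
rewrite invGL // (invG Uy) -[in RHS]mulmxA; congr (_ *m _).
have [v vE] : exists v, v = y - x0 by eexists.
rewrite L0_unit_field -vE.
rewrite !mulmxDr !mulmxDl mul1mx !mulNmx -!scalemxAl -!mulmxA !mulLP !PL.
rewrite L0D LP0; mxlin.
Qed.

Lemma PLmul y x : U y -> P *m L y x = L y x.
Proof.
move=> Uy; apply: row_mulP => w; rewrite mulmxA (Lc (w *m P) _ Uy) (Lc w _ Uy).
have := Lmul_kernel Uy (L0_compl w).
rewrite mulmxBr mulmx1 => /eqP.
have -> : L y (w - w *m P) = L y w - L y (w *m P) by exact: linearB.
by rewrite subr_eq0 => /eqP ->.
Qed.

(** A derivative of [G] is a multiplication followed by [G], hence vanishes on the annihilator. This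
    constant part of the Hessian is the origin of [quadratic_part]. *)
Lemma hessian_compl y : U y -> (1%:M - P) *m G y = (1%:M - P) *m G0.
Proof.
move=> Uy; have sM : msmooth U (fun z => (1%:M - P) *m G z).
  by apply: msmoothM => //; exact: msmooth_cst.
apply: (pd0_cst dU sM) => // l z Uz; rewrite (pdMl _ l oU) //.
rewrite pdG // -scalemxAr mulmxA; suff -> : (1%:M - P) *m L z (delta_mx 0 l) = 0.
  by rewrite mul0mx scaler0.
apply: row_mulP => w; rewrite mulmxA mulmx0 Lc //.
by rewrite Lmul_kernel ?mulmx0 // L0_compl.
Qed.

Lemma PG y : U y -> P *m G y = G y *m P^T.
Proof. by move=> Uy; rewrite -(Lmul_unit_field Uy) Ls. Qed.

Lemma LmulP y x : U y -> L y x *m P = L y x.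
Proof.
move=> Uy; have E : L y x = G y *m (L y x)^T *m invmx (G y).
  by rewrite -Ls // mulmxK ?Gu.
have GP : invmx (G y) *m P = P^T *m invmx (G y).
  by rewrite -[RHS](mulKmx (Gu Uy)) [G y *m (_ *m _)]mulmxA -PG // -mulmxA mulmxV ?Gu // mulmx1.
rewrite E -mulmxA GP !mulmxA -[G y *m _ *m P^T]mulmxA -trmx_mul PLmul //.
Qed.

Lemma unit_field_third l y : U y -> ef y *m pd l G y = - 2 *: (delta_mx 0 l *m P *m G y).
Proof.
move=> Uy; rewrite pdG // -scalemxAr mulmxA (Lc (ef y) _ Uy).
by rewrite Lmul_unit_field.
Qed.

Lemma msmooth_unit_field : msmooth U ef.
Proof.
apply: msmoothD => //; first exact: msmooth_cst.
apply: msmoothM => //; last exact: msmooth_cst.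
by apply: msmoothB => //; [exact: msmooth_id|exact: msmooth_cst].
Qed.

Lemma pd_unit_field l y : U y -> pd l ef y = delta_mx 0 l *m P.
Proof.
move=> Uy; have sid := msmooth_id oU; have sc p q M := @msmooth_cst R n U p q M oU.
rewrite (pdD l oU) //; last by apply: msmoothM => //; exact: msmoothB.
rewrite pd_cst add0r (pdMr _ l oU) ?(pdB l oU) ?pd_id ?pd_cst ?subr0 //.
exact: msmoothB.
Qed.

(** The metric dual of minus the unit field. Its derivative is the part [P G] of the Hessian, which
    makes it the differential of [potential]. *)
Definition gradient y : 'rV[R]_n := - (ef y *m G y).

Lemma gradientP y : U y -> gradient y *m P^T = gradient y.
Proof. by move=> Uy; rewrite /gradient mulNmx -mulmxA -PG // mulmxA unit_fieldP. Qed.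

Let Q := (1%:M - P) *m G0.

Let QT : Q^T = Q.
Proof.
rewrite /Q trmx_mul Gsym // linearB /= trmx1 mulmxBr mulmxBl mulmx1 mul1mx.
by rewrite PG0.
Qed.

Let Phi y : 'rV[R]_n := \row_j partial j f y.

Let sPhi : msmooth U Phi.
Proof.
move=> i j; apply: (smooth_ext oU _ (smooth_partial j sf)) => y _.
by rewrite mxE.
Qed.

(** The derivatives of the three terms are [G], [(1 - P) G] and [P G], so [psi] is constant; its
    value is the linear part of [f]. *)
Let psi y := Phi y - (y - x0) *m Q - gradient y.

Let sv : msmooth U (fun y => y - x0).
Proof. by apply: msmoothB => //; [exact: msmooth_id|exact: msmooth_cst]. Qed.

Let pdv l y : U y -> pd l (fun y => y - x0) y = delta_mx 0 l.
Proof.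
move=> Uy; rewrite (pdB l oU) ?pd_id ?pd_cst ?subr0 //; [exact: msmooth_id|exact: msmooth_cst].
Qed.

Let sefG : msmooth U (fun y => ef y *m G y).
Proof. by apply: msmoothM => //; exact: msmooth_unit_field. Qed.

Let pdefG l y : U y -> pd l (fun y => ef y *m G y) y = - (delta_mx 0 l *m P *m G y).
Proof.
move=> Uy; rewrite (pdM l oU msmooth_unit_field sG) // pd_unit_field //.
rewrite unit_field_third //; mxlin.
Qed.

Lemma msmooth_gradient : msmooth U gradient.
Proof. exact: msmoothN. Qed.

Lemma pd_gradient l y : U y -> pd l gradient y = delta_mx 0 l *m P *m G y.
Proof. by move=> Uy; rewrite (pdN l oU sefG) // pdefG // opprK. Qed.

Let psi_cst y : U y -> psi y = psi x0.
Proof.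
move=> Uy; have svQ : msmooth U (fun y => (y - x0) *m Q).
  by apply: msmoothM => //; exact: msmooth_cst.
have sPQ := msmoothB oU sPhi svQ.
have sg := msmooth_gradient.
apply: (pd0_cst dU (msmoothB oU sPQ sg)) => // l z Uz.
rewrite (pdB l oU sPQ sg) // (pdB l oU sPhi svQ) // (pdMr _ l oU sv) // pdv // pd_grad //.
rewrite pd_gradient // /Q -(hessian_compl Uz) mulmxBl mul1mx mulmxBr mulmxA.
mxlin.
Qed.

Definition quadratic_part y := ((y - x0) *m ((1%:M - P) *m G0) *m (y - x0)^T) 0 0.

Definition linear_part : 'rV[R]_n := psi x0.

Definition potential y := f y - 2^-1 * quadratic_part y - (linear_part *m y^T) 0 0.

Let squad : smooth_on U quadratic_part.
Proof.
have s1 : msmooth U (fun y => (y - x0) *m Q) by apply: msmoothM => //; exact: msmooth_cst.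
have s2 : msmooth U (fun y => (y - x0)^T) by exact: msmooth_tr.
exact: (msmoothM oU s1 s2 0 0).
Qed.

Let slin : smooth_on U (fun y => (linear_part *m y^T) 0 0).
Proof.
have s2 : msmooth U (fun y : 'rV[R]_n => y^T).
  exact/msmooth_tr/msmooth_id.
exact: (msmoothM oU (msmooth_cst linear_part oU) s2 0 0).
Qed.

Lemma smooth_potential : smooth_on U potential.
Proof.
move=> k; apply: (Ck_ext oU (F := fun y => f y + (- 2^-1) * quadratic_part y
    + (-1) * (linear_part *m y^T) 0 0)).
  by move=> y _; rewrite /potential mulN1r mulNr.
apply: CkD => //; first apply: CkD => //.
  by apply: CkM => //; exact: Ck_cst.
by apply: CkM => //; exact: Ck_cst.
Qed.

Lemma partial_potential l y : U y -> partial l potential y = gradient y 0 l.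
Proof.
move=> Uy.
have sc c := @smooth_cst R n U c oU.
have E : partial l potential y = partial l f y + (- 2^-1) * partial l quadratic_part y
    + (-1) * partial l (fun y => (linear_part *m y^T) 0 0) y.
  rewrite (partial_ext l oU (G := fun y => f y + (- 2^-1) * quadratic_part y
    + (-1) * (linear_part *m y^T) 0 0)) //; last first.
    by move=> z _; rewrite /potential mulN1r mulNr.
  have s1 : smooth_on U (fun y => (- 2^-1) * quadratic_part y).
    by move=> k; apply: CkM => //; exact: Ck_cst.
  have s2 : smooth_on U (fun y => (-1) * (linear_part *m y^T) 0 0).
    by move=> k; apply: CkM => //; exact: Ck_cst.
  have s3 : smooth_on U (fun y => f y + (- 2^-1) * quadratic_part y).
    by move=> k; apply: CkD.
  rewrite (smooth_partialD l oU s3 s2) // (smooth_partialD l oU sf s1) //.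
  rewrite (smooth_partialM l oU (sc _) squad) // (smooth_partialM l oU (sc _) slin) //.
  by rewrite !partial_cst !mul0r !add0r.
have sT : msmooth U (fun y : 'rV[R]_n => y^T).
  exact/msmooth_tr/msmooth_id.
have svT : msmooth U (fun y => (y - x0)^T).
  exact: msmooth_tr.
have svQ : msmooth U (fun y => (y - x0) *m Q).
  by apply: msmoothM => //; exact: msmooth_cst.
have Eq : partial l quadratic_part y = 2 * ((y - x0) *m Q) 0 l.
  rewrite -(pdE l (fun y => (y - x0) *m Q *m (y - x0)^T) y 0 0).
  rewrite (pdM l oU svQ svT) // (pdMr _ l oU sv) // pdv // pd_tr pdv //.
  rewrite addmxE trmx_delta -colE [col _ _ _ _]mxE.
  have -> : ((delta_mx 0 l : 'rV_n) *m Q *m (y - x0)^T) 0 0 = ((y - x0) *m Q) 0 l.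
    rewrite -[LHS](trmxE (delta_mx 0 l *m Q *m (y - x0)^T) 0 0) trmx_mul trmxK [(_ *m Q)^T]trmx_mul QT trmx_delta.
    by rewrite mulmxA -colE [LHS]mxE.
  by rewrite mulr_natl mulr2n.
have El : partial l (fun y => (linear_part *m y^T) 0 0) y = linear_part 0 l.
  rewrite -(pdE l (fun y => linear_part *m y^T) y 0 0) (pdMl _ l oU sT) //.
  by rewrite pd_tr pd_id trmx_delta -colE [LHS]mxE.
rewrite E Eq El /linear_part -(psi_cst Uy) /psi !(addmxE, oppmxE) [Phi y 0 l]mxE.
by lra.
Qed.

Let tr11 (M : 'M[R]_1) : M^T = M.
Proof. by apply/matrixP => i j; rewrite trmxE !ord1. Qed.

(** The squared length of the unit field is constant: differentiating its factors [e G] and [e]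
    gives opposite contributions. *)
Lemma gradient_unit_field y : U y ->
  (gradient y *m (ef y)^T) 0 0 = - (e0 *m G0 *m e0^T) 0 0.
Proof.
move=> Uy.
have sefT : msmooth U (fun y => (ef y)^T).
  exact/msmooth_tr/msmooth_unit_field.
have E : ef y *m G y *m (ef y)^T = ef x0 *m G x0 *m (ef x0)^T.
  apply: (pd0_cst dU (msmoothM oU sefG sefT)) => // l z Uz.
  rewrite (pdM l oU sefG sefT) // pdefG // pd_tr pd_unit_field // trmx_mul mulNmx.
  apply/eqP; rewrite addrC subr_eq0; apply/eqP.
  rewrite -[RHS]tr11 !trmx_mul trmxK Gsym // !mulmxA.
  by [].
rewrite /gradient mulNmx oppmxE E /unit_field subrr mul0mx addr0 //.
Qed.

(* Since the inverse Hessian is quadratic in the unit field, the gradient of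
   the potential is homogeneous of degree -1. *)
Lemma gradient_homogeneous y y' r : U y -> U y' -> r != 0 -> ef y' = r *: ef y ->
  gradient y' = r^-1 *: gradient y.
Proof.
move=> Uy Uy' r0 E.
have quad z : U z -> gradient y *m invmx (G z) =
    gradient y *m H0 *m (2 *: (L0 (ef z) *m L0 (ef z)) - L0 (ef z *m L0 (ef z))).
  move=> Uz; rewrite invG //.
  have HP : H0 *m P = P^T *m H0.
    by rewrite -[RHS](mulKmx (Gu Ux0)) [G0 *m (_ *m _)]mulmxA -PG0 -mulmxA mulmxV ?Gu // mulmx1.
  (* This replaces the identity matrix in [invG] by [P], and [P + 2 L(v) + 2 L(v)^2 - L(v^2)] is the
     quadratic representation of [ef z]. *)
  have K : gradient y *m H0 *m (1%:M - P) = 0.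
    by rewrite mulmxBr mulmx1 -mulmxA HP mulmxA gradientP // subrr.
  rewrite mulmxA -[RHS]addr0 -K -mulmxDr; congr (_ *m _).
  have [v vE] : exists v, v = z - x0 by eexists.
  rewrite L0_unit_field -vE.
  have -> : ef z *m (P + L0 v) = e0 + v *m P + (v *m P + v *m L0 v).
    rewrite mulmxDr unit_fieldP; congr (_ + _).
    - by rewrite /unit_field -vE.
    by rewrite /unit_field -vE mulmxDl (Lc e0 v Ux0) -mulmxA PL.
  rewrite !L0D !LP0 !mulmxDr !mulmxDl !mulLP !PL; mxlin.
have I z : U z -> gradient z *m invmx (G z) = - ef z.
  by move=> Uz; rewrite /gradient mulNmx mulmxK ?Gu.
(* By [quad], [invmx (G y')] acts on [gradient y] as [r^2] times [invmx (G y)], which gives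
   [- r^2 ef y], that is [- r ef y']. *)
suff : r^-1 *: gradient y *m invmx (G y') = gradient y' *m invmx (G y').
  by move/(congr1 (mulmx^~ (G y'))); rewrite !mulmxKV ?Gu.
rewrite I // -scalemxAl quad // E.
have LZ a : L0 (r *: a) = r *: L0 a by exact: linearZ.
have -> : 2 *: (L0 (r *: ef y) *m L0 (r *: ef y)) - L0 (r *: ef y *m L0 (r *: ef y)) =
    (r * r) *: (2 *: (L0 (ef y) *m L0 (ef y)) - L0 (ef y *m L0 (ef y))).
  rewrite LZ -!scalemxAl -!scalemxAr !LZ scalerBr !scalerA.
  by congr (_ *: _ - _); ring.
by rewrite -scalemxAr -quad // I // scalerN !scalerN scalerA mulKf.
Qed.

End UnitField.

(** * Images with the quotient topology *)

Lemma second_countable_row {R : realType} n : @second_countable 'rV[R]_n.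
Proof.
pose B (c : 'rV[rat]_n * nat) : set 'rV[R]_n := ball (map_mx ratr c.1 : 'rV[R]_n) (c.2.+1%:R^-1).
exists (range B).
  apply: sub_countable (card_image_le _ _) _; exact: countableP.
split; first by move=> _ [c _ <-]; apply: ball_open; rewrite invr_gt0 ltr0n.
move=> x W /nbhs_ballP[e /= e0 eW].
have [m me] : exists m : nat, m.+1%:R^-1 < e / 2.
  have [//|m] := @ltr_add_invr R 0 (e / 2); first by rewrite divr_gt0.
  by rewrite add0r; exists m.
have /choice[q qx] : forall j, exists q : rat, `|x 0 j - ratr q| < m.+1%:R^-1.
  move=> j; have : x 0 j - m.+1%:R^-1 < x 0 j + m.+1%:R^-1.
    by rewrite ltrBlDr -addrA ltrDl -mulr2n mulrn_wgt0 ?invr_gt0 ?ltr0n.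
  by move=> /rat_in_itvoo[q /itvP xq]; exists q; rewrite distrC ltr_distl !xq.
have xB : `|map_mx ratr (\row_j q j) - x| < m.+1%:R^-1.
  rewrite norm_row_lt ?invr_gt0 ?ltr0n //; apply/forallP => j.
  by rewrite !mxE distrC.
exists (B (\row_j q j, m)).
  by split; [exists (\row_j q j, m)|rewrite /B -ball_normE /=].
move=> z; rewrite /B -ball_normE /= => Bz; apply: eW; rewrite -ball_normE /=.
rewrite [e]splitr; apply: le_lt_trans (ler_distD (map_mx ratr (\row_j q j)) x z) _.
by rewrite ltrD // ?(lt_trans Bz) // distrC (lt_trans xB).
Qed.

Section ImageSpace.
Context {T : topologicalType} {Z : Type} (U : set T) (f : T -> Z).

(** Points are the values themselves, so [image_val] is injective; only the topology comes from the
    parametrization. *)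
Definition image_space : Type := {z : Z | exists2 y, U y & f y = z}.

HB.instance Definition _ := gen_eqMixin image_space.
HB.instance Definition _ := gen_choiceMixin image_space.

Definition image_val (p : image_space) : Z := sval p.

Lemma image_val_inj : injective image_val.
Proof. by move=> [a Ha] [b Hb] /= ab; apply: eq_exist. Qed.

Definition image_preimage (V : set image_space) : set T :=
  [set y | U y /\ exists2 p, V p & image_val p = f y].

(** Openness of the preimage is asked relative to [U], which yields a topology for an arbitrary set
    [U]. *)
Definition image_open : set_system image_space :=
  fun V => forall y, image_preimage V y -> \forall z \near y, U z -> image_preimage V z.

Lemma image_openT : image_open setT.
Proof.
move=> y _; apply: nearW => z Uz; split=> //.
by exists (exist _ (f z) (ex_intro2 _ _ z Uz erefl)).
Qed.

Lemma image_openI : setI_closed image_open.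
Proof.
move=> V W oV oW y [Uy [p [Vp Wp] py]].
have vy : image_preimage V y by split=> //; exists p.
have wy : image_preimage W y by split=> //; exists p.
apply: filterS2 (oV y vy) (oW y wy) => z Vz Wz Uz.
have [_ [q Vq qz]] := Vz Uz; have [_ [q' Wq' qz']] := Wz Uz.
by split=> //; exists q => //; split=> //; rewrite (_ : q = q') //; apply: image_val_inj; rewrite qz.
Qed.

Lemma image_open_bigU (I : Type) (V : I -> set image_space) :
  (forall i, image_open (V i)) -> image_open (\bigcup_i V i).
Proof.
move=> oV y [Uy [p [i _ Vp] py]].
have vy : image_preimage (V i) y by split=> //; exists p.
apply: filterS (oV i y vy) => z Vz /Vz[Uz [q Vq qz]].
by split=> //; exists q => //; exists i.
Qed.

HB.instance Definition _ := isOpenTopological.Build image_space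
  image_openT image_openI image_open_bigU.

End ImageSpace.

Arguments image_val {T Z U f}.

Section ImageSpaceTheory.
Context {R : realType} {n : nat} {Z : topologicalType}.
Variables (U : set 'rV[R]_n) (f : 'rV[R]_n -> Z) (x0 : 'rV[R]_n).
Hypotheses (oU : open U) (Ux0 : U x0).
Hypothesis cf : forall y, U y -> {for y, continuous f}.
Local Notation M := (image_space U f).

Let pack y (Uy : U y) : M := exist _ (f y) (ex_intro2 _ _ y Uy erefl).

(** Made total by sending the complement of [U] to the image of [x0]. *)
Definition to_image y : M :=
  if pselect (U y) is left Uy then pack Uy else pack Ux0.

Lemma to_imageE y : U y -> image_val (to_image y) = f y.
Proof. by move=> Uy; rewrite /to_image; case: pselect. Qed.

Lemma to_image_surj (p : M) : exists2 y, U y & to_image y = p.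
Proof.
case: p => z [y Uy yz]; exists y => //; apply: image_val_inj.
by rewrite to_imageE.
Qed.

Lemma to_image_eq y y' : U y -> U y' -> f y = f y' -> to_image y = to_image y'.
Proof. by move=> Uy Uy' E; apply: image_val_inj; rewrite !to_imageE. Qed.

Lemma image_space_openP (V : set M) :
  open V <-> forall y, U y -> V (to_image y) -> \forall z \near y, V (to_image z).
Proof.
have oE : open V = image_open V by [].
have pE y : U y -> image_preimage V y <-> V (to_image y).
  move=> Uy; split=> [[_ [p Vp py]]|Vy].
    by rewrite (_ : to_image y = p) //; apply: image_val_inj; rewrite to_imageE.
  by split=> //; exists (to_image y) => //; rewrite to_imageE.
rewrite oE; split=> oV y.
  move=> Uy /(pE _ Uy)/oV; apply: filterS2 (open_nbhs_nbhs (conj oU Uy)) => z Uz Vz.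
  exact/(pE z Uz)/Vz.
move=> [Uy Vy]; have /oV : V (to_image y) by apply/pE.
move=> /(_ Uy); apply: filterS => z Vz Uz; exact/pE.
Qed.

Lemma to_image_continuous y : U y -> {for y, continuous to_image}.
Proof.
move=> Uy V /=; rewrite nbhsE => -[W [oW Wy] WV].
have /image_space_openP/(_ y Uy Wy) := oW.
by apply: filterS => z /WV.
Qed.

Lemma image_val_continuous : continuous (image_val : M -> Z).
Proof.
move=> p V /=; rewrite nbhsE => -[W [oW Wp] WV].
have oP : open [set q : M | W (image_val q)].
  apply/image_space_openP => y Uy /=; rewrite to_imageE // => Wy.
  have nW : nbhs (f y) W by apply: open_nbhs_nbhs.
  apply: filterS2 (open_nbhs_nbhs (conj oU Uy)) (cf Uy nW) => z Uz /= Wz.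
  by rewrite to_imageE.
apply: filterS (open_nbhs_nbhs (conj oP Wp)) => q; exact: WV.
Qed.

Lemma image_space_hausdorff : hausdorff_space Z -> hausdorff_space M.
Proof.
rewrite !open_hausdorff => hZ p q pq.
have vpq : image_val p != image_val q by apply: contra_neq pq => /image_val_inj.
have [[A B] /= [Ap Bq] [oA oB AB]] := hZ _ _ vpq.
exists (image_val @^-1` A, image_val @^-1` B) => /=.
  by rewrite !inE /= in Ap Bq *.
split.
- by apply: open_comp => // r _; exact: image_val_continuous.
- by apply: open_comp => // r _; exact: image_val_continuous.
by rewrite -preimage_setI (eqP AB) preimage_set0.
Qed.

Lemma image_space_connected : connected U -> connected [set: M].
Proof.
move=> cU; have -> : [set: M] = to_image @` U.
  by apply/seteqP; split=> // p _; have [y Uy <-] := to_image_surj p; exists y.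
apply: connected_continuous_connected => //.
apply: continuous_in_subspaceT => y /set_mem Uy; exact: to_image_continuous.
Qed.

Hypothesis lift : forall y y' W, U y -> U y' -> f y = f y' -> open W -> W `<=` U -> W y ->
  \forall z \near y', exists2 w, W w & f w = f z.

(** By [lift], the points of [U] with the same value as some point of [W] form an open set. Openness
    of the quotient map is what carries second countability and charts to the image. *)
Lemma to_image_open W : open W -> W `<=` U -> open (to_image @` W).
Proof.
move=> oW WU; apply/image_space_openP => y' Uy' [y Wy yy'].
have Uy := WU _ Wy.
have fyy' : f y = f y' by rewrite -!to_imageE // yy'.
apply: filterS2 (open_nbhs_nbhs (conj oU Uy')) (lift Uy Uy' fyy' oW WU Wy) => z Uz [w Ww wz].
by exists w => //; apply: to_image_eq => //; exact: WU.
Qed.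

Lemma image_space_second_countable : @second_countable M.
Proof.
have [B cB [oB bB]] := @second_countable_row R n.
exists ((fun b => to_image @` (b `&` U)) @` B).
  exact: sub_countable (card_image_le _ _) _.
split=> [_ [b Bb <-]|p V].
  by apply: to_image_open => [|y []//]; apply: openI => //; exact: oB.
rewrite /= nbhsE => -[W [oW Wp] WV].
have [y Uy yp] := to_image_surj p.
have nW : nbhs y (to_image @^-1` W `&` U).
  apply: filterI; last exact: open_nbhs_nbhs.
  by have /image_space_openP := oW; apply => //; rewrite yp.
have [b [Bb bY] bW] := bB y _ nW.
exists (to_image @` (b `&` U)).
  by split; [exists b|exists y].
by move=> _ [z [bz Uz] <-]; apply: WV; have [] := bW z bz.
Qed.

Lemma image_space_manifold : hausdorff_space Z -> connected U -> manifold_space M.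
Proof.
move=> hZ cU; split; first exact: image_space_hausdorff.
  exact: image_space_second_countable.
exact: image_space_connected.
Qed.

End ImageSpaceTheory.

(** * Centroaffine cones *)

Lemma continuous_row {R : realType} (T : topologicalType) m (F : T -> 'rV[R]_m) x :
  (forall j, {for x, continuous (fun y => F y 0 j)}) -> {for x, continuous F}.
Proof.
move=> cF; apply/cvgrPdist_lt => e e0.
have cj j : \forall y \near x, `|F x 0 j - F y 0 j| < e.
  by have /cvgrPdist_lt := cF j; apply.
have : \forall y \near x, forall j, `|F x 0 j - F y 0 j| < e by exact: filter_forall.
apply: filterS => y Fy; rewrite norm_row_lt //; apply/forallP => j.
by rewrite addmxE oppmxE.
Qed.

Lemma smooth_row {R : realType} n m (U : set 'rV[R]_n) (M : 'rV[R]_n -> 'rV[R]_m) :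
  open U -> msmooth U M -> smooth_on U M.
Proof.
move=> oU sM k; elim: k M sM => [|k IH] M sM.
  by split=> // x Ux; apply: continuous_row => j; exact: (Ck_cont (sM 0 j 0%N) Ux).
split=> [x Ux|i]; first by apply: continuous_row => j; exact: (Ck_cont (sM 0 j 0%N) Ux).
split=> [x Ux|].
  by apply/derivable_mxP => a b; apply: diff_derivable; exact: (smooth_differentiable oU).
apply: (Ck_ext oU (F := pd i M)); first by move=> x Ux; rewrite (partial_pd oU).
by apply: IH; exact: msmooth_pd.
Qed.

(* The centroaffine hypersurface e^(mu g(s)) (p0 + s E), where g has Hessian hg
   and gradient dg. *)
Section ConeChart.
Context {R : realType} {k : nat}.
Variables (V : set 'rV[R]_k) (g : 'rV[R]_k -> R) (mu : R).
Variables (E : 'M[R]_(k, k + 1)) (p0 : 'rV[R]_(k + 1)).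
Variables (dg : 'rV[R]_k -> 'rV[R]_k) (hg : 'rV[R]_k -> 'M[R]_k).
Hypotheses (oV : open V) (sg : smooth_on V g) (shg : msmooth V hg) (sdg : msmooth V dg).
Hypothesis uN : col_mx E p0 \in unitmx.
Hypothesis partial_g : forall l s, V s -> partial l g s = dg s 0 l.
Hypothesis pd_dg : forall l s, V s -> pd l dg s = delta_mx 0 l *m hg s.
Hypothesis hg_sym : forall s, V s -> (hg s)^T = hg s.
Implicit Types (s : 'rV[R]_k).

Definition cone_point s : 'rV[R]_(k + 1) := expR (mu * g s) *: (p0 + s *m E).
(** The centroaffine metric of [cone_point]; the rank one term appears when the rows of [E] are
    expressed by the derivatives of the immersion. *)
Definition cone_metric s : 'M[R]_k := mu *: hg s - mu ^+ 2 *: ((dg s)^T *m dg s).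
Local Notation X := cone_point.
Local Notation h := cone_metric.
Hypothesis h_posdef : forall s, V s -> posdef (h s).

Let smug : smooth_on V (fun s => mu * g s).
Proof. by move=> m; apply: CkM => //; exact: Ck_cst. Qed.

Let sexp : smooth_on V (fun s => expR (mu * g s)).
Proof. by move=> m; apply: Ck_expR. Qed.

Let partial_exp l s : V s -> partial l (fun s => expR (mu * g s)) s =
  expR (mu * g s) * (mu * dg s 0 l).
Proof.
move=> Vs; rewrite partial_expR; last exact: (smooth_differentiable oV smug).
rewrite (smooth_partialM l oV (smooth_cst mu oV) sg) // partial_cst mul0r add0r.
by rewrite partial_g.
Qed.

Let sray : msmooth V (fun s => p0 + s *m E).
Proof.
apply: msmoothD => //; first exact: msmooth_cst.
by apply: msmoothM => //; [exact: msmooth_id|exact: msmooth_cst].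
Qed.

Let pd_ray l s : V s -> pd l (fun s => p0 + s *m E) s = row l E.
Proof.
move=> Vs; rewrite (pdD l oV) //; [|exact: msmooth_cst|]; last first.
  by apply: msmoothM => //; [exact: msmooth_id|exact: msmooth_cst].
rewrite pd_cst add0r (pdMr _ l oV) //; last exact: msmooth_id.
by rewrite pd_id -rowE.
Qed.

Lemma msmooth_cone_point : msmooth V X.
Proof. exact: msmooth_scale. Qed.

Lemma partial_cone_point l s : V s ->
  partial l X s = (mu * dg s 0 l) *: X s + expR (mu * g s) *: row l E.
Proof.
move=> Vs; rewrite (partial_pd oV) //; last exact: msmooth_cone_point.
rewrite /cone_point (pd_scale l oV) // partial_exp // pd_ray //.
by rewrite scalerA [expR _ * (mu * _)]mulrC.
Qed.

Lemma smooth_cone_point : smooth_on V X.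
Proof. exact: (smooth_row oV msmooth_cone_point). Qed.

Lemma partial2_cone_point i j s : V s -> partial i (partial j X) s =
  h s i j *: X s + (mu * dg s 0 j) *: partial i X s + (mu * dg s 0 i) *: partial j X s.
Proof.
move=> Vs; rewrite (partial_ext i oV (partial_cone_point j)) //.
have sd : smooth_on V (fun s => mu * dg s 0 j).
  by move=> m; apply: CkM => //; [exact: Ck_cst|exact: sdg].
have s1 : msmooth V (fun s => (mu * dg s 0 j) *: X s).
  by apply: msmooth_scale => //; exact: msmooth_cone_point.
have s2 : msmooth V (fun s => expR (mu * g s) *: row j E).
  by apply: msmooth_scale => //; exact: msmooth_cst.
rewrite (partial_pd oV) //; last exact: msmoothD.
rewrite (pdD i oV s1 s2) // (pd_scale i oV sd msmooth_cone_point) //.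
rewrite (pd_scale i oV sexp (msmooth_cst _ oV)) // pd_cst scaler0 addr0.
rewrite -(partial_pd oV _ msmooth_cone_point) // partial_exp //.
have -> : partial i (fun s => mu * dg s 0 j) s = mu * hg s i j.
  rewrite (smooth_partialM i oV (smooth_cst mu oV) (sdg 0 j)) // partial_cst mul0r add0r.
  by rewrite -(pdE i dg) pd_dg // -rowE rowmxE.
rewrite !partial_cone_point //; apply/rowP => m.
have -> : h s i j = mu * hg s i j - mu ^+ 2 * (dg s 0 i * dg s 0 j).
  rewrite addmxE oppmxE !scalemxE; congr (_ - _ * _).
  by rewrite mxE big_ord1 trmxE.
rewrite !(addmxE, scalemxE); ring.
Qed.

(** Unipotent factors relate the frame to the constant basis [col_mx E p0], which gives its
    invertibility. *)
Lemma cone_frameE s : V s -> frame X X s = expR (mu * g s) *: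
  (block_mx 1%:M (mu *: (dg s)^T) 0 1%:M *m block_mx 1%:M 0 s 1%:M *m col_mx E p0).
Proof.
move=> Vs; rewrite -mulmxA mul_block_col mul1mx mul0mx addr0 mul1mx.
rewrite mul_block_col !mul1mx mul0mx add0r scale_col_mx /frame; congr col_mx.
  apply/row_matrixP => i; rewrite rowK partial_cone_point // /cone_point.
  apply/rowP => j; rewrite !(mxE, rowmxE) big_ord1 !mxE; ring.
by rewrite /cone_point addrC.
Qed.

Lemma cone_frame_unit s : V s -> frame X X s \in unitmx.
Proof.
move=> Vs; rewrite cone_frameE // unitmxZ ?unitfE ?gt_eqF ?expR_gt0 // !unitmx_mul uN andbT.
by rewrite !unitmxE det_ublock det_lblock !det1 mulr1 unitr1.
Qed.

Lemma cone_gauss i j s : V s -> gauss X X i j s =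
  row_mx (mu *: (dg s 0 j *: delta_mx 0 i + dg s 0 i *: delta_mx 0 j)) (h s i j)%:M.
Proof.
move=> Vs; rewrite /gauss partial2_cone_point //.
apply: (canLR (mulmxK (cone_frame_unit Vs))).
rewrite /frame mul_row_col mul_scalar_mx scalerDr mulmxDl !scalerA -!scalemxAl -!rowE !rowK.
by rewrite [RHS]addrC addrA.
Qed.

Lemma cone_conn l i j s : V s -> induced_conn X X l i j s =
  mu * (dg s 0 j * (l == i)%:R + dg s 0 i * (l == j)%:R).
Proof.
move=> Vs; rewrite /induced_conn cone_gauss // row_mxKl scalemxE addmxE !scalemxE.
by rewrite !mxE !eqxx.
Qed.

Lemma cone_metricE s : V s -> metric X X s = h s.
Proof.
by move=> Vs; apply/matrixP => i j; rewrite [LHS]mxE cone_gauss // row_mxKr mxE eqxx mulr1n.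
Qed.

Lemma cone_metric_sym s : V s -> (h s)^T = h s.
Proof.
move=> Vs; rewrite linearB /= linearZ /= hg_sym // [X in _ - X]linearZ /= trmx_mul trmxK.
by [].
Qed.

(** * Cubic form of the cone, from the tangential part [A] and the radial part [b] of the products
    of chart directions *)

Section CubicForm.
Variables (A : 'I_k -> 'rV[R]_k -> 'M[R]_k) (b : 'I_k -> 'rV[R]_k -> 'cV[R]_k).
Hypothesis sA : forall i, msmooth V (A i).
Hypothesis A_comm : forall i j s, V s -> delta_mx 0 j *m A i s = delta_mx 0 i *m A j s :> 'rV[R]_k.
Hypothesis bE : forall i s, V s -> b i s = mu *: (hg s *m (delta_mx 0 i)^T + A i s *m (dg s)^T).
Hypothesis pd_hg : forall l s, V s -> pd l hg s = - 2 *: (A l s *m hg s - b l s *m dg s).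
Hypothesis pd_A : forall i l s, V s -> pd l (A i) s = A i s *m A l s - A l s *m A i s
  - \sum_m A l s i m *: A m s - b l s *m delta_mx 0 i - (b l s i 0)%:M.

Let A_sw i j m s : V s -> A i s j m = A j s i m.
Proof. by move=> Vs; rewrite -[LHS]rowmxE -[RHS]rowmxE !rowE A_comm. Qed.

Let hgC i j s : V s -> hg s i j = hg s j i.
Proof. by move=> Vs; rewrite -{1}(hg_sym Vs) trmxE. Qed.

Let bij i j s : V s -> b i s j 0 = mu * (hg s i j + (A i s *m (dg s)^T) j 0).
Proof.
move=> Vs; rewrite bE // scalemxE addmxE trmx_delta -colE [col _ _ _ _]mxE.
by rewrite hgC.
Qed.

Let Adg_sw i j s : V s -> (A i s *m (dg s)^T) j 0 = (A j s *m (dg s)^T) i 0.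
Proof. by move=> Vs; rewrite !mxE; apply: eq_bigr => m _; rewrite A_sw. Qed.

Let Ahg_sw i j m s : V s -> (A i s *m hg s) j m = (A j s *m hg s) i m.
Proof. by move=> Vs; rewrite !mxE; apply: eq_bigr => l _; rewrite A_sw. Qed.

Let b_sw i j s : V s -> b i s j 0 = b j s i 0.
Proof. by move=> Vs; rewrite !bij // hgC // Adg_sw. Qed.

Let third_sw i j m s : V s -> (A i s *m hg s) j m - b i s j 0 * dg s 0 m =
  (A i s *m hg s) m j - b i s m 0 * dg s 0 j.
Proof.
move=> Vs; have := pd_hg i Vs.
have : (pd i hg s)^T = pd i hg s.
  by rewrite -pd_tr; apply: (pd_ext i oV) => // y /hg_sym.
move=> /[swap] -> /matrixP/(_ j m); rewrite trmxE !scalemxE !addmxE !oppmxE.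
have E2 a c : (b i s *m dg s) a c = b i s a 0 * dg s 0 c by rewrite mxE big_ord1.
rewrite !E2; lra.
Qed.

Let pd_h l i j s : V s -> pd l h s i j = - 2 * mu * ((A l s *m hg s) i j - b l s i 0 * dg s 0 j)
  - mu ^+ 2 * (hg s l i * dg s 0 j + dg s 0 i * hg s l j).
Proof.
move=> Vs; have sd2 : msmooth V (fun s => (dg s)^T *m dg s).
  by apply: msmoothM => //; exact: msmooth_tr.
have s1 : msmooth V (fun s => mu *: hg s) by apply: msmooth_scale => //; exact: smooth_cst.
have s2 : msmooth V (fun s => mu ^+ 2 *: ((dg s)^T *m dg s)).
  by apply: msmooth_scale => //; exact: smooth_cst.
rewrite (pdB l oV s1 s2) // (pdZ _ l oV) // (pdZ _ l oV) // pd_hg //.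
rewrite (pdM l oV (msmooth_tr oV sdg) sdg) // pd_tr pd_dg //.
rewrite addmxE oppmxE !scalemxE !addmxE oppmxE.
have -> : (b l s *m dg s) i j = b l s i 0 * dg s 0 j by rewrite mxE big_ord1.
have -> : ((delta_mx 0 l *m hg s)^T *m dg s) i j = hg s l i * dg s 0 j.
  by rewrite mxE big_ord1 trmxE -rowE rowmxE.
have -> : ((dg s)^T *m (delta_mx 0 l *m hg s)) i j = dg s 0 i * hg s l j.
  by rewrite mxE big_ord1 trmxE -rowE rowmxE.
ring.
Qed.

(** As for a graph: the symmetries of [A hg - b dg], half the derivative of [hg] up to sign,
    collapse the Christoffel expression to [-2 A h]. *)
Lemma cone_levi_civita m i j s : V s -> levi_civita (metric X X) m i j s = - A i s j m.
Proof.
move=> Vs; rewrite /levi_civita cone_metricE //.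
have uh : h s \in unitmx by exact/posdef_unit/h_posdef.
have E3 a c d : partial a (fun y => metric X X y c d) s = pd a h s c d.
  by rewrite pdE; apply: (partial_ext a oV) => // y Vy; rewrite cone_metricE.
have Ahe l : (A i s *m h s) j l = mu * (A i s *m hg s) j l
     - mu ^+ 2 * ((A i s *m (dg s)^T) j 0 * dg s 0 l).
  rewrite mulmxBr -!scalemxAr mulmxA addmxE oppmxE !scalemxE; congr (_ - _ * _).
  by rewrite mxE big_ord1.
rewrite (eq_bigr (fun l => - 2 * ((A i s *m h s) j l * invmx (h s) l m))); last first.
  move=> l _; rewrite (E3 i j l) (E3 j i l) (E3 l i j) !pd_h //.
  have -> : invmx (h s) m l = invmx (h s) l m.
    by rewrite -[in LHS](cone_metric_sym Vs) -trmx_inv trmxE.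
  rewrite mulrC mulrA; congr (_ * _); rewrite Ahe.
  rewrite (Ahg_sw l i j Vs) (b_sw l i Vs) (third_sw i l j Vs) (Ahg_sw j i l Vs) (b_sw j i Vs).
  rewrite (hgC l i Vs) (hgC l j Vs) (hgC j i Vs) (bij i j Vs); ring.
rewrite -mulr_sumr mulrA mulrN mulVf ?pnatr_eq0 // mulN1r; congr (- _).
have := mulmxK uh (A i s) => /matrixP/(_ j m) <-.
by rewrite [in RHS]mxE.
Qed.

Lemma cone_cubic m i j s : V s -> cubic X X m i j s =
  A i s j m + mu * (dg s 0 j * (m == i)%:R + dg s 0 i * (m == j)%:R).
Proof. by move=> Vs; rewrite /cubic cone_conn // cone_levi_civita // opprK addrC. Qed.

(** The terms in [A] alone cancel as for a graph. The Kronecker terms of the cubic form contribute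
    [mu (hg + A dg)], which is the entry of [b] and cancels the last two terms of [pd_A]. *)
Lemma cone_parallel : parallel_cubic V X X.
Proof.
move=> s Vs l m i j; rewrite /cov_cubic.
pose C m' i' j' y := A i' y j' m' + (mu * (m' == i')%:R * dg y 0 j' + mu * (m' == j')%:R * dg y 0 i').
have CE m' i' j' y : V y -> cubic X X m' i' j' y = C m' i' j' y.
  by move=> Vy; rewrite cone_cubic // /C; ring.
rewrite (partial_ext l oV (CE m i j)) //.
have sd c q : smooth_on V (fun s => mu * c * dg s 0 q).
  by move=> a; apply: CkM => //; [exact: Ck_cst|exact: sdg].
have pdd c q : partial l (fun s => mu * c * dg s 0 q) s = mu * c * hg s l q.
  rewrite (smooth_partialM l oV (smooth_cst (mu * c) oV) (sdg 0 q)) // partial_cst mul0r add0r.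
  by rewrite -(pdE l dg) pd_dg // -rowE rowmxE.
have -> : partial l (C m i j) s = pd l (A i) s j m
    + (mu * (m == i)%:R * hg s l j + mu * (m == j)%:R * hg s l i).
  have s2 : smooth_on V (fun s => mu * (m == i)%:R * dg s 0 j + mu * (m == j)%:R * dg s 0 i).
    by move=> a; apply: CkD => //; exact: sd.
  rewrite (smooth_partialD l oV (sA i j m) s2) // (smooth_partialD l oV (sd _ _) (sd _ _)) //.
  by rewrite !pdd pdE.
have delta (F : 'I_k -> R) a : \sum_q F q * (q == a)%:R = F a.
  rewrite (bigD1 a) //= eqxx mulr1 big1 ?addr0 // => q /negbTE ->.
  by rewrite mulr0.
have delta' (F : 'I_k -> R) a : \sum_q F q * (a == q)%:R = F a.
  by rewrite -[RHS](delta F a); apply: eq_bigr => q _; rewrite eq_sym.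
have -> : \sum_q (levi_civita (metric X X) m l q s * cubic X X q i j s
     - levi_civita (metric X X) q l i s * cubic X X m q j s
     - levi_civita (metric X X) q l j s * cubic X X m i q s) =
   - (A i s *m A l s) j m + (A l s *m A i s) j m + \sum_q A l s i q * A q s j m
   + (mu * (m == j)%:R * (A l s *m (dg s)^T) i 0 + mu * (m == i)%:R * (A l s *m (dg s)^T) j 0).
  rewrite (eq_bigr (fun q => - (A i s j q * A l s q m) + A l s j q * A i s q m
    + A l s i q * A q s j m + mu * (m == j)%:R * (A l s i q * (dg s)^T q 0)
    + mu * (m == i)%:R * (A l s j q * (dg s)^T q 0)
    + (- mu * dg s 0 j) * (A l s q m * (q == i)%:R) + (- mu * dg s 0 i) * (A l s q m * (q == j)%:R)
    + (mu * dg s 0 j) * (A l s i q * (m == q)%:R) + (mu * dg s 0 i) * (A l s j q * (m == q)%:R))).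
    rewrite !big_split /= -!mulr_sumr !delta !delta' sumrN.
    rewrite !mxE; ring.
  move=> q _; rewrite !cone_levi_civita // !CE // /C trmxE; ring.
rewrite pd_A // !(addmxE, oppmxE) summxE.
rewrite (eq_bigr (fun q => A l s i q * A q s j m)); last by move=> q _; rewrite scalemxE.
have -> : (b l s *m delta_mx 0 i) j m = mu * (m == i)%:R * (hg s l j + (A l s *m (dg s)^T) j 0).
  by rewrite mxE big_ord1 mxE eqxx /= bij //; ring.
have -> : (b l s i 0)%:M j m = mu * (m == j)%:R * (hg s l i + (A l s *m (dg s)^T) i 0).
  rewrite mxE bij // eq_sym; case: (m == j) => /=; rewrite ?mulr1n ?mulr0n; ring.
ring.
Qed.

End CubicForm.

End ConeChart.

(** * Projection of the domain onto the cone *)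

Section ConeProjection.
Context {R : realType} {n k : nat}.
Variables (U : set 'rV[R]_n) (F : 'rV[R]_n -> R) (mu : R).
Variables (eta : 'rV[R]_n -> 'rV[R]_n) (B : 'M[R]_(k + 1, n)) (S : 'M[R]_(n, k + 1)).
Variable (c0 : 'rV[R]_(k + 1)).
Implicit Types (y z v : 'rV[R]_n).
(** To be used with [S B = P]: the coordinates of the unit field in the basis [B] of the image of
    [P]. *)
Definition cone_coord y : 'rV[R]_(k + 1) := c0 + y *m S.
Local Notation p := cone_coord.
Hypotheses (oU : open U) (sF : smooth_on U F) (mu0 : 0 < mu).
Hypothesis partialF : forall l y, U y -> partial l F y = eta y 0 l.
Hypothesis BS : B *m S = 1%:M.
Hypothesis etaP : forall y, U y -> eta y *m (S *m B)^T = eta y.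
Hypothesis eta_homogeneous : forall y y' r, U y -> U y' -> r != 0 ->
  p y' = r *: p y -> eta y' = r^-1 *: eta y.
Hypothesis eta_euler : forall y, U y -> ((p y *m B) *m (eta y)^T) 0 0 = - mu^-1.

Definition cone_proj y : 'rV[R]_(k + 1) := expR (mu * F y) *: p y.
Local Notation proj := cone_proj.

Lemma cone_coord_neq0 y : U y -> p y != 0.
Proof.
move=> Uy; apply/eqP => E; have := eta_euler Uy; rewrite E !mul0mx mxE.
by move/eqP; rewrite eq_sym oppr_eq0 invr_eq0 gt_eqF.
Qed.

Lemma derive_potential v y : U y -> 'D_v F y = (v *m (eta y)^T) 0 0.
Proof.
move=> Uy; rewrite derive_partial; last exact: smooth_differentiable oU sF Uy.
by rewrite mxE; apply: eq_bigr => i _; rewrite partialF // trmxE.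
Qed.

Lemma derive_potential_proj v y : U y ->
  (v *m (S *m B) *m (eta y)^T) 0 0 = (v *m (eta y)^T) 0 0.
Proof.
move=> Uy; have E : S *m B *m (eta y)^T = (eta y)^T.
  by apply: trmx_inj; rewrite trmx_mul trmxK etaP.
by rewrite -mulmxA E.
Qed.

Let scoord : msmooth U p.
Proof.
apply: msmoothD => //; first exact: msmooth_cst.
by apply: msmoothM => //; [exact: msmooth_id|exact: msmooth_cst].
Qed.

Let smu : smooth_on U (fun y => mu * F y).
Proof. by move=> m; apply: CkM => //; exact: Ck_cst. Qed.

Let sexp : smooth_on U (fun y => expR (mu * F y)).
Proof. by move=> m; apply: Ck_expR. Qed.

Lemma msmooth_cone_proj : msmooth U proj.
Proof. exact: msmooth_scale. Qed.

Lemma cone_proj_continuous y : U y -> {for y, continuous proj}.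
Proof.
by move=> Uy; have /(_ 0%N) := smooth_row oU msmooth_cone_proj; move/Ck_cont; apply.
Qed.

Lemma derive_cone_proj v y j : U y -> 'D_v (fun z => proj z 0 j) y =
  expR (mu * F y) * (mu * (v *m (eta y)^T) 0 0 * p y 0 j + (v *m S) 0 j).
Proof.
move=> Uy; rewrite derive_partial; last first.
  exact: (smooth_differentiable oU (msmooth_cone_proj 0 j)).
have E i : partial i (fun z => proj z 0 j) y =
    expR (mu * F y) * (mu * eta y 0 i * p y 0 j + S i j).
  rewrite -(pdE i proj) (pd_scale i oU sexp scoord Uy).
  rewrite partial_expR; last exact: (smooth_differentiable oU smu).
  rewrite (smooth_partialM i oU (smooth_cst mu oU) sF) // partial_cst mul0r add0r.
  rewrite (pdD i oU (msmooth_cst c0 oU)) //; last first.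
    by apply: msmoothM => //; [exact: msmooth_id|exact: msmooth_cst].
  rewrite (pdMr _ i oU) //; last exact: msmooth_id.
  by rewrite pd_cst add0r pd_id -rowE partialF // addmxE !scalemxE rowmxE; ring.
rewrite (eq_bigr (fun i => expR (mu * F y) * (mu * (v 0 i * (eta y)^T i 0) * p y 0 j
   + v 0 i * S i j))); last by move=> i _; rewrite E trmxE; ring.
by rewrite -mulr_sumr big_split /= -mulr_suml -mulr_sumr !mxE.
Qed.

(* The affine map z |-> y + a^-1 (z - y') S B, which rescales the directions of
   the cone by the ratio a of the coordinates of y' and y, preserves cone_proj. *)
Lemma cone_proj_lift y y' W : U y -> U y' -> proj y = proj y' -> open W -> W `<=` U -> W y ->
  \forall z \near y', exists2 w, W w & proj w = proj z.
Proof.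
move=> Uy Uy' E oW WU Wy.
pose a := expR (mu * (F y - F y')).
have a0 : a != 0 by rewrite gt_eqF ?expR_gt0.
have pE : p y' = a *: p y.
  rewrite /a mulrBr expRD expRN mulrC -scalerA [_ *: p y]E /cone_proj scalerA.
  by rewrite mulVf ?scale1r // gt_eqF ?expR_gt0.
pose T0 := y - a^-1 *: (y' *m (S *m B)); pose TM := a^-1 *: (S *m B).
pose T z := T0 + z *m TM.
have Ty' : T y' = y by rewrite /T /T0 /TM -scalemxAr addrNK.
have pT z : p (T z) = a^-1 *: p z.
  rewrite /cone_coord /T /T0 /TM !mulmxDl mulNmx -!scalemxAl -!scalemxAr -!scalemxAl.
  rewrite -!mulmxA BS mulmx1 addrA addrA -/(p y).
  have -> : p y = a^-1 *: p y' by rewrite pE scalerA mulVf // scale1r.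
  by rewrite /cone_coord !scalerDr addrK.
have cT : continuous T.
  move=> z; exact: (differentiable_continuous (differentiable_affine T0 TM z)).
have : \forall z \near y', W (T z) /\ U z.
  apply: filterI; last exact: open_nbhs_nbhs.
  by apply: cT; rewrite Ty'; exact: open_nbhs_nbhs.
move=> /nbhs_ballP[r /= r0 rW].
have FT z : ball y' r z -> F (T z) - F z = F y - F y'.
  move=> zr; rewrite -[in RHS]Ty'.
  apply: (partial0_ball (F := fun z => F (T z) - F z)) zr => [z' /rW [/WU UT Uz']|i z' /rW [/WU UT Uz']].
    apply: differentiableB; last exact: (smooth_differentiable oU).
    by apply: differentiable_affine_comp; exact: (smooth_differentiable oU).
  have dT : differentiable (fun z => F (T z)) z'.
    by apply: differentiable_affine_comp; exact: (smooth_differentiable oU).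
  have dF := smooth_differentiable oU sF Uz'.
  rewrite /partial deriveB; [|exact: diff_derivable..].
  rewrite derive_affine_comp -/(T z') !derive_potential //.
  rewrite (eta_homogeneous (y := z') (r := a^-1)) ?invr_eq0 // invrK.
  rewrite /TM -scalemxAr [(a *: _)^T]linearZ /= -scalemxAl -scalemxAr scalerA mulVf // scale1r.
  by rewrite derive_potential_proj // subrr.
apply/nbhs_ballP; exists r => // z zr; exists (T z); first by have [] := rW z zr.
rewrite /cone_proj pT scalerA; congr (_ *: _).
have -> : F (T z) = F z + (F y - F y') by rewrite -(FT z zr) addrC subrK.
by rewrite mulrDr expRD -/a mulfK.
Qed.

(** On the segment from [y] to [y'] the coordinates move along a ray. By [eta_euler] the exponential
    factor decreases at exactly the rate at which they grow, and [eta] does not see the component of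
    [y' - y] in the kernel of [S]. The ball keeps the segment in [U]. *)
Lemma cone_proj_ray c r y y' a : ball c r `<=` U -> ball c r y -> ball c r y' ->
  0 < a -> p y' = a *: p y -> proj y' = proj y.
Proof.
move=> cU yB yB' a0 pE; apply/rowP => j; apply/eqP; rewrite -subr_eq0; apply/eqP.
pose v := y' - y.
have inU s : 0 <= s <= 1 -> U (y + (s * 1) *: v).
  move=> /andP[s0 s1]; apply: cU; rewrite mulr1 -ball_normE /=.
  have -> : c - (y + s *: v) = (1 - s) *: (c - y) + s *: (c - y').
    by rewrite /v !scalerBr !scalerBl !scale1r; mxlin.
  rewrite -ball_normE /= in yB yB'.
  apply: le_lt_trans (ler_normD _ _) _; rewrite !normrZ.
  rewrite (ger0_norm s0) ger0_norm ?subr_ge0 //.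
  have -> : r = (1 - s) * r + s * r by ring.
  have [->|sn0] := eqVneq s 0; first by rewrite subr0 !mul1r !mul0r !addr0.
  apply: ler_ltD; first by rewrite ler_wpM2l ?subr_ge0 // ltW.
  by rewrite ltr_pM2l // lt0r sn0.
have := @line_MVT R _ (fun z => proj z 0 j) y v 1.
have -> : y + 1 *: v = y' by rewrite scale1r /v addrC subrK.
case=> [s s01|s s01 ->].
  apply: diff_derivable; exact: (smooth_differentiable oU (msmooth_cone_proj 0 j) (inU s s01)).
have Us := inU s s01; rewrite mul1r derive_cone_proj //.
set z := y + (s * 1) *: v in Us *.
have vS : v *m S = (a - 1) *: p y.
  rewrite scalerBl scale1r -pE /cone_coord /v mulmxBl; mxlin.
have pz : p z = (1 + s * (a - 1)) *: p y.
  rewrite /z mulr1 /cone_coord mulmxDl addrA -/(p y) -scalemxAl vS scalerA.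
  by rewrite scalerDl scale1r.
have r0 : 0 < 1 + s * (a - 1).
  have /andP[s0 s1] := s01.
  have [->|sn0] := eqVneq s 0; first by rewrite mul0r addr0.
  have -> : 1 + s * (a - 1) = (1 - s) + s * a by ring.
  by rewrite ltr_wpDl ?subr_ge0 // mulr_gt0 // lt0r sn0.
have e := eta_euler Us.
rewrite -derive_potential_proj // mulmxA vS -scalemxAl -scalemxAl scalemxE.
rewrite pz -!scalemxAl scalemxE in e.
have muN : mu != 0 by rewrite gt_eqF.
have rN : 1 + s * (a - 1) != 0 by rewrite gt_eqF.
have -> : (p y *m B *m (eta z)^T) 0 0 = - (mu^-1 / (1 + s * (a - 1))).
  by rewrite -mulNr -e mulrC mulKf.
rewrite pz !scalemxE; field.
by apply/andP.
Qed.

End ConeProjection.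

(** * Dependence of the geometry only on the immersion over an open set *)

Lemma levi_civita_ext {R : realType} k (V : set 'rV[R]_k) (g g' : 'rV[R]_k -> 'M[R]_k) :
  open V -> (forall s, V s -> g s = g' s) ->
  forall m i j s, V s -> levi_civita g m i j s = levi_civita g' m i j s.
Proof.
move=> oV gg' m i j s Vs; rewrite /levi_civita (gg' s Vs); congr (_ * _).
apply: eq_bigr => l _.
have E a c d : partial a (fun y => g y c d) s = partial a (fun y => g' y c d) s.
  by apply: (partial_ext a oV) => // y Vy; rewrite gg'.
by rewrite (E i j l) (E j i l) (E l i j).
Qed.

Section CovariantExt.
Context {R : realType} {k : nat} (V : set 'rV[R]_k).
Variables A A' LC LC' : 'I_k -> 'I_k -> 'I_k -> 'rV[R]_k -> R.
Hypotheses (oV : open V) (AE : forall m i j s, V s -> A m i j s = A' m i j s).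
Hypothesis LCE : forall m i j s, V s -> LC m i j s = LC' m i j s.

Lemma covariant_ext l m i j s : V s ->
  partial l (A m i j) s + \sum_q (LC m l q s * A q i j s - LC q l i s * A m q j s
    - LC q l j s * A m i q s) =
  partial l (A' m i j) s + \sum_q (LC' m l q s * A' q i j s - LC' q l i s * A' m q j s
    - LC' q l j s * A' m i q s).
Proof.
move=> Vs; rewrite (partial_ext l oV (fun y => @AE m i j y) Vs).
by congr (_ + _); apply: eq_bigr => q _; rewrite !LCE // !AE.
Qed.

End CovariantExt.

Section GeometryExt.
Context {R : realType} {k : nat}.
Variables (V : set 'rV[R]_k) (X X' xi xi' : 'rV[R]_k -> 'rV[R]_(k + 1)).
Hypotheses (oV : open V) (XE : forall s, V s -> X s = X' s) (xiE : forall s, V s -> xi s = xi' s).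
Implicit Types (s : 'rV[R]_k).

Lemma frame_ext s : V s -> frame X xi s = frame X' xi' s.
Proof.
move=> Vs; pose fr (d : 'I_k -> 'rV[R]_(k + 1)) x : 'M[R]_(k + 1) := col_mx (\matrix_i d i) x.
have E : (fun i => partial i X s) = (fun i => partial i X' s).
  by apply: funext => i; exact: (partial_ext i oV XE).
rewrite -[frame X xi s]/(fr (fun i => partial i X s) (xi s)).
by rewrite -[frame X' xi' s]/(fr (fun i => partial i X' s) (xi' s)) E (xiE Vs).
Qed.

Lemma gauss_ext i j s : V s -> gauss X xi i j s = gauss X' xi' i j s.
Proof.
move=> Vs; rewrite /gauss (frame_ext Vs).
by rewrite (partial_ext i oV (fun y Vy => partial_ext j oV XE Vy) Vs).
Qed.

Lemma metric_ext s : V s -> metric X xi s = metric X' xi' s.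
Proof. by move=> Vs; apply/matrixP => i j; rewrite [LHS]mxE [RHS]mxE gauss_ext. Qed.

Lemma cubic_ext m i j s : V s -> cubic X xi m i j s = cubic X' xi' m i j s.
Proof.
move=> Vs; rewrite /cubic /induced_conn (gauss_ext i j Vs).
by rewrite (levi_civita_ext oV metric_ext m i j Vs).
Qed.

Lemma cov_cubic_ext l m i j s : V s ->
  cov_cubic X xi l m i j s = cov_cubic X' xi' l m i j s.
Proof.
move=> Vs; exact: (covariant_ext oV cubic_ext (levi_civita_ext oV metric_ext) l m i j Vs).
Qed.

End GeometryExt.

(** The blocks are dual coordinates: [al] reads off the component along [p0] and [be] those along
    the rows of [E]. *)
Lemma col_mx_inverse {R : comUnitRingType} k (E : 'M[R]_(k, k + 1)) p0 :
  col_mx E p0 \in unitmx ->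
  let be := lsubmx (invmx (col_mx E p0)) in let al := rsubmx (invmx (col_mx E p0)) in
  [/\ E *m be = 1%:M, E *m al = 0, p0 *m be = 0, p0 *m al = 1%:M & be *m E + al *m p0 = 1%:M].
Proof.
move=> uN be al; have := mulmxV uN; rewrite -[invmx _]hsubmxK mul_col_row.
rewrite (scalar_mx_block k 1 1) => /eq_block_mx[? ? ? ?]; split=> //.
by rewrite -mul_row_col hsubmxK mulVmx // scalar_mx_block.
Qed.

(** * Charts of the image by affine slices *)

Section ConeImage.
Context {R : realType} {n k : nat}.
Variables (U : set 'rV[R]_n) (F : 'rV[R]_n -> R) (mu : R).
Variables (eta : 'rV[R]_n -> 'rV[R]_n) (B : 'M[R]_(k + 1, n)) (S : 'M[R]_(n, k + 1)).
Variable (c0 : 'rV[R]_(k + 1)).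
Implicit Types (y z v : 'rV[R]_n).
Local Notation p := (cone_coord S c0).
Hypotheses (dU : is_domain U) (sF : smooth_on U F) (mu0 : 0 < mu).
Hypothesis partialF : forall l y, U y -> partial l F y = eta y 0 l.
Hypothesis BS : B *m S = 1%:M.
Hypothesis etaP : forall y, U y -> eta y *m (S *m B)^T = eta y.
Hypothesis eta_homogeneous : forall y y' r, U y -> U y' -> r != 0 ->
  p y' = r *: p y -> eta y' = r^-1 *: eta y.
Hypothesis eta_euler : forall y, U y -> ((p y *m B) *m (eta y)^T) 0 0 = - mu^-1.
Local Notation proj := (cone_proj F mu S c0).
Let oU : open U. Proof. by case: dU. Qed.
Variable (x0 : 'rV[R]_n).
Hypothesis Ux0 : U x0.

Local Notation M1 := (image_space U proj).
Local Notation toM := (to_image proj Ux0).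

Let cproj y : U y -> {for y, continuous proj}.
Proof. exact: cone_proj_continuous. Qed.

Let lift y y' W : U y -> U y' -> proj y = proj y' -> open W -> W `<=` U -> W y ->
  \forall z \near y', exists2 w, W w & proj w = proj z.
Proof. exact: (cone_proj_lift oU sF partialF BS etaP eta_homogeneous). Qed.

Let ray c r y y' a : ball c r `<=` U -> ball c r y -> ball c r y' ->
  0 < a -> p y' = a *: p y -> proj y' = proj y.
Proof. exact: (cone_proj_ray oU sF mu0 partialF etaP eta_euler). Qed.

Lemma cone_image_manifold : manifold_space M1.
Proof.
apply: (image_space_manifold oU Ux0 cproj lift); last by case: dU.
exact: norm_hausdorff.
Qed.

Section Chart.
Variables (y0 : 'rV[R]_n) (r : R) (E : 'M[R]_(k, k + 1)).
Hypotheses (r0 : 0 < r) (rU : ball y0 r `<=` U).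
Hypothesis uN : col_mx E (p y0) \in unitmx.

Definition chart_dir := E *m B.
(** An affine slice of the domain through [y0], transversal to the rays: by [coord_al] all its
    points have height 1. *)
Definition chart_ray (s : 'rV[R]_k) := y0 + s *m chart_dir.
Definition chart_dom : set 'rV[R]_k := [set s | ball y0 r (chart_ray s)].
Definition chart_map s : M1 := toM (chart_ray s).
Local Notation V := chart_dom.
Local Notation u := chart_map.

Let iN := invmx (col_mx E (p y0)).
Let be : 'M[R]_(k + 1, k) := lsubmx iN.
Let al : 'M[R]_(k + 1, 1) := rsubmx iN.

Let inv_entries : [/\ E *m be = 1%:M, E *m al = 0, p y0 *m be = 0, p y0 *m al = 1%:M &
  be *m E + al *m p y0 = 1%:M].
Proof. exact: col_mx_inverse. Qed.

Lemma cone_coord_ray s : p (chart_ray s) = p y0 + s *m E.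
Proof. by rewrite /cone_coord /chart_ray /chart_dir mulmxDl addrA -!mulmxA BS mulmx1. Qed.

Let coord_al s : p (chart_ray s) *m al = 1%:M.
Proof.
have [_ Ea _ pa _] := inv_entries.
by rewrite cone_coord_ray mulmxDl -mulmxA Ea mulmx0 addr0.
Qed.

Let coord_be s : p (chart_ray s) *m be = s.
Proof.
have [Eb _ pb _ _] := inv_entries.
by rewrite cone_coord_ray mulmxDl -mulmxA Eb mulmx1 pb add0r.
Qed.

Let cray : continuous chart_ray.
Proof.
by move=> s; exact: (differentiable_continuous (differentiable_affine y0 chart_dir s)).
Qed.

Lemma chart_dom_open : open V.
Proof.
by apply: open_comp => [s _|]; [exact: cray|exact: ball_open].
Qed.

Lemma chart_dom0 : V 0.
Proof. by rewrite /chart_dom /= /chart_ray mul0mx addr0; exact: ballxx. Qed.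

Lemma chart_dom_sub s : V s -> U (chart_ray s).
Proof. exact: rU. Qed.

(** With [slope], this describes the central projection to the slice: [slope y] is the parameter of
    the point of the slice on the ray of [p y]. *)
Let height y := (p y *m al) 0 0.
Let slope y := (height y)^-1 *: (p y *m be).

Let coord_split y : p y = height y *: p y0 + p y *m be *m E.
Proof.
have [_ _ _ _ inv_sum] := inv_entries; rewrite -{1}[p y]mulmx1 -inv_sum mulmxDr !mulmxA addrC; congr (_ + _).
by rewrite [p y *m al]mx11_scalar mul_scalar_mx.
Qed.

Let cheight : continuous height.
Proof.
have -> : height = fun y => (c0 *m al + y *m (S *m al)) 0 0.
  by apply: funext => y; rewrite /height /cone_coord mulmxDl mulmxA.
move=> y; apply: (@continuous_comp _ _ _ (fun y => c0 *m al + y *m (S *m al)) (fun M : 'rV[R]_1 => M 0 0)).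
  exact: (differentiable_continuous (differentiable_affine (c0 *m al) (S *m al) y)).
exact: coord_continuous.
Qed.

Let cslope y : height y != 0 -> {for y, continuous slope}.
Proof.
move=> hy; have cb : continuous (fun y => p y *m be).
  have -> : (fun y => p y *m be) = fun y => c0 *m be + y *m (S *m be).
    by apply: funext => z; rewrite /cone_coord mulmxDl mulmxA.
  by move=> z; exact: (differentiable_continuous (differentiable_affine (c0 *m be) (S *m be) z)).
apply: continuousZ; last exact: cb.
by apply: continuousV => //; exact: cheight.
Qed.

Lemma chart_embedding : open_embedding_on V u.
Proof.
split; first exact: chart_dom_open.
- move=> s Vs; apply: (@continuous_comp _ _ _ chart_ray toM); first exact: cray.
  exact: (to_image_continuous oU (chart_dom_sub Vs)).
- move=> W WV oW.
  (* The slice over [W] need not be open in the domain. The cone over it is, and it has the same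
     image since the projection is constant along rays. *)
  pose Wt := [set y | [/\ ball y0 r y, 0 < height y & W (slope y)]].
  have -> : u @` W = toM @` Wt.
    apply/seteqP; split=> [_ [s Ws <-]|_ [y [yB hy Ws] <-]].
      exists (chart_ray s) => //; split; first exact: WV.
        by rewrite /height coord_al mxE eqxx ltr01.
      by rewrite /slope /height coord_al coord_be mxE eqxx invr1 scale1r.
    exists (slope y) => //; apply: to_image_eq; [exact/rU/WV|exact: rU|].
    apply: esym; apply: (ray rU (WV _ Ws) yB hy).
    rewrite cone_coord_ray scalerDr {1}coord_split; congr (_ + _).
    by rewrite /slope -!scalemxAl scalerA mulfV ?gt_eqF // scale1r.
  apply: (to_image_open oU lift); last by move=> y [/rU].
  rewrite openE => y [yB hy Ws].
  have n1 : \forall z \near y, ball y0 r z.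
    by apply: open_nbhs_nbhs; split=> //; exact: ball_open.
  have n2 : \forall z \near y, 0 < height z.
    have : nbhs (height y) [set t | 0 < t].
      by apply: open_nbhs_nbhs; split=> //; exact: open_gt.
    exact: cheight.
  have n3 : \forall z \near y, W (slope z).
    have hy0 : height y != 0 by rewrite gt_eqF.
    by apply: (cslope hy0); exact: open_nbhs_nbhs.
  by near=> z; split; near: z.
- move=> s s' /set_mem Vs /set_mem Vs' uss'.
  have : proj (chart_ray s) = proj (chart_ray s').
    rewrite -(to_imageE proj Ux0 (chart_dom_sub Vs)) -(to_imageE proj Ux0 (chart_dom_sub Vs')).
    exact: congr1.
  (* Both points have height 1, so [al] equates the exponential factors, after which [be] equates
     the parameters. *)
  move=> pss'; have := congr1 (mulmx^~ al) pss'.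
  rewrite /cone_proj -!scalemxAl !coord_al => /matrixP/(_ 0 0); rewrite !mxE !mulr1 => e.
  have := congr1 (mulmx^~ be) pss'; rewrite /cone_proj -!scalemxAl !coord_be e.
  by apply: scalerI; rewrite gt_eqF ?expR_gt0.
Unshelve. all: by end_near.
Qed.

Lemma chart_mapE s : V s -> image_val (chart_map s) =
  cone_point (fun s => F (chart_ray s)) mu E (p y0) s.
Proof.
by move=> Vs; rewrite to_imageE; [rewrite /cone_proj cone_coord_ray|exact: chart_dom_sub].
Qed.

End Chart.

End ConeImage.

Section AffineChange.
Context {R : realType} {n k : nat}.
Variables (U : set 'rV[R]_n) (V : set 'rV[R]_k) (a : 'rV[R]_n) (C : 'M[R]_(k, n)).
Hypotheses (oU : open U) (oV : open V) (VU : forall s, V s -> U (a + s *m C)).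

Lemma smooth_affine (F : 'rV[R]_n -> R) : smooth_on U F -> smooth_on V (fun s => F (a + s *m C)).
Proof. by move=> sF m; exact: Ck_affine_comp (sF m). Qed.

Lemma msmooth_affine p q (M : 'rV[R]_n -> 'M[R]_(p, q)) :
  msmooth U M -> msmooth V (fun s => M (a + s *m C)).
Proof. by move=> sM i j; exact: smooth_affine (sM i j). Qed.

Lemma partial_affine (F : 'rV[R]_n -> R) l s : smooth_on U F -> V s ->
  partial l (fun s => F (a + s *m C)) s = \sum_m C l m * partial m F (a + s *m C).
Proof.
move=> sF Vs; rewrite /partial derive_affine_comp derive_partial; last first.
  exact: (smooth_differentiable oU sF (VU Vs)).
by apply: eq_bigr => m _; rewrite -rowE rowmxE.
Qed.

Lemma pd_affine p q (M : 'rV[R]_n -> 'M[R]_(p, q)) l s : msmooth U M -> V s ->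
  pd l (fun s => M (a + s *m C)) s = \sum_m C l m *: pd m M (a + s *m C).
Proof.
move=> sM Vs; apply/matrixP => i j; rewrite summxE pdE (partial_affine l (sM i j) Vs).
by apply: eq_bigr => m _; rewrite scalemxE pdE.
Qed.

End AffineChange.

(** * The algebra in a chart of the cone *)

Section ChartAlgebra.
Context {R : realType} {n k : nat}.
Variables (V : set 'rV[R]_k) (g : 'rV[R]_k -> R) (mu : R).
Variables (E : 'M[R]_(k, k + 1)) (p0 : 'rV[R]_(k + 1)).
Variables (G : 'rV[R]_k -> 'M[R]_n) (L : 'rV[R]_k -> {linear 'rV[R]_n -> 'M[R]_n}).
Variables (e eta : 'rV[R]_k -> 'rV[R]_n) (C : 'M[R]_(k, n)) (P : 'M[R]_n).
Variables (be : 'M[R]_(n, k)) (al : 'cV[R]_n).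
Implicit Types (s : 'rV[R]_k).
Hypotheses (oV : open V) (sg : smooth_on V g) (mu0 : 0 < mu) (uN : col_mx E p0 \in unitmx).
Hypotheses (sG : msmooth V G) (sL : forall z, msmooth V (fun s => L s z)) (seta : msmooth V eta).
Hypotheses (CP : C *m P = C) (Cbe : C *m be = 1%:M) (Cal : C *m al = 0)
  (ebe : forall s, e s *m be = s) (eal : forall s, e s *m al = 1%:M).
Hypothesis split_im : forall s (Z : 'M[R]_(k, n)), Z *m P = Z ->
  Z = (Z *m be - Z *m al *m s) *m C + Z *m al *m e s.
Hypotheses (Gsym : forall s, V s -> (G s)^T = G s) (Gpos : forall s, V s -> posdef (G s)).
Hypotheses (Lc : forall s u w, V s -> u *m L s w = w *m L s u)
  (Ls : forall s v, V s -> L s v *m G s = G s *m (L s v)^T)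
  (LP : forall s v, V s -> L s v *m P = L s v) (Le : forall s, V s -> L s (e s) = P).
Hypothesis etaE : forall s, V s -> eta s = - (e s *m G s).
Hypothesis eta_euler : forall s, V s -> (e s *m (eta s)^T) 0 0 = - mu^-1.
Hypothesis partial_g : forall l s, V s -> partial l g s = (eta s *m C^T) 0 l.
Hypothesis pdG : forall l s, V s -> pd l G s = - 2 *: (L s (row l C) *m G s).
Hypothesis pd_eta : forall l s, V s -> pd l eta s = row l C *m P *m G s.
Hypothesis pdL : forall l z s, V s -> pd l (fun s => L s z) s =
  L s z *m L s (row l C) - L s (row l C) *m L s z - L s (z *m L s (row l C)).
Variables (X : 'I_k -> 'rV[R]_k -> 'M[R]_(k, n)) (A : 'I_k -> 'rV[R]_k -> 'M[R]_k).
Variables (b : 'I_k -> 'rV[R]_k -> 'cV[R]_k) (dg : 'rV[R]_k -> 'rV[R]_k).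
Variable hg : 'rV[R]_k -> 'M[R]_k.
Hypotheses (XE : forall i s, X i s = C *m L s (row i C))
  (AE : forall i s, A i s = X i s *m be - X i s *m al *m s)
  (bE : forall i s, b i s = X i s *m al)
  (dgE : forall s, dg s = eta s *m C^T) (hgE : forall s, hg s = C *m G s *m C^T).

Let sc p q (M : 'M[R]_(p, q)) : msmooth V (fun=> M). Proof. exact: msmooth_cst. Qed.

Let msmooth_hg : msmooth V hg.
Proof.
apply: (msmooth_ext oV (fun s _ => esym (hgE s))).
by apply: msmoothM => //; exact: msmoothM.
Qed.

Let msmooth_dg : msmooth V dg.
Proof. by apply: (msmooth_ext oV (fun s _ => esym (dgE s))); exact: msmoothM. Qed.

Let msmooth_X i : msmooth V (X i).
Proof. by apply: (msmooth_ext oV (fun s _ => esym (XE i s))); exact: msmoothM. Qed.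

Let sXb i : msmooth V (fun s => X i s *m be). Proof. exact: msmoothM. Qed.
Let sXa i : msmooth V (fun s => X i s *m al). Proof. exact: msmoothM. Qed.
Let sXas i : msmooth V (fun s => X i s *m al *m s).
Proof. by apply: msmoothM => //; exact: msmooth_id. Qed.

Let msmooth_A i : msmooth V (A i).
Proof. by apply: (msmooth_ext oV (fun s _ => esym (AE i s))); exact: msmoothB. Qed.

(** Products lie in the image of [P], which is spanned by the chart directions and the unit. *)
Let decomp i s : V s -> X i s = A i s *m C + b i s *m e s.
Proof.
by move=> Vs; rewrite AE bE -split_im // XE -mulmxA LP.
Qed.

Let euler s : V s -> e s *m G s *m (e s)^T = (mu^-1)%:M.
Proof.
move=> Vs; have := eta_euler Vs; rewrite etaE // [(- _)^T]linearN /= trmx_mul Gsym //.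
by rewrite mulmxN oppmxE mulmxA => /oppr_inj e1; rewrite [LHS]mx11_scalar e1.
Qed.

Let eGC s : V s -> e s *m G s *m C^T = - dg s.
Proof. by move=> Vs; rewrite dgE etaE // mulNmx opprK. Qed.

Let CGe s : V s -> C *m G s *m (e s)^T = - (dg s)^T.
Proof.
move=> Vs; apply: trmx_inj; rewrite [(- _)^T]linearN /= trmxK -eGC // trmx_mul trmxK trmx_mul.
by rewrite Gsym // mulmxA.
Qed.

(** Pairing [decomp] with the unit isolates [b]: the unit has squared length [1/mu], and
    self-adjointness moves the multiplication onto it. *)
Let b_hg i s : V s -> b i s = mu *: (hg s *m (delta_mx 0 i)^T + A i s *m (dg s)^T).
Proof.
move=> Vs.
have : X i s *m G s *m (e s)^T = hg s *m (delta_mx 0 i)^T.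
  rewrite XE -[C *m _ *m G _]mulmxA Ls // -!mulmxA -trmx_mul (Lc (e _)) // Le //.
  rewrite hgE -[RHS]mulmxA -trmx_mul -rowE -[RHS]mulmxA; congr (_ *m (_ *m _^T)).
  by rewrite rowE -mulmxA CP.
rewrite decomp // !mulmxDl -[A i s *m C *m _]mulmxA -[A i s *m _ *m _]mulmxA CGe //.
rewrite -[b i s *m _ *m G _]mulmxA -[b i s *m _ *m _]mulmxA euler // mul_mx_scalar mulmxN => <-.
by rewrite addrC addrA subrr add0r scalerA mulfV ?scale1r // gt_eqF.
Qed.

Let pd_hg l s : V s -> pd l hg s = - 2 *: (A l s *m hg s - b l s *m dg s).
Proof.
move=> Vs; rewrite (pd_ext l oV (fun s _ => hgE s) Vs).
have sCG : msmooth V (fun s => C *m G s) by exact: msmoothM.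
rewrite (pdMr _ l oV sCG) // (pdMl _ l oV sG) // pdG //.
rewrite -scalemxAr -scalemxAl; congr (_ *: _); rewrite mulmxA -XE decomp // !mulmxDl.
rewrite -[A l s *m C *m _]mulmxA -[A l s *m _ *m _]mulmxA -hgE; congr (_ + _).
by rewrite -[b l s *m _ *m G _]mulmxA -[b l s *m _ *m _]mulmxA eGC // mulmxN.
Qed.

Let pd_dg l s : V s -> pd l dg s = delta_mx 0 l *m hg s.
Proof.
move=> Vs; rewrite (pd_ext l oV (fun s _ => dgE s) Vs) (pdMr _ l oV seta) // pd_eta //.
by rewrite rowE hgE -[_ *m C *m P]mulmxA CP !mulmxA.
Qed.

Let partial_gE l s : V s -> partial l g s = dg s 0 l.
Proof. by move=> Vs; rewrite partial_g // dgE. Qed.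

Let hg_sym s : V s -> (hg s)^T = hg s.
Proof. by move=> Vs; rewrite hgE trmx_mul trmxK trmx_mul Gsym // mulmxA. Qed.

Let A_comm i j s : V s -> delta_mx 0 j *m A i s = delta_mx 0 i *m A j s :> 'rV[R]_k.
Proof.
move=> Vs.
have XC : delta_mx 0 j *m X i s = delta_mx 0 i *m X j s :> 'rV[R]_n.
  by rewrite !XE !mulmxA -!rowE (Lc (row j C)).
by rewrite !AE !mulmxBr !mulmxA XC.
Qed.

Let pd_X i l s : V s -> pd l (X i) s = C *m (L s (row i C) *m L s (row l C)
  - L s (row l C) *m L s (row i C) - L s (row i C *m L s (row l C))).
Proof.
move=> Vs; rewrite (pd_ext l oV (fun s _ => XE i s) Vs) (pdMl _ l oV (sL _)) //.
by rewrite pdL.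
Qed.

(** The coefficients along the chart directions after projecting the unit away; [s] enters because
    the unit [e s] moves. *)
Let pr s (Z : 'M[R]_(k, n)) := Z *m be - Z *m al *m s.

Let prC s : pr s C = 1%:M. Proof. by rewrite /pr Cbe Cal mul0mx subr0. Qed.

Let prM s (M : 'M[R]_k) (Z : 'M[R]_(k, n)) : pr s (M *m Z) = M *m pr s Z.
Proof. by rewrite /pr mulmxBr !mulmxA. Qed.

Let prD s Z Z' : pr s (Z + Z') = pr s Z + pr s Z'.
Proof. by rewrite /pr !mulmxDl; mxlin. Qed.

Let prB s Z Z' : pr s (Z - Z') = pr s Z - pr s Z'.
Proof. by rewrite /pr !mulmxBl; mxlin. Qed.

Let prZ s a Z : pr s (a *: Z) = a *: pr s Z.
Proof. by rewrite /pr -!scalemxAl scalerBr. Qed.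

Let prS s (Z : 'I_k -> 'M[R]_(k, n)) : pr s (\sum_m Z m) = \sum_m pr s (Z m).
Proof. by rewrite /pr !mulmx_suml -sumrB. Qed.

Let prX i s : pr s (X i s) = A i s. Proof. by rewrite AE. Qed.

Let pr_row s (c : 'cV[R]_k) j : pr s (c *m row j C) = c *m delta_mx 0 j.
Proof. by rewrite rowE mulmxA prM prC mulmx1. Qed.

Let XL j m s : V s -> X j s *m L s (row m C) = A j s *m X m s + b j s *m row m C.
Proof.
move=> Vs; rewrite {1}decomp // mulmxDl -mulmxA -XE -mulmxA; congr (_ + _ *m _).
by rewrite Lc // Le // rowE -mulmxA CP.
Qed.

Let CL_row i l s : V s -> C *m L s (row i C *m L s (row l C)) =
  \sum_m A l s i m *: X m s + b l s i 0 *: C.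
Proof.
move=> Vs; have -> : row i C *m L s (row l C) = \sum_m A l s i m *: row m C + b l s i 0 *: e s.
  rewrite rowE -mulmxA -XE decomp // mulmxDr !mulmxA -!rowE; congr (_ + _).
    by rewrite mulmx_sum_row; apply: eq_bigr => m _; rewrite rowmxE.
  by rewrite [row i (b l s)]mx11_scalar mul_scalar_mx rowmxE.
have -> : L s (\sum_m A l s i m *: row m C + b l s i 0 *: e s) =
    \sum_m A l s i m *: L s (row m C) + b l s i 0 *: L s (e s).
  rewrite linearD linear_sum linearZ; congr (_ + _).
  by apply: eq_bigr => m _; rewrite linearZ.
rewrite Le // mulmxDr mulmx_sumr -scalemxAr CP; congr (_ + _).
by apply: eq_bigr => m _; rewrite -scalemxAr XE.
Qed.

Let pd_A i l s : V s -> pd l (A i) s = A i s *m A l s - A l s *m A i s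
  - \sum_m A l s i m *: A m s - b l s *m delta_mx 0 i - (b l s i 0)%:M.
Proof.
(* The last term comes from differentiating the projection itself. *)
move=> Vs; have -> : pd l (A i) s = pr s (pd l (X i) s) - b i s *m delta_mx 0 l.
  rewrite (pd_ext l oV (fun s _ => AE i s) Vs) (pdB l oV (sXb i) (sXas i)) //.
  rewrite (pdMr _ l oV) // (pdM l oV (sXa i) (msmooth_id oV)) //.
  by rewrite (pdMr _ l oV) // pd_id opprD addrA -bE.
rewrite pd_X // !mulmxBr !mulmxA -!XE !XL // CL_row // !prB !prD !prM !pr_row prS prZ prC.
rewrite scalemx1 !prX (eq_bigr (fun m => A l s i m *: A m s)); last first.
  by move=> m _; rewrite prZ prX.
mxlin.
Qed.

(** The cone metric is [mu] times [G] on the orthogonal complement of the unit: [c] is chosen to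
    make [w'] orthogonal to [e s], and projecting the unit away recovers [v] from [w']. *)
Let h_pos s : V s -> posdef (cone_metric mu dg hg s).
Proof.
move=> Vs v v0.
pose w := v *m C; pose c := mu * (v *m (dg s)^T) 0 0; pose w' := w + c *: e s.
have w'0 : w' != 0.
  apply/eqP => w0; have : w' *m be - w' *m al *m s = 0 by rewrite w0 !mul0mx subrr.
  rewrite /w' /w !mulmxDl -!scalemxAl -!mulmxA Cbe [C *m (al *m s)]mulmxA Cal.
  rewrite [e s *m (al *m s)]mulmxA ebe eal mul0mx mulmx0 mul1mx mulmx1 add0r addrK => vE.
  by rewrite vE eqxx in v0.
have := Gpos Vs w'0.
have eGw : e s *m G s *m w^T = - (dg s *m v^T).
  by rewrite /w trmx_mul mulmxA eGC // mulNmx.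
have wGe : w *m G s *m (e s)^T = - (v *m (dg s)^T).
  by rewrite /w -!mulmxA [C *m (_ *m _)]mulmxA CGe // mulmxN.
have wGw : w *m G s *m w^T = v *m hg s *m v^T.
  by rewrite /w hgE trmx_mul !mulmxA.
have E4 : w' *m G s *m w'^T = v *m hg s *m v^T - c *: (v *m (dg s)^T) - c *: (dg s *m v^T)
    + (c * c) *: (mu^-1)%:M.
  have w'T : w'^T = w^T + c *: (e s)^T.
    by apply/matrixP => i j; rewrite trmxE addmxE !(addmxE, scalemxE, trmxE).
  rewrite w'T /w' !mulmxDl !mulmxDr -/w.
  rewrite -!scalemxAl -!scalemxAr scalerA euler // wGw wGe eGw !scalerN; mxlin.
rewrite E4.
have -> : v *m cone_metric mu dg hg s *m v^T = mu *: (v *m hg s *m v^T)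
    - mu ^+ 2 *: (v *m (dg s)^T *m (dg s *m v^T)).
  by rewrite /cone_metric mulmxBr mulmxBl -!scalemxAr -!scalemxAl !mulmxA.
rewrite !(addmxE, oppmxE, scalemxE) => h0.
have E5 : (v *m (dg s)^T *m (dg s *m v^T)) 0 0 = (v *m (dg s)^T) 0 0 * (dg s *m v^T) 0 0.
  by rewrite mxE big_ord1.
have E6 : (dg s *m v^T) 0 0 = (v *m (dg s)^T) 0 0.
  by rewrite -[LHS]trmxE trmx_mul trmxK.
have E7 : ((mu^-1)%:M : 'M[R]_1) 0 0 = mu^-1 by rewrite mxE eqxx mulr1n.
move: h0; rewrite E5 E6 E7 /c.
move: ((v *m (dg s)^T) 0 0) ((v *m hg s *m v^T) 0 0) => q t h0.
have -> : mu * t - mu ^+ 2 * (q * q) = mu * (t - mu * q * q - mu * q * q + mu * q * (mu * q) * mu^-1).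
  have muN : mu != 0 by rewrite gt_eqF.
  by field.
exact: mulr_gt0.
Qed.

Local Notation Y := (cone_point g mu E p0).

Lemma chart_frame_unit s : V s -> frame Y Y s \in unitmx.
Proof. exact: (cone_frame_unit mu oV sg uN partial_gE). Qed.

Lemma chart_metric_posdef s : V s -> posdef (metric Y Y s).
Proof.
move=> Vs; rewrite (cone_metricE mu oV sg msmooth_dg uN partial_gE pd_dg) //.
exact: h_pos.
Qed.

Lemma chart_parallel : parallel_cubic V Y Y.
Proof.
exact: (cone_parallel oV sg msmooth_hg msmooth_dg uN partial_gE pd_dg hg_sym h_pos
  msmooth_A A_comm b_hg pd_hg pd_A).
Qed.

End ChartAlgebra.

Lemma complete_row {K : fieldType} k (p0 : 'rV[K]_(k + 1)) : p0 != 0 ->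
  exists E : 'M[K]_(k, k + 1), col_mx E p0 \in unitmx.
Proof.
move=> p00; have rk : \rank (p0^C)%MS = k.
  by rewrite mxrank_compl rank_rV p00 addn1 subn1.
suff : exists E : 'M[K]_(\rank (p0^C)%MS, k + 1), \rank (col_mx E p0) = (k + 1)%N.
  rewrite rk => -[E rE]; exists E.
  by rewrite -row_free_unit /row_free rE.
exists (row_base (p0^C)%MS); rewrite -addsmxE.
have -> : \rank (row_base (p0^C) + p0)%MS = \rank (p0^C + p0)%MS.
  by rewrite (adds_eqmx (eq_row_base _) (eqmx_refl p0)).
by rewrite addsmxC; apply/eqP; exact: addsmx_compl_full.
Qed.

(** * The image as a centroaffine hypersurface with parallel cubic form *)

Section ConeCentroaffine.
Context {R : realType} {n k : nat}.
Variables (U : set 'rV[R]_n) (F : 'rV[R]_n -> R) (mu : R).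
Variables (eta : 'rV[R]_n -> 'rV[R]_n) (B : 'M[R]_(k + 1, n)) (S : 'M[R]_(n, k + 1)).
Variables (c0 : 'rV[R]_(k + 1)) (G : 'rV[R]_n -> 'M[R]_n).
Variable L : 'rV[R]_n -> {linear 'rV[R]_n -> 'M[R]_n}.
Implicit Types (y z v : 'rV[R]_n).
Local Notation p := (cone_coord S c0).
Local Notation P := (S *m B).
Hypotheses (dU : is_domain U) (sF : smooth_on U F) (mu0 : 0 < mu).
Hypotheses (sG : msmooth U G) (sL : forall z, msmooth U (fun y => L y z)) (seta : msmooth U eta).
Hypotheses (BS : B *m S = 1%:M) (Gsym : forall y, U y -> (G y)^T = G y)
  (Gpos : forall y, U y -> posdef (G y)).
Hypotheses (Lc : forall y u w, U y -> u *m L y w = w *m L y u)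
  (Ls : forall y v, U y -> L y v *m G y = G y *m (L y v)^T)
  (LP : forall y v, U y -> L y v *m P = L y v)
  (Lp : forall y, U y -> L y (p y *m B) = P).
Hypothesis partialF : forall l y, U y -> partial l F y = eta y 0 l.
Hypothesis etaE : forall y, U y -> eta y = - (p y *m B *m G y).
Hypothesis etaP : forall y, U y -> eta y *m P^T = eta y.
Hypothesis eta_homogeneous : forall y y' r, U y -> U y' -> r != 0 ->
  p y' = r *: p y -> eta y' = r^-1 *: eta y.
Hypothesis eta_euler : forall y, U y -> ((p y *m B) *m (eta y)^T) 0 0 = - mu^-1.
Hypothesis pdG : forall l y, U y -> pd l G y = - 2 *: (L y (delta_mx 0 l) *m G y).
Hypothesis pd_eta : forall l y, U y -> pd l eta y = delta_mx 0 l *m P *m G y.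
Hypothesis pdL : forall l z y, U y -> pd l (fun y => L y z) y =
  L y z *m L y (delta_mx 0 l) - L y (delta_mx 0 l) *m L y z - L y (z *m L y (delta_mx 0 l)).
Hypothesis p_pos : k = 0%N -> forall y, U y -> forall i, 0 < p y 0 i.

Let oU : open U. Proof. by case: dU. Qed.

Local Notation proj := (cone_proj F mu S c0).
Variables (x0 : 'rV[R]_n) (Ux0 : U x0).
Local Notation M1 := (image_space U proj).
Local Notation toM := (to_image proj Ux0).

Section AtChart.
Variables (y0 : 'rV[R]_n) (r : R) (E : 'M[R]_(k, k + 1)).
Hypotheses (r0 : 0 < r) (rU : ball y0 r `<=` U) (uN : col_mx E (p y0) \in unitmx).
Local Notation V := (chart_dom B y0 r E).
Local Notation ray := (chart_ray B y0 E).
Local Notation C := (chart_dir B E).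
Local Notation u := (chart_map F mu B S c0 Ux0 y0 E).
Local Notation Y := (cone_point (fun s => F (ray s)) mu E (p y0)).

Let oV : open V. Proof. exact: chart_dom_open. Qed.
Let VU s : V s -> U (ray s). Proof. exact: rU. Qed.

Let pray s : p (ray s) = p y0 + s *m E. Proof. exact: cone_coord_ray. Qed.

Let be : 'M[R]_(n, k) := S *m lsubmx (invmx (col_mx E (p y0))).
Let al : 'cV[R]_n := S *m rsubmx (invmx (col_mx E (p y0))).

Let shift_L l s : \sum_m C l m *: L (ray s) (delta_mx 0 m) = L (ray s) (row l C).
Proof.
rewrite [row l C]row_sum_delta linear_sum; apply: eq_bigr => m _.
by rewrite linearZ rowmxE.
Qed.

Let smr p q (M : 'rV[R]_n -> 'M[R]_(p, q)) : msmooth U M -> msmooth V (fun s => M (ray s)).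
Proof. exact: (msmooth_affine oU oV VU). Qed.

Let sFr : smooth_on V (fun s => F (ray s)).
Proof. exact: (smooth_affine oU oV VU sF). Qed.

Let chart_conclusion : (forall s, V s -> frame Y Y s \in unitmx) /\
  (forall s, V s -> posdef (metric Y Y s)) /\ parallel_cubic V Y Y.
Proof.
have [Eb Ea pb pa inv_sum] := col_mx_inverse uN.
have CE : C = E *m B by [].
have CP : C *m P = C by rewrite CE -mulmxA [B *m _]mulmxA BS mul1mx.
have Cbe : C *m be = 1%:M by rewrite CE /be -mulmxA [B *m _]mulmxA BS mul1mx.
have Cal : C *m al = 0 by rewrite CE /al -mulmxA [B *m _]mulmxA BS mul1mx.
have ebe s : p (ray s) *m B *m be = s.
  by rewrite /be -mulmxA [B *m _]mulmxA BS mul1mx pray mulmxDl pb add0r -mulmxA Eb mulmx1.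
have eal s : p (ray s) *m B *m al = 1%:M.
  by rewrite /al -mulmxA [B *m _]mulmxA BS mul1mx pray mulmxDl pa -mulmxA Ea mulmx0 addr0.
have split_im s (Z : 'M[R]_(k, n)) : Z *m P = Z ->
    Z = (Z *m be - Z *m al *m s) *m C + Z *m al *m (p (ray s) *m B).
  move=> ZP; have ZS : Z = Z *m S *m B by rewrite -mulmxA.
  rewrite {1}ZS -[Z *m S]mulmx1 -inv_sum pray CE /be /al.
  rewrite !mulmxDr !mulmxDl !mulmxDr !mulmxA !mulNmx; mxlin.
have partial_g l s : V s -> partial l (fun s => F (ray s)) s = (eta (ray s) *m C^T) 0 l.
  move=> Vs; rewrite (partial_affine oU VU l sF Vs) mxE; apply: eq_bigr => m _.
  by rewrite partialF ?trmxE 1?mulrC //; exact: VU.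
have pdGr l s : V s -> pd l (fun s => G (ray s)) s = - 2 *: (L (ray s) (row l C) *m G (ray s)).
  move=> Vs; rewrite (pd_affine oU VU l sG Vs) -shift_L mulmx_suml scaler_sumr.
  by apply: eq_bigr => m _; rewrite pdG -?scalemxAl ?scalerA 1?mulrC //; exact: VU.
have pd_etar l s : V s -> pd l (fun s => eta (ray s)) s = row l C *m P *m G (ray s).
  move=> Vs; rewrite (pd_affine oU VU l seta Vs) [row l C]row_sum_delta !mulmx_suml.
  by apply: eq_bigr => m _; rewrite pd_eta ?rowmxE -?scalemxAl //; exact: VU.
have pdLr l z s : V s -> pd l (fun s => L (ray s) z) s =
   L (ray s) z *m L (ray s) (row l C) - L (ray s) (row l C) *m L (ray s) z
   - L (ray s) (z *m L (ray s) (row l C)).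
  move=> Vs; rewrite (pd_affine oU VU l (sL z) Vs).
  have LS (c : 'I_n -> R) (w : 'I_n -> 'rV[R]_n) :
      L (ray s) (\sum_m c m *: w m) = \sum_m c m *: L (ray s) (w m).
    by rewrite linear_sum; apply: eq_bigr => m _; rewrite linearZ.
  rewrite -(shift_L l s) [z *m \sum_(_ < _) _]mulmx_sumr mulmx_suml mulmx_sumr.
  rewrite (eq_bigr (fun m => C l m *: (z *m L (ray s) (delta_mx 0 m)))); last first.
    by move=> m _; rewrite scalemxAr.
  rewrite LS -!sumrB; apply: eq_bigr => m _; rewrite pdL; last exact: VU.
  by rewrite !scalerBr -scalemxAr -scalemxAl.
have Vsym s : V s -> (G (ray s))^T = G (ray s) by move=> /VU; exact: Gsym.
have Vpos s : V s -> posdef (G (ray s)) by move=> /VU; exact: Gpos.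
have Vc s a b : V s -> a *m L (ray s) b = b *m L (ray s) a by move=> /VU; exact: Lc.
have Vs_ s a : V s -> L (ray s) a *m G (ray s) = G (ray s) *m (L (ray s) a)^T.
  by move=> /VU; exact: Ls.
have VP s a : V s -> L (ray s) a *m P = L (ray s) a by move=> /VU; exact: LP.
have Vp s : V s -> L (ray s) (p (ray s) *m B) = P by move=> /VU; exact: Lp.
have VetaE s : V s -> eta (ray s) = - (p (ray s) *m B *m G (ray s)) by move=> /VU; exact: etaE.
have Veul s : V s -> ((p (ray s) *m B) *m (eta (ray s))^T) 0 0 = - mu^-1.
  by move=> /VU; exact: eta_euler.
pose X i s := C *m L (ray s) (row i C).
pose A i s : 'M[R]_k := X i s *m be - X i s *m al *m s.
pose b i s : 'cV[R]_k := X i s *m al.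
pose dg s : 'rV[R]_k := eta (ray s) *m C^T.
pose hg s : 'M[R]_k := C *m G (ray s) *m C^T.
split; [|split].
- exact: (chart_frame_unit mu oV sFr uN partial_g (fun s => erefl (dg s))).
- exact: (chart_metric_posdef oV sFr mu0 uN (smr seta) CP Cbe Cal ebe eal Vsym Vpos VetaE Veul
    partial_g pd_etar (dg := dg) (hg := hg)).
- exact: (chart_parallel oV sFr mu0 uN (smr sG) (fun z => smr (sL z)) (smr seta) CP Cbe Cal
    ebe eal split_im Vsym Vpos Vc Vs_ VP Vp VetaE Veul partial_g pdGr pd_etar pdLr
    (X := X) (A := A) (b := b) (dg := dg) (hg := hg)).
Qed.

Let uE s : V s -> (image_val \o u) s = Y s.
Proof. by move=> Vs; exact: (chart_mapE F mu c0 BS Ux0 rU Vs). Qed.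

Lemma cone_centroaffine_chart : centroaffine_chart (image_val : M1 -> 'rV[R]_(k + 1)) V u.
Proof.
have [fu [mp _]] := chart_conclusion.
split.
- exact: (chart_embedding dU sF mu0 partialF BS etaP eta_homogeneous eta_euler Ux0 rU uN).
- apply: (smooth_ext oV (F := Y)); first by move=> s Vs; rewrite uE.
  exact: smooth_cone_point.
- by move=> s Vs; rewrite (frame_ext oV uE uE Vs); exact: fu.
- by move=> s Vs; rewrite (metric_ext oV uE uE Vs); exact: mp.
Qed.

Lemma cone_chart_parallel : parallel_cubic V (image_val \o u) (image_val \o u).
Proof.
have [_ [_ pY]] := chart_conclusion => s Vs l m i j.
by rewrite (cov_cubic_ext oV uE uE l m i j Vs); exact: pY.
Qed.

End AtChart.

Let chart_exists (q : M1) : exists y0 r E, [/\ 0 < r, ball y0 r `<=` U,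
  col_mx E (p y0) \in unitmx & (chart_map F mu B S c0 Ux0 y0 E @` chart_dom B y0 r E) q].
Proof.
have [y0 Uy0 yq] := to_image_surj Ux0 q.
have /nbhs_ballP[r /= r0 rU] := open_nbhs_nbhs (conj oU Uy0).
have [E uN] := complete_row (cone_coord_neq0 mu0 eta_euler Uy0).
exists y0, r, E; split=> //; exists 0; first exact: chart_dom0.
by rewrite /chart_map /chart_ray mul0mx addr0.
Qed.

Lemma cone_centroaffine_hypersurface :
  centroaffine_hypersurface (image_val : M1 -> 'rV[R]_(k + 1)).
Proof.
split.
- exact: (cone_image_manifold mu dU sF partialF BS etaP eta_homogeneous Ux0).
- move=> q; have [y0 [r [E [r0 rU uN uq]]]] := chart_exists q.
  by exists (chart_dom B y0 r E), (chart_map F mu B S c0 Ux0 y0 E); split=> //; exact: cone_centroaffine_chart.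
- move=> k0 q i; have [y Uy <-] := to_image_surj Ux0 q.
  by rewrite to_imageE // scalemxE mulr_gt0 ?expR_gt0 // p_pos.
Qed.

Lemma cone_centroaffine_parallel : centroaffine_parallel (image_val : M1 -> 'rV[R]_(k + 1)).
Proof.
move=> q; have [y0 [r [E [r0 rU uN uq]]]] := chart_exists q.
exists (chart_dom B y0 r E), (chart_map F mu B S c0 Ux0 y0 E); split=> //.
  exact: cone_centroaffine_chart.
exact: cone_chart_parallel.
Qed.

End ConeCentroaffine.

(** * Paraboloids *)

Lemma connected_row {R : realType} n : connected [set: 'rV[R]_n].
Proof.
have -> : [set: 'rV[R]_n] = \bigcup_(v in setT) ((fun t : R => t *: v) @` setT).
  by apply/seteqP; split=> // v _; exists v => //; exists 1; rewrite ?scale1r.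
apply: bigcup_connected; first by exists 0 => v _; exists 0; rewrite ?scale0r.
move=> v _; apply: connected_continuous_connected; first exact/connected_intervalP.
by apply: continuous_subspaceT => t; exact: scalel_continuous.
Qed.

Lemma manifold_row {R : realType} n : manifold_space 'rV[R]_n.
Proof.
split; [exact: norm_hausdorff|exact: second_countable_row|exact: connected_row].
Qed.

Lemma domain_row {R : realType} n : is_domain [set: 'rV[R]_n].
Proof. by split; [exact: openT|exact: connected_row|exists 0]. Qed.

Lemma affine_embedding {R : realType} n (U : set 'rV[R]_n) a (M M' : 'M[R]_n) :
  open U -> M *m M' = 1%:M -> open_embedding_on U (fun y => a + y *m M).
Proof.
move=> oU MM'; have M'M := mulmx1C MM'.
have K : cancel (fun y : 'rV[R]_n => a + y *m M) (fun z => - (a *m M') + z *m M').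
  by move=> y; rewrite mulmxDl addKr -mulmxA MM' mulmx1.
have K' : cancel (fun z : 'rV[R]_n => - (a *m M') + z *m M') (fun y => a + y *m M).
  by move=> z; rewrite mulmxDl mulNmx -!mulmxA M'M !mulmx1 addrA subrr add0r.
split=> // [y _|W WU oW|y y' _ _ /(congr1 (fun z => - (a *m M') + z *m M'))].
- exact: (differentiable_continuous (differentiable_affine a M y)).
- have -> : (fun y => a + y *m M) @` W = (fun z => - (a *m M') + z *m M') @^-1` W.
    apply/seteqP; split=> [_ [y Wy <-]|z Wz] /=; first by rewrite K.
    by exists (- (a *m M') + z *m M'); rewrite ?K'.
  apply: open_comp => // z _.
  exact: (differentiable_continuous (differentiable_affine (- (a *m M')) M' z)).
- by rewrite !K.
Qed.

Section Paraboloid.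
Context {R : realType} {n : nat}.
Local Notation phi := (@half_sqnorm R n).
Let oT : open [set: 'rV[R]_n] := openT.

Lemma smooth_half_sqnorm : smooth_on setT phi.
Proof.
move=> k; apply: CkM => //; first exact: Ck_cst.
by apply: Ck_sum => // i _; apply: CkM => //; exact: Ck_coord.
Qed.

Lemma partial_half_sqnorm i x : partial i phi x = x 0 i.
Proof.
have sc j : smooth_on setT (fun x : 'rV[R]_n => x 0 j * x 0 j).
  by move=> k; apply: CkM => //; exact: Ck_coord.
have ss : smooth_on setT (fun x : 'rV[R]_n => \sum_j x 0 j * x 0 j).
  by move=> k; apply: Ck_sum => // j _; exact: sc.
rewrite (smooth_partialM i oT (smooth_cst _ oT) ss) // partial_cst mul0r add0r.
rewrite (smooth_partial_sum _ i oT sc) //.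
have E j : partial i (fun x : 'rV[R]_n => x 0 j * x 0 j) x = 2 * (x 0 j * (i == j)%:R).
  have sj := smooth_coord j oT.
  by rewrite (smooth_partialM i oT sj sj) // !partial_coord; ring.
rewrite (eq_bigr _ (fun j _ => E j)) -mulr_sumr mulKf ?pnatr_eq0 //.
rewrite (bigD1 i) //= eqxx mulr1 big1 ?addr0 // => j.
by rewrite eq_sym => /negbTE ->; rewrite mulr0.
Qed.

Lemma hessian_half_sqnorm x : hessian phi x = 1%:M.
Proof.
apply/matrixP => i j; rewrite !mxE.
rewrite (partial_ext i oT (fun x _ => partial_half_sqnorm j x)) // partial_coord.
by [].
Qed.

Lemma strictly_convex_half_sqnorm : strictly_convex_on setT phi.
Proof.
move=> x _ v v0; rewrite hessian_half_sqnorm mulmx1 mxE.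
have [j vj] : exists j, v 0 j != 0.
  apply/existsP; apply: contra_neqT v0; rewrite negb_exists => /forallP v0.
  by apply/rowP => j; have := v0 j; rewrite negbK => /eqP ->; rewrite mxE.
rewrite (bigD1 j) //= ltr_pwDl //.
  by rewrite mxE -expr2 exprn_even_gt0.
by apply: sumr_ge0 => i _; rewrite mxE -expr2 sqr_ge0.
Qed.

Lemma A_half_sqnorm l x : A_ phi l x = 0.
Proof.
rewrite A_E third_pd (pd_ext l oT (fun x _ => hessian_half_sqnorm x)) //.
by rewrite pd_cst mul0mx scaler0.
Qed.

Lemma parallel_half_sqnorm : parallel_cubic setT (graph phi) (fun=> Yvec R n).
Proof.
move=> x Ux l k i j.
rewrite (graph_cov_cubic oT smooth_half_sqnorm) //.
rewrite (pd_ext l oT (fun x _ => A_half_sqnorm i x)) // pd_cst !A_half_sqnorm.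
rewrite big1 ?mul0mx ?subrr ?subr0 ?zeromxE // => m _.
by rewrite zeromxE scale0r.
Qed.

Lemma calabi_chart_paraboloid : calabi_chart (graph phi) setT phi id.
Proof.
split=> //; first exact: domain_row.
- exact: smooth_half_sqnorm.
- exact: strictly_convex_half_sqnorm.
- split; [exact: openT|by move=> x _; exact: cvg_id|by move=> W _; rewrite image_id|by move=> x y].
Qed.

Lemma calabi_hypersurface_paraboloid : calabi_hypersurface (graph phi).
Proof.
split; first exact: manifold_row.
by move=> q; exists setT, phi, id; split; [exists q|exact: calabi_chart_paraboloid].
Qed.

Lemma calabi_parallel_paraboloid : calabi_parallel (graph phi).
Proof.
move=> q; exists setT, phi, id; split; [by exists q|exact: calabi_chart_paraboloid|].
exact: parallel_half_sqnorm.
Qed.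

End Paraboloid.

Section CastAffine.
Context {R : comUnitRingType} {N m p : nat} (e : m = N).

Lemma castmx_affine (g : 'M[R]_(p, N)) (D : 'M[R]_(N, m)) (d : 'M[R]_(p, m)) :
  g *m castmx (erefl N, e) D + castmx (erefl p, e) d = castmx (erefl p, e) (g *m D + d).
Proof. by case: N / e g D => g D; rewrite !castmx_id. Qed.

Lemma castmx_unit (D : 'M[R]_(N, m)) (D' : 'M[R]_(m, N)) : D *m D' = 1%:M ->
  castmx (erefl N, e) D \in unitmx.
Proof.
by case: N / e D D' => D D' DD'; rewrite castmx_id; have [] := mulmx1_unit DD'.
Qed.

End CastAffine.

(** Phrased by the numerical index, to be insensitive to the way a dimension is written as a sum. *)
Lemma row_mx01E {R : pzRingType} a (j : 'I_(a + 1)) :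
  (row_mx 0 1%:M : 'rV[R]_(a + 1)) 0 j = (val j == a)%:R.
Proof.
case: (split_ordP j) => i ->; first by rewrite row_mxEl mxE /= ltn_eqF.
by rewrite row_mxEr !mxE !ord1 /= addn0 eqxx.
Qed.

Lemma castmx_Yvec {R : realType} {n n2 m : nat} (e : (m + (n2 + 1))%N = (n + 1)%N) :
  castmx (erefl 1%N, e) (row_mx 0 (Yvec R n2)) = Yvec R n.
Proof.
apply/rowP => j; rewrite castmxE row_mx01E cast_ord_id /=.
case: (split_ordP (cast_ord (esym e) j)) => i ij.
  rewrite ij row_mxEl mxE; have := congr1 val ij; rewrite /= => ->.
  by rewrite ltn_eqF //; have := ltn_ord i; lia.
rewrite ij row_mxEr row_mx01E; have := congr1 val ij; rewrite /= => ->.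
by congr (_%:R); apply/eqP/eqP; lia.
Qed.

(** * Calabi products *)

Section ConeProduct.
Context {R : realType} {n k n2 : nat}.
Variables (U : set 'rV[R]_n) (F : 'rV[R]_n -> R) (mu : R).
Variables (eta : 'rV[R]_n -> 'rV[R]_n) (B : 'M[R]_(k + 1, n)) (S : 'M[R]_(n, k + 1)).
Variables (c0 : 'rV[R]_(k + 1)) (K : 'M[R]_(n2, n)) (T : 'M[R]_(n, n2)).
Variables (d0 lin : 'rV[R]_n) (f : 'rV[R]_n -> R) (lam : R).
Implicit Types (y z v : 'rV[R]_n).
Local Notation p := (cone_coord S c0).
Hypotheses (dU : is_domain U) (sF : smooth_on U F) (mu0 : 0 < mu).
Hypothesis partialF : forall l y, U y -> partial l F y = eta y 0 l.
Hypothesis BS : B *m S = 1%:M.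
Hypothesis etaP : forall y, U y -> eta y *m (S *m B)^T = eta y.
Hypothesis eta_homogeneous : forall y y' r, U y -> U y' -> r != 0 ->
  p y' = r *: p y -> eta y' = r^-1 *: eta y.
Hypothesis eta_euler : forall y, U y -> ((p y *m B) *m (eta y)^T) 0 0 = - mu^-1.
Hypotheses (KT : K *m T = 1%:M) (TK : S *m B + T *m K = 1%:M).
Local Notation proj := (cone_proj F mu S c0).
Local Notation q y := ((y - d0) *m T).
Let oU : open U. Proof. by case: dU. Qed.
Variable (x0 : 'rV[R]_n).
Hypothesis Ux0 : U x0.
Local Notation M1 := (image_space U proj).
Local Notation toM := (to_image proj Ux0).

Let BT : B *m T = 0.
Proof.
have : B *m (S *m B + T *m K) *m T = B *m T by rewrite TK mulmx1.
rewrite mulmxDr mulmxDl !mulmxA BS mul1mx -[_ *m K *m T]mulmxA KT mulmx1.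
by move=> /(canRL (addKr _)); rewrite addNr.
Qed.

Let KS : K *m S = 0.
Proof.
have : K *m (S *m B + T *m K) *m S = K *m S by rewrite TK mulmx1.
rewrite mulmxDr mulmxDl !mulmxA KT mul1mx -[_ *m B *m S]mulmxA BS mulmx1.
by move=> /(canRL (addKr _)); rewrite addNr.
Qed.

Let recover_base := - (c0 *m B) + d0 *m (T *m K).

(** The affine inverse of [y |-> (p y, q y)]. *)
Let recover (c : 'rV[R]_(k + 1)) (w : 'rV[R]_n2) : 'rV[R]_n := recover_base + (c *m B + w *m K).

Let recoverK y : recover (p y) (q y) = y.
Proof.
rewrite /recover /recover_base /cone_coord mulmxBl mulmxDl mulmxBl -!mulmxA.
by rewrite -{3}[y]mulmx1 -TK mulmxDr !mulmxA; mxlin.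
Qed.

Let p_recover c w : p (recover c w) = c.
Proof.
rewrite /recover /recover_base /cone_coord !mulmxDl mulNmx -!mulmxA BS KS !mulmx1 !mulmx0.
mxlin.
Qed.

Let q_recover c w : q (recover c w) = w.
Proof.
rewrite /recover /recover_base !mulmxDl !mulNmx -!mulmxA BT KT !mulmx1 !mulmx0.
mxlin.
Qed.

(** The choice [t = - mu F] undoes the exponential factor of the projection, so [e^t proj] is affine
    in [y], and [- t / lam^2] becomes [F] once [lam^2 = mu]. *)
Definition product_map y : R * M1 * 'rV[R]_n2 := (- (mu * F y), toM y, q y).
Local Notation h := product_map.

Let cproj y : U y -> {for y, continuous proj}.
Proof. exact: cone_proj_continuous. Qed.

Let lift y y' W : U y -> U y' -> proj y = proj y' -> open W -> W `<=` U -> W y ->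
  \forall z \near y', exists2 w, W w & proj w = proj z.
Proof. exact: (cone_proj_lift oU sF partialF BS etaP eta_homogeneous). Qed.

Let expproj y : expR (- (mu * F y)) *: proj y = p y.
Proof. by rewrite /cone_proj scalerA -expRD addNr expR0 scale1r. Qed.

Let unpack (z : R * M1 * 'rV[R]_n2) := recover (expR z.1.1 *: image_val z.1.2) z.2.

Let cunpack : continuous unpack.
Proof.
have cM (m : nat) (M : 'M[R]_(m, n)) : continuous (fun c : 'rV[R]_m => c *m M).
  have -> : (fun c : 'rV[R]_m => c *m M) = fun c => 0 + c *m M.
    by apply: funext => c; rewrite add0r.
  by move=> c; exact: (differentiable_continuous (differentiable_affine 0 M c)).
have c1 : continuous (fun z : R * M1 * 'rV[R]_n2 => expR z.1.1 *: image_val z.1.2).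
  move=> z; apply: cvgZ.
    apply: (@continuous_comp _ _ _ (fun z : R * M1 * 'rV[R]_n2 => z.1.1) expR).
      by apply: (@continuous_comp _ _ _ fst fst); exact: cvg_fst.
    exact: continuous_expR.
  apply: (@continuous_comp _ _ _ (fun z : R * M1 * 'rV[R]_n2 => z.1.2) image_val).
    by apply: (@continuous_comp _ _ _ fst snd); [exact: cvg_fst|exact: cvg_snd].
  exact: (image_val_continuous oU Ux0 cproj).
move=> z.
have hB := @continuous_comp _ _ _ _ (fun c : 'rV[R]_(k + 1) => c *m B) z (c1 z) (cM _ B _).
have c2 : {for z, continuous (fun z : R * M1 * 'rV[R]_n2 => z.2)} by exact: cvg_snd.
have hK := @continuous_comp _ _ _ _ (fun c : 'rV[R]_n2 => c *m K) z c2 (cM _ K _).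
exact: (cvgD (cvg_cst _) (cvgD hB hK)).
Qed.

Lemma product_embedding : open_embedding_on U h.
Proof.
split=> //.
- move=> y Uy.
  have h1 : {for y, continuous (fun y => - (mu * F y))}.
    apply: continuousN; apply: continuousM; first exact: cst_continuous.
    exact: (Ck_cont (sF 0%N) Uy).
  have h2 : {for y, continuous toM} := to_image_continuous oU Uy.
  have h3 : {for y, continuous (fun y => q y)}.
    have -> : (fun y => q y) = (fun y => - (d0 *m T) + y *m T).
      by apply: funext => z; rewrite mulmxBl addrC.
    exact: (differentiable_continuous (differentiable_affine (- (d0 *m T)) T y)).
  exact: (cvg_pair (cvg_pair h1 h2) h3).
- move=> W WU oW; rewrite openE => _ [y0 Wy0 <-].
  have Uy0 := WU _ Wy0.
  have /nbhs_ballP[r /= r0 rW] := open_nbhs_nbhs (conj oW Wy0).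
  have rU : ball y0 r `<=` U by move=> z /rW/WU.
  have un0 : unpack (h y0) = y0.
    by rewrite /unpack /h /= to_imageE // expproj recoverK.
  have oB : open (toM @` ball y0 r).
    by apply: (to_image_open oU lift) => //; exact: ball_open.
  have n1 : \forall z \near h y0, ball y0 r (unpack z).
    by apply: cunpack; rewrite un0; exact: nbhsx_ballx.
  (* A recovered point [y] must also have the prescribed class [m]. This is seen by comparison with
     a representative [y1] of [m] in the same ball, on whose ray [y] lies. *)
  have n2_ : \forall z \near h y0, (toM @` ball y0 r) z.1.2.
    have c2 : continuous (fun z : R * M1 * 'rV[R]_n2 => z.1.2).
      by move=> z; apply: (@continuous_comp _ _ _ fst snd); [exact: cvg_fst|exact: cvg_snd].
    apply: c2; apply: open_nbhs_nbhs; split=> //.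
    by exists y0 => //; exact: ballxx.
  have : \forall z \near h y0, (h @` W) z.
    apply: filterS2 n1 n2_ => -[[t m] w] /= zB [y1 y1B y1m].
    have Uy1 := rU _ y1B.
    pose y := unpack (t, m, w).
    have Uy : U y by exact: rU.
    have mE : image_val m = proj y1 by rewrite -y1m to_imageE.
    have pE : p y = (expR t * expR (mu * F y1)) *: p y1.
      by rewrite /y /unpack p_recover /= mE /cone_proj scalerA.
    have projE : proj y = proj y1.
      apply: (cone_proj_ray oU sF mu0 partialF etaP eta_euler rU y1B zB _ pE).
      by rewrite mulr_gt0 ?expR_gt0.
    exists y; first exact: rW.
    rewrite /h; congr (_, _, _); last exact: q_recover.
      have : (expR (mu * F y) * expR t) *: image_val m = 1 *: image_val m.
        rewrite scale1r mE -[in RHS]projE /cone_proj -scalerA; congr (_ *: _).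
        by rewrite pE /cone_proj scalerA.
      have m0 : image_val m != 0.
        by rewrite mE scaler_eq0 negb_or gt_eqF ?expR_gt0 ?(cone_coord_neq0 mu0 eta_euler).
      move/eqP; rewrite -subr_eq0 -scalerBl scaler_eq0 (negbTE m0) orbF subr_eq0 -expRD.
      rewrite -expR0 => /eqP/expR_inj/eqP; rewrite addrC addr_eq0 => /eqP ->.
      by [].
    by rewrite -y1m; apply: to_image_eq.
  by [].
- move=> y y' /set_mem Uy /set_mem Uy' [muF toMy qy].
  have projE : proj y = proj y' by rewrite -!(to_imageE proj Ux0) // toMy.
  by rewrite -(recoverK y) -(recoverK y') -!expproj projE qy (oppr_inj muF).
Qed.

Hypothesis lam2 : lam ^+ 2 = mu.
Hypothesis fE : forall y, U y -> F y + half_sqnorm (q y) = f y - (lin *m y^T) 0 0.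

(** [col_mx B K] and [row_mx S T] are inverse to each other on both sides, which forces equal
    sizes. *)
Let dims : ((k + 1) + (n2 + 1))%N = (n + 1)%N.
Proof.
have E1 : col_mx B K *m row_mx S T = 1%:M.
  by rewrite mul_col_row BS BT KS KT -scalar_mx_block.
have E2 : row_mx S T *m col_mx B K = 1%:M by rewrite mul_row_col.
have := mulmx1_min E1; have := mulmx1_min E2; lia.
Qed.

(** The linear part of the equivalence: the coordinates [p] and [q], and a shear that subtracts the
    linear part of [f] from the height. [D'] is its inverse. *)
Let D : 'M[R]_(n + 1, (k + 1) + (n2 + 1)) :=
  block_mx S (row_mx T (- lin^T)) 0 (row_mx 0 1%:M).

Let D' : 'M[R]_((k + 1) + (n2 + 1), n + 1) :=
  block_mx B (B *m lin^T) (col_mx K 0) (col_mx (K *m lin^T) 1%:M).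

Let DD' : D *m D' = 1%:M.
Proof.
rewrite /D /D' mulmx_block !mul_row_col !mul0mx !mulmx0 !add0r !addr0 mul1mx TK.
by rewrite !mulmxA mulmx1 addrA -mulmxDl TK mul1mx subrr -scalar_mx_block.
Qed.

Lemma product_equiv : calabi_equiv_open_part U f
  (calabi_product lam (image_val : M1 -> 'rV[R]_(k + 1)) (graph (@half_sqnorm R n2))).
Proof.
exists dims, (castmx (erefl _, dims) D),
  (castmx (erefl _, dims) (row_mx c0 (row_mx (- (d0 *m T)) 0))), h.
split.
- exact: castmx_unit DD'.
- have := castmx_affine dims (Yvec R n) D 0.
  rewrite [castmx _ (0 : 'rV[R]_(_ + _))](_ : _ = 0); last first.
    by apply/matrixP => i j; rewrite castmxE !mxE.
  rewrite !addr0 => ->; rewrite /D mul_row_block !mul0mx !mulmx0 !add0r mul1mx.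
  exact: castmx_Yvec.
- exact: product_embedding.
- move=> y Uy; rewrite castmx_affine; congr castmx.
  rewrite /graph mul_row_block !mulmx0 addr0 mul_scalar_mx add_row_mx.
  rewrite scale_row_mx scaler0 mul_mx_row add_row_mx addr0 add_row_mx addr0.
  rewrite /calabi_product /h to_imageE // expproj scale_row_mx scaler0 opp_row_mx oppr0.
  rewrite add_row_mx addr0 /Yvec scale_row_mx scaler0 opp_row_mx oppr0 add_row_mx addr0.
  congr (row_mx _ (row_mx _ _)); [by rewrite addrC|by rewrite mulmxBl|].
  rewrite scale_scalar_mx mulr1 -scaleNr; apply/matrixP => i j; rewrite !ord1.
  rewrite lam2 !(addmxE, oppmxE, scalemxE).
  have s1 a : (a%:M : 'M[R]_1) 0 0 = a by rewrite mxE eqxx mulr1n.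
  rewrite !s1 mulmxN oppmxE.
  have -> : (y *m lin^T) 0 0 = (lin *m y^T) 0 0 by rewrite -[LHS]trmxE trmx_mul trmxK.
  have muN : mu != 0 by rewrite gt_eqF.
  have -> : - mu *: F y / mu = - F y by rewrite -[- mu *: F y]/(- mu * F y); field.
  by rewrite mulr1 opprK addrC -fE // addrC.
Qed.

End ConeProduct.

(** The outer factors of [S B S B = S B] have full rank and can be cancelled. *)
Lemma idempotent_factor {K : fieldType} n (P : 'M[K]_n) : P *m P = P ->
  exists (B : 'M[K]_(\rank P, n)) (S : 'M[K]_(n, \rank P)), B *m S = 1%:M /\ S *m B = P.
Proof.
move=> PP; exists (row_base P), (col_base P); split; last exact: mulmx_base.
have E : col_base P *m (row_base P *m col_base P) *m row_base P = col_base P *m 1%:M *m row_base P.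
  by rewrite mulmx1 mulmx_base [X in X *m _]mulmxA mulmx_base -mulmxA mulmx_base PP.
have /row_fullP[Y YC] := col_base_full P.
have := congr1 (mulmx Y) (row_free_inj (row_base_free P) E).
by rewrite !(mulmxA Y (col_base P)) YC !mul1mx.
Qed.

Lemma ord_add1_eq k (i j : 'I_(k + 1)) : k = 0%N -> i = j.
Proof.
by move=> k0; apply: val_inj; have := ltn_ord i; have := ltn_ord j => /=; lia.
Qed.

(* The sign matters in dimension 0, where the image of v has to be positive. *)
Lemma idempotent_factor_pos {K : realFieldType} n (P : 'M[K]_n) (v : 'rV[K]_n) :
  P *m P = P -> P != 0 -> v *m P != 0 ->
  exists k (B : 'M[K]_(k + 1, n)) (S : 'M[K]_(n, k + 1)),
    [/\ B *m S = 1%:M, S *m B = P & k = 0%N -> forall i, 0 < (v *m S) 0 i].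
Proof.
move=> PP P0 vP; have [k rk] : exists k, \rank P = (k + 1)%N.
  by exists (\rank P).-1; rewrite addn1 prednK // lt0n mxrank_eq0.
have [B [S [BS SB]]] := idempotent_factor PP; move: B S BS SB; rewrite rk => B S BS SB.
exists k; pose c : K := if [forall i, 0 < (v *m S) 0 i] then 1 else -1.
have cc : c * c = 1 by rewrite /c; case: ifP => _; rewrite ?mulr1 ?mulrNN ?mulr1.
exists (c *: B), (c *: S); split.
- by rewrite -scalemxAl -scalemxAr scalerA cc scale1r.
- by rewrite -scalemxAl -scalemxAr scalerA cc scale1r.
move=> k0 i; have vS : (v *m S) 0 i != 0.
  apply: contraNneq vP => vSi; rewrite -SB mulmxA (_ : v *m S = 0) ?mul0mx //.
  apply/rowP => j; rewrite [RHS]mxE -vSi; congr (_ 0 _).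
  exact: ord_add1_eq.
rewrite -scalemxAr scalemxE /c; case: ifPn => [/forallP/(_ i)|]; first by rewrite mul1r.
rewrite negb_forall => /existsP[j]; rewrite -leNgt => vj; rewrite mulN1r oppr_gt0.
by rewrite lt_neqAle vS /= (ord_add1_eq i j).
Qed.

Lemma connected_pos {R : realType} {T : topologicalType} (U : set T) (g : T -> R) x y :
  connected U -> (forall z, U z -> {for z, continuous g}) -> (forall z, U z -> g z != 0) ->
  U x -> U y -> 0 < g x -> 0 < g y.
Proof.
move=> cU cg g0 Ux Uy gx; rewrite ltNge; apply/negP => gy.
have : is_interval (g @` U).
  apply/connected_intervalP/connected_continuous_connected => //.
  by apply: continuous_in_subspaceT => z /set_mem; exact: cg.
move=> itv; have [z Uz gz] : (g @` U) 0.
  by apply: (itv (g y) (g x)); [exists y|exists x|rewrite gy ltW].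
by have := g0 z Uz; rewrite gz eqxx.
Qed.

Lemma half_sqnormE {R : realType} n (w : 'rV[R]_n) : half_sqnorm w = 2^-1 * (w *m w^T) 0 0.
Proof.
by rewrite /half_sqnorm mxE; congr (_ * _); apply: eq_bigr => i _; rewrite trmxE expr2.
Qed.

(** * The two cases of the classification *)

Section Classification.
Context {R : realType} {n : nat}.
Variables (U : set 'rV[R]_n) (f : 'rV[R]_n -> R).
Variables (G : 'rV[R]_n -> 'M[R]_n) (L : 'rV[R]_n -> {linear 'rV[R]_n -> 'M[R]_n}).
Variables (x0 e0 : 'rV[R]_n).
Hypotheses (dU : is_domain U) (Ux0 : U x0) (sf : smooth_on U f) (sG : msmooth U G).
Hypotheses (Gpos : forall y, U y -> posdef (G y)) (Gsym : forall y, U y -> (G y)^T = G y).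
Local Notation L0 := (L x0).
Local Notation G0 := (G x0).
Local Notation H0 := (invmx G0).
Local Notation P := (L0 e0).
Hypothesis sL : forall z, msmooth U (fun y => L y z).
Hypotheses (Lc : forall y u w, U y -> u *m L y w = w *m L y u)
  (Ls : forall y v, U y -> L y v *m G y = G y *m (L y v)^T).
Hypothesis pdG : forall l y, U y -> pd l G y = - 2 *: (L y (delta_mx 0 l) *m G y).
Hypothesis pdL : forall l z y, U y -> pd l (fun y => L y z) y =
  L y z *m L y (delta_mx 0 l) - L y (delta_mx 0 l) *m L y z - L y (z *m L y (delta_mx 0 l)).
Hypothesis pd_grad : forall l y, U y -> pd l (fun y => \row_j partial j f y) y = delta_mx 0 l *m G y.
Hypothesis invG : forall y, U y -> invmx (G y) = H0 *m
  (1%:M + 2 *: L0 (y - x0) + 2 *: (L0 (y - x0) *m L0 (y - x0)) - L0 ((y - x0) *m L0 (y - x0))).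
Hypothesis invGL : forall y w, U y -> invmx (G y) *m L y w =
  H0 *m (L0 w + L0 (y - x0) *m L0 w + L0 w *m L0 (y - x0) - L0 ((y - x0) *m L0 w)).
Hypotheses (eP : e0 *m P = e0) (PP : P *m P = P)
  (PL : forall x, P *m L0 x = L0 x) (LP0 : forall x, L0 (x *m P) = L0 x).
Implicit Types (x y z : 'rV[R]_n).

Let oU : open U. Proof. by case: dU. Qed.
Let Gu y : U y -> G y \in unitmx. Proof. by move=> Uy; exact/posdef_unit/Gpos. Qed.
Local Notation ef := (unit_field L x0 e0).
Local Notation eta := (gradient G L x0 e0).
Local Notation F := (potential f G L x0 e0).
Local Notation lin := (linear_part f G L x0 e0).

Let partialF l y : U y -> partial l F y = eta y 0 l.
Proof. exact: (partial_potential dU Ux0 sf sG Gu Gsym Lc Ls pdG pd_grad invG invGL PL LP0). Qed.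

Let sF : smooth_on U F. Proof. exact: smooth_potential. Qed.

Let quadE m (T : 'M[R]_(n, m)) y : T *m T^T = (1%:M - P) *m G0 ->
  half_sqnorm ((y - x0) *m T) = 2^-1 * quadratic_part G L x0 e0 y.
Proof.
move=> TT; rewrite half_sqnormE /quadratic_part; congr (_ * _).
by rewrite trmx_mul -TT !mulmxA.
Qed.

Lemma flat_classification : P = 0 -> calabi_equiv_open_part U f (graph (@half_sqnorm R n)).
Proof.
move=> P0; have e00 : e0 = 0 by rewrite -eP P0 mulmx0.
have eta0 y : eta y = 0.
  by rewrite /gradient /unit_field e00 -[in X in _ + X]e00 P0 mulmx0 addr0 mul0mx oppr0.
have Fcst y : U y -> F y = F x0.
  move=> Uy; apply: (partial0_cst dU) => // [z|l z Uz]; first exact: smooth_differentiable.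
  by rewrite partialF // eta0 mxE.
have [K KG] : exists K : 'M[R]_n, K *m G0 *m K^T = 1%:M.
  have [K [_ KG]] := orthonormal_basis (Gsym Ux0) (Gpos Ux0) 1%:M.
  by move: K KG; rewrite mxrank1 => K KG; exists K.
(* The inverse of the orthonormal basis [K]; since [T] times its transpose is [G0], it brings the
   quadratic part to the standard form. *)
pose T := G0 *m K^T.
have KT : K *m T = 1%:M by rewrite mulmxA.
have TK := mulmx1C KT.
have TT : T *m T^T = (1%:M - P) *m G0.
  by rewrite P0 subr0 mul1mx {2}/T trmx_mul trmxK (Gsym Ux0) mulmxA TK mul1mx.
exists (erefl _), (block_mx T (- lin^T) 0 1%:M), (row_mx (- (x0 *m T)) (- F x0)%:M),
  (fun y => - (x0 *m T) + y *m T); split.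
- by rewrite unitmxE det_ublock det1 mulr1 -unitmxE; have [] := mulmx1_unit TK.
- by rewrite mul_row_block !mul0mx mulmx0 !add0r mulmx1.
- exact: affine_embedding TK.
move=> y Uy; rewrite castmx_id /graph mul_row_block mulmx0 addr0 mulmx1 add_row_mx.
rewrite [y *m T + _]addrC; congr row_mx.
have -> : - (x0 *m T) + y *m T = (y - x0) *m T by rewrite mulmxBl addrC.
rewrite (quadE y TT) -(Fcst y Uy) /potential.
apply/matrixP => i j; rewrite !ord1 !(addmxE, oppmxE) mulmxN oppmxE.
have -> : (y *m lin^T) 0 0 = (lin *m y^T) 0 0 by rewrite -[LHS]trmxE trmx_mul trmxK.
by rewrite !mxE eqxx !mulr1n; lra.
Qed.

Lemma product_classification : P != 0 ->
  exists (n1 n2 : nat) (M1 M2 : topologicalType)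
         (phi : M1 -> 'rV[R]_(n1 + 1)) (psi : M2 -> 'rV[R]_(n2 + 1)) (lam : R),
    [/\ (n1 + n2 + 1 = n)%N /\ lam != 0,
        centroaffine_hypersurface phi, centroaffine_parallel phi,
        calabi_hypersurface psi /\ calabi_parallel psi
      & calabi_equiv_open_part U f (calabi_product lam phi psi)].
Proof.
move=> P0.
have e00 : e0 != 0.
  by apply: contra_neq P0 => ->; exact: linear0.
have [k [B [S [BS SB eSpos]]]] : exists k (B : 'M[R]_(k + 1, n)) (S : 'M[R]_(n, k + 1)),
    [/\ B *m S = 1%:M, S *m B = P & k = 0%N -> forall i, 0 < (e0 *m S) 0 i].
  by apply: idempotent_factor_pos => //; rewrite eP.
have mu0 : 0 < (e0 *m G0 *m e0^T) 0 0 by exact: Gpos.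
(* The inverse of the constant in [gradient_unit_field]: the exponential of [mu F] then decays along
   rays exactly as the unit field grows. *)
pose mu := ((e0 *m G0 *m e0^T) 0 0)^-1.
have mu_gt0 : 0 < mu by rewrite invr_gt0.
pose c0 := e0 *m S - x0 *m S.
have pE y : cone_coord S c0 y = e0 *m S + (y - x0) *m S.
  by rewrite /cone_coord /c0 mulmxBl addrAC addrA.
have pB y : cone_coord S c0 y *m B = ef y.
  by rewrite pE mulmxDl -!mulmxA SB eP.
(* An orthonormal basis of the annihilator, with dual coordinates [T], makes the second factor the
   standard paraboloid. *)
have [n2 [K [KP KG]]] : exists n2 (K : 'M[R]_(n2, n)),
    (K :=: 1%:M - P)%MS /\ K *m G0 *m K^T = 1%:M.
  have [K KE] := orthonormal_basis (Gsym Ux0) (Gpos Ux0) (1%:M - P).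
  by exists (\rank (1%:M - P)), K.
pose T := G0 *m K^T.
have KT : K *m T = 1%:M by rewrite mulmxA.
have TK : T *m K = 1%:M - P.
  have /submxP[Z ZE] : (1%:M - P <= K)%MS by rewrite KP.
  have /submxP[Z' Z'E] : (K <= 1%:M - P)%MS by rewrite KP.
  have KP0 : K *m P = 0 by rewrite Z'E -mulmxA mulmxBl mul1mx PP subrr mulmx0.
  (* As [P] is self-adjoint for [G0], its image is orthogonal to the annihilator. *)
  have PT : P *m T = 0.
    by rewrite /T mulmxA (PG0 e0 Ux0 Ls) -mulmxA -trmx_mul KP0 trmx0 mulmx0.
  have TE : T = (1%:M - P) *m T by rewrite mulmxBl PT mul1mx subr0.
  rewrite TE {1}ZE.
  by rewrite -[Z *m K *m T]mulmxA KT mulmx1 -ZE.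
have SBTK : S *m B + T *m K = 1%:M by rewrite SB TK addrC subrK.
have TT : T *m T^T = (1%:M - P) *m G0.
  by rewrite {2}/T trmx_mul trmxK (Gsym Ux0) mulmxA TK.
have etaE y : U y -> eta y = - (cone_coord S c0 y *m B *m G y) by rewrite pB.
have etaP y : U y -> eta y *m (S *m B)^T = eta y.
  by move=> Uy; rewrite SB; exact: (gradientP Ux0 Gu Ls invG invGL eP PP PL LP0).
have eta_hom y y' r : U y -> U y' -> r != 0 -> cone_coord S c0 y' = r *: cone_coord S c0 y ->
    eta y' = r^-1 *: eta y.
  move=> Uy Uy' r0 E; apply: (gradient_homogeneous Ux0 Gu Lc Ls invG invGL eP PP PL LP0) => //.
  by rewrite -!pB E scalemxAl.
have eta_eul y : U y -> ((cone_coord S c0 y *m B) *m (eta y)^T) 0 0 = - mu^-1.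
  move=> Uy; rewrite pB /mu invrK.
  rewrite -(gradient_unit_field dU Ux0 sG Gu Gsym Lc Ls pdG invG invGL PL LP0 Uy).
  by rewrite -[LHS]trmxE trmx_mul trmxK.
have LP y v : U y -> L y v *m (S *m B) = L y v.
  by move=> Uy; rewrite SB; exact: (LmulP Ux0 Gu Lc Ls invG invGL PL LP0).
have Lp y : U y -> L y (cone_coord S c0 y *m B) = S *m B.
  by move=> Uy; rewrite pB SB; exact: (Lmul_unit_field Ux0 Gu Ls invG invGL PL LP0).
have pd_eta l y : U y -> pd l eta y = delta_mx 0 l *m (S *m B) *m G y.
  by move=> Uy; rewrite SB; exact: (pd_gradient dU Ux0 sG Gu Lc Ls pdG invG invGL PL LP0).
have seta : msmooth U eta by exact: msmooth_gradient.
have p_pos : k = 0%N -> forall y, U y -> forall i, 0 < cone_coord S c0 y 0 i.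
  (* For [k = 0] the only coordinate is a nonvanishing function on a connected domain, so it keeps
     the sign at [x0], which the choice of [S] made positive. *)
  move=> k0 y Uy i.
  apply: (@connected_pos R _ U (fun y => cone_coord S c0 y 0 i) x0 y) => //.
  - by case: dU.
  - move=> z _; apply: (@continuous_comp _ _ _ (cone_coord S c0) (fun M : 'rV[R]_(k + 1) => M 0 i)).
      exact: (differentiable_continuous (differentiable_affine c0 S z)).
    exact: coord_continuous.
  - move=> z Uz; apply: contraNneq (cone_coord_neq0 mu_gt0 eta_eul Uz) => pzi.
    apply/eqP/rowP => j; rewrite [RHS]mxE -pzi; congr (_ 0 _).
    exact: ord_add1_eq.
  - by rewrite pE subrr mul0mx addr0; exact: eSpos.
have fE y : U y -> F y + half_sqnorm ((y - x0) *m T) = f y - (lin *m y^T) 0 0.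
  by move=> Uy; rewrite (quadE y TT) /potential; lra.
have lam2 : Num.sqrt mu ^+ 2 = mu by rewrite sqr_sqrtr // ltW.
have equiv := product_equiv dU sF mu_gt0 partialF BS etaP eta_hom eta_eul KT SBTK Ux0 lam2 fE.
have dims : (k + n2 + 1 = n)%N by have [e _] := equiv; lia.
exists k, n2, (image_space U (cone_proj F mu S c0)), 'rV[R]_n2,
  image_val, (graph (@half_sqnorm R _)), (Num.sqrt mu); split => //.
- by split=> //; rewrite gt_eqF // sqrtr_gt0.
- exact: (cone_centroaffine_hypersurface dU sF mu_gt0 sG sL seta BS Gsym Gpos Lc Ls LP Lp
    partialF etaE etaP eta_hom eta_eul pdG pd_eta pdL p_pos Ux0).
- exact: (cone_centroaffine_parallel dU sF mu_gt0 sG sL seta BS Gsym Gpos Lc Ls LP Lp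
    partialF etaE etaP eta_hom eta_eul pdG pd_eta pdL Ux0).
- by split; [exact: calabi_hypersurface_paraboloid|exact: calabi_parallel_paraboloid].
Qed.

End Classification.

Theorem theorem1p1 (R : realType) (n : nat)
    (Omega : set 'rV[R]_n) (f : 'rV[R]_n -> R) :
  is_domain Omega ->
  smooth_on Omega f ->
  strictly_convex_on Omega f ->
  parallel_cubic Omega (graph f) (fun=> Yvec R n) ->
  [\/ calabi_equiv_open_part Omega f (graph (@half_sqnorm R n)) /\
      zero_cubic Omega (graph f) (fun=> Yvec R n),

      exists (n1 : nat) (M1 : topologicalType) (phi : M1 -> 'rV[R]_(n1 + 1))
             (lam : R),
        [/\ (n1 + 1 = n)%N, lam != 0,
            centroaffine_hypersurface phi, centroaffine_parallel phi
          & calabi_equiv_open_part Omega f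
              (calabi_product_centroaffine_point lam phi)],

      exists (n2 : nat) (M2 : topologicalType) (psi : M2 -> 'rV[R]_(n2 + 1))
             (lam : R),
        [/\ (n2 + 1 = n)%N, lam != 0,
            calabi_hypersurface psi, calabi_parallel psi
          & calabi_equiv_open_part Omega f
              (calabi_product_calabi_point lam psi)]
    | exists (n1 n2 : nat) (M1 M2 : topologicalType)
             (phi : M1 -> 'rV[R]_(n1 + 1)) (psi : M2 -> 'rV[R]_(n2 + 1))
             (lam : R),
        [/\ (n1 + n2 + 1 = n)%N /\ lam != 0,
            centroaffine_hypersurface phi, centroaffine_parallel phi,
            calabi_hypersurface psi /\ calabi_parallel psi
          & calabi_equiv_open_part Omega f (calabi_product lam phi psi)]].
Proof.
move=> dU sf cf par; have [oU _ [x0 Ux0]] := dU.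
pose L y : {linear 'rV[R]_n -> 'M[R]_n} := Lmul f y.
have sG := msmooth_hessian oU sf.
have Lc y u w : Omega y -> u *m L y w = w *m L y u by exact: (Lmul_comm dU sf).
have Ls y v : Omega y -> L y v *m hessian f y = hessian f y *m (L y v)^T.
  exact: (Lmul_sym dU sf cf).
have sL z : msmooth Omega (fun y => L y z).
  exact: (msmooth_Lmul dU sf cf (msmooth_cst z oU)).
have pdG l y : Omega y -> pd l (hessian f) y = - 2 *: (L y (delta_mx 0 l) *m hessian f y).
  exact: (pd_hessian cf).
have pdL l z y : Omega y -> pd l (fun y => L y z) y =
    L y z *m L y (delta_mx 0 l) - L y (delta_mx 0 l) *m L y z - L y (z *m L y (delta_mx 0 l)).
  by move=> Uy; rewrite /L /= (Lmul_delta f y l); exact: (pd_Lmul_cst dU sf cf par l z Uy).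
have pd_grad l y : Omega y ->
    pd l (fun y => \row_j partial j f y) y = delta_mx 0 l *m hessian f y.
  move=> Uy; rewrite -rowE; apply/rowP => j; rewrite rowmxE [RHS]mxE pdE.
  by apply: (partial_ext l oU) => // z _; rewrite mxE.
have [e0 [eP PP PL LP0]] := unit_element (L := L x0) (hessian_sym oU sf Ux0) (cf x0 Ux0)
  (fun u w => Lc x0 w u Ux0) (fun u v z => Lmul_der dU sf cf par u v z Ux0)
  (fun u => Ls x0 u Ux0).
have invG := invhessian_quadratic dU sf cf par Ux0.
have invGL := fun y w => @invhessian_dir R n Omega f dU sf cf par x0 Ux0 y w.
have Gsym := hessian_sym oU sf.
(* By [PL] the idempotent fixes all products, so [P = 0] makes the product at [x0] zero;
   [Lmul_kernel] transfers this to every point and gives the vanishing cubic form. *)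
have [P0|P0] := eqVneq (L x0 e0) 0; [apply: Or41; split|apply: Or44].
- exact: (flat_classification dU Ux0 sf sG cf Gsym Lc Ls pdG pd_grad invG invGL eP PL LP0 P0).
- move=> y Uy m i j; rewrite (graph_cubic oU sf) // -Lmul_delta.
  have k0 : L x0 (delta_mx 0 i) = 0 by rewrite -PL P0 mul0mx.
  by rewrite (Lmul_kernel (fun y => hessian_unit cf (x := y)) invGL Uy k0) mxE.
- exact: (product_classification dU Ux0 sf sG cf Gsym sL Lc Ls pdG pdL pd_grad invG invGL
    eP PP PL LP0 P0).
Qed.
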